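(* Let $\mu_0,\mu_1\in\mathcal M(\mathbb R;S)$. (1) If the infimum $W:=\inf\{\mathbf E_1(\mu,w):(\mu,w)\in\mathscr C_1(\mu_0\to\mu_1)\}$ (so that $\mathbf W_{\mathbf M}(\mu_0,\mu_1)=W^{1/2}$) is finite, then it is attained by a curve $(\mu,w)\in\mathscr C_1(\mu_0\to\mu_1)$, for which one has $$\mathbf\Phi(\mu_t,w_t)=W\quad\text{for a.e. }t\in(0,1).$$ Consequently, $$\mathbf W_{\mathbf M}(\mu_s,\mu_t)=|t-s|\,\mathbf W_{\mathbf M}(\mu_0,\mu_1)\quad\text{for all }s,t\in[0,1].$$ (2) For all $T>0$, $$\mathbf W_{\mathbf M}(\mu_0,\mu_1)=\Big[\inf\big\{T\,\mathbf E_T(\mu,w):(\mu,w)\in\mathscr C_T(\mu_0\to\mu_1)\big\}\Big]^{1/2}=\inf\Big\{\int_0^T[\mathbf\Phi(\mu_t,w_t)]^{1/2}\,dt:(\mu,w)\in\mathscr C_T(\mu_0\to\mu_1)\Big\}.$$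
   Context: Let $S\subset\mathbb R^n$ be convex and compact with nonempty interior $\mathrm{int}(S)$. $\mathcal M(\mathbb R;A)$ denotes the set of measurable functions $\mathbb R\to A$ (identified almost everywhere). The mobility matrix $\mathbf M:S\to\mathbb R^{n\times n}$ satisfies: (C0) $\mathbf M$ is continuous on $S$ and smooth on $\mathrm{int}(S)$; (C1) $\mathbf M(z)$ is symmetric positive definite for each $z\in\mathrm{int}(S)$; (C2) $\mathrm D^2\mathbf M(z)[\zeta,\zeta]$ is negative semidefinite for each $z\in\mathrm{int}(S)$, $\zeta\in\mathbb R^n$; (C3) $\mathbf M(z)\nu=0$ if $z\in\partial S$ and $\nu$ is a normal vector to $\partial S$ at $z$. Let $\tilde\phi(z,p)=p^{\mathrm T}\mathbf M(z)^{-1}p$ on $\mathrm{int}(S)\times\mathbb R^n$ and let $\phi:S\times\mathbb R^n\to[0,\infty]$ be its lower semicontinuous envelope, $\phi(\tilde z,\tilde p)=\liminf_{(z,p)\to(\tilde z,\tilde p)}\tilde\phi(z,p)$ (with $(z,p)\in\mathrm{int}(S)\times\mathbb R^n$). The action functional is $\mathbf\Phi(\mu,w)=\int_{\mathbb R}\phi(\mu(x),w(x))\,dx$ for $\mu\in\mathcal M(\mathbb R;S)$, $w\in\mathcal M(\mathbb R;\mathbb R^n)$. For $T>0$, $\mathscr C_T$ is the set of curves $(\mu,w)=(\mu_t,w_t)_{t\in[0,T]}$ such that: $t\mapsto\mu_t\in\mathcal M(\mathbb R;S)$ is weakly$\ast$-continuous (i.e. $t\mapsto\int\mu_t^{\mathrm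 T}\rho\,dx$ is continuous for each $\rho\in C_c^0(\mathbb R;\mathbb R^n)$); $(w_t)$ is a Borel-measurable family in $\mathcal M(\mathbb R;\mathbb R^n)$; $\int_0^T\int_{-R}^R|w_t|\,dx\,dt<\infty$ for each $R>0$; and $\partial_t\mu+\partial_xw=0$ in the sense of distributions on $[0,T]\times\mathbb R$. $\mathscr C_T(\hat\mu\to\check\mu)$ is the subset with $\mu|_{t=0}=\hat\mu$, $\mu|_{t=T}=\check\mu$. The energy is $\mathbf E_T(\mu,w)=\int_0^T\mathbf\Phi(\mu_t,w_t)\,dt$, and $\mathbf W_{\mathbf M}(\mu_0,\mu_1)=[\inf\{\mathbf E_1(\mu,w):(\mu,w)\in\mathscr C_1(\mu_0\to\mu_1)\}]^{1/2}\in[0,\infty]$ (with $\inf\emptyset=+\infty$). *)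

(* Defs.v *)
From HB Require Import structures.
From mathcomp Require Import all_boot all_order all_algebra.
From mathcomp Require Import all_classical all_reals all_analysis.

Set Implicit Arguments.
Unset Strict Implicit.
Unset Printing Implicit Defensive.

Import Order.TTheory GRing.Theory Num.Theory.
Import numFieldNormedType.Exports.

Local Open Scope classical_set_scope.
Local Open Scope ring_scope.

Section Smooth.
Context {R : realType} {V W : normedModType R}.

Definition iter_derive (vs : seq V) (f : V -> W) : V -> W :=
  foldr (fun v g => 'D_v g) f vs.

(* C^infinity on an open subset U of a finite-dimensional V: differentiability
   of every iterated directional derivative entails its continuity. *)
Definition smooth_on (U : set V) (f : V -> W) : Prop :=
  forall (vs : seq V) (x : V), U x -> differentiable (iter_derive vs f) x.

Definition support_closure (f : V -> W) : set V := closure [set x | f x != 0].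

End Smooth.

Section Mobility.
Context {R : realType} {n : nat}.
Implicit Types (S : set 'cV[R]_n) (M : 'cV[R]_n -> 'M[R]_n).

Definition dotv (u v : 'cV[R]_n) : R := (u^T *m v) 0 0.

Definition qform (A : 'M[R]_n) (v : 'cV[R]_n) : R := (v^T *m A *m v) 0 0.

Definition sym_posdef (A : 'M[R]_n) : Prop :=
  A^T = A /\ forall v, v != 0 -> 0 < qform A v.

Definition neg_semidef (A : 'M[R]_n) : Prop :=
  A^T = A /\ forall v, qform A v <= 0.

Definition boundary S : set 'cV[R]_n := closure S `\` S°.

(* Outer normals in the sense of convex analysis, so that S may have corners;
   0 is included. *)
Definition normal_at S (z nu : 'cV[R]_n) : Prop :=
  forall y, S y -> dotv nu (y - z) <= 0.

(* M is a total function; its values off S are never used. *)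
Definition mobility S M : Prop :=
  [/\ {within S, continuous M} /\ smooth_on S° M,
      forall z, S° z -> sym_posdef (M z),
      forall z zeta, S° z -> neg_semidef ('D_zeta ('D_zeta M) z) &
      forall z nu, boundary S z -> normal_at S z nu -> M z *m nu = 0].

Definition phi_int M (zp : 'cV[R]_n * 'cV[R]_n) : \bar R :=
  (qform (invmx (M zp.1)) zp.2)%:E.

Definition phi S M (zp : 'cV[R]_n * 'cV[R]_n) : \bar R :=
  limf_einf (phi_int M) (within (S° `*` setT) (nbhs zp)).

(* Borel measurability of f : R -> R^n, stated componentwise. Elements of
   M(R; A) are represented by Borel functions with values everywhere in A. *)
Definition Mfun (A : set 'cV[R]_n) (f : R -> 'cV[R]_n) : Prop :=
  (forall i, measurable_fun [set: R] (fun x : R => f x i 0)) /\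
  forall x, A (f x).

Definition ae_equal (f g : R -> 'cV[R]_n) : Prop :=
  {ae (@lebesgue_measure R), forall x, f x = g x}.

Definition Phi S M (mu w : R -> 'cV[R]_n) : \bar R :=
  (\int[lebesgue_measure]_x phi S M (mu x, w x))%E.

Definition weakstar_continuous (T : R) (mu : R -> R -> 'cV[R]_n) : Prop :=
  forall rho : R -> 'cV[R]_n,
    continuous rho -> compact (support_closure rho) ->
    {within `[0%R, T]%classic, continuous
      (fun t : R => \int[lebesgue_measure]_x dotv (mu t x) (rho x))}.

(* A Borel family (w_t) is given by a representative that is Borel in (t, x). *)
Definition borel_family (T : R) (w : R -> R -> 'cV[R]_n) : Prop :=
  forall i, measurable_fun (`[0, T]%classic `*` [set: R] : set (R * R))
                           (fun tx : R * R => w tx.1 tx.2 i 0).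

(* `|w t x| is the sup norm of R^n, equivalent to the Euclidean one. *)
Definition strip_integrable (T : R) (w : R -> R -> 'cV[R]_n) : Prop :=
  forall r : R, 0 < r ->
    (\int[lebesgue_measure]_(t in `[0%R, T]%classic)
       \int[lebesgue_measure]_(x in `[(- r)%R, r]%classic) `|w t x|%:E
     < +oo)%E.

(* The test functions have compact support in the open strip, so the initial
   and final values do not enter; they are prescribed in curves_between. *)
Definition continuity_eq (T : R) (mu w : R -> R -> 'cV[R]_n) : Prop :=
  forall psi : R * R -> R,
    smooth_on setT psi -> compact (support_closure psi) ->
    support_closure psi `<=` `]0, T[%classic `*` [set: R] ->
    forall i : 'I_n,
      \int[lebesgue_measure]_(t in `[0%R, T]%classic)
        \int[lebesgue_measure]_x
          ('D_((1, 0) : R * R) psi (t, x) * mu t x i 0) +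
      \int[lebesgue_measure]_(t in `[0%R, T]%classic)
        \int[lebesgue_measure]_x
          ('D_((0, 1) : R * R) psi (t, x) * w t x i 0) = 0.

Definition curve : Type :=
  ((R -> R -> 'cV[R]_n) * (R -> R -> 'cV[R]_n))%type.

(* Only the values at times t in [0, T] are relevant. *)
Definition curves S (T : R) : set curve :=
  [set c | [/\ forall t, 0 <= t <= T -> Mfun S (c.1 t),
               weakstar_continuous T c.1,
               borel_family T c.2,
               strip_integrable T c.2 &
               continuity_eq T c.1 c.2]].

Definition curves_between S (T : R) (mu0 mu1 : R -> 'cV[R]_n) : set curve :=
  [set c | [/\ curves S T c, ae_equal (c.1 0) mu0 & ae_equal (c.1 T) mu1]].

Definition energy S M (T : R) (c : curve) : \bar R :=
  (\int[lebesgue_measure]_(t in `[0%R, T]%classic) Phi S M (c.1 t) (c.2 t))%E.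

Definition min_energy S M (mu0 mu1 : R -> 'cV[R]_n) : \bar R :=
  ereal_inf [set energy S M 1 c | c in curves_between S 1 mu0 mu1].

Definition WM S M (mu0 mu1 : R -> 'cV[R]_n) : \bar R :=
  sqrte (min_energy S M mu0 mu1).

End Mobility.

(* Main.v *)
Require Import Defs.
From HB Require Import structures.
From mathcomp Require Import all_boot all_order all_algebra.
From mathcomp Require Import all_classical all_reals all_analysis.
From mathcomp Require Import measurable_realfun ring lra.

Set Implicit Arguments.
Unset Strict Implicit.
Unset Printing Implicit Defensive.

Import Order.TTheory GRing.Theory Num.Theory.
Import numFieldNormedType.Exports.

Local Open Scope classical_set_scope.
Local Open Scope ring_scope.

(** The action density [p^T M(z)^-1 p], extended to [S] by its lower
    semicontinuous envelope, is the supremum over [q] of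
    [2 p.q - q^T M(z) q] ([phi_action_density]). As [M] is concave and continuous
    on [S], this supremum is jointly convex, lower semicontinuous and Borel; as
    [M] is bounded, it controls [|p|^2] ([action_density_coercive]).

    Existence is the direct method. Weak compactness is replaced by convexity:
    the competitors of energy at most [W + 1/(k+1)] form nested sets that are
    closed under midpoints and bounded in a weighted L2, and their elements of
    almost minimal norm form a Cauchy sequence, by the parallelogram identity
    ([nested_midpoint_sets]). So some minimizing sequence converges almost
    everywhere with a square-integrable majorant. Fatou's lemma bounds the energy
    of the limit ([plane_energy_lsc]) and dominated convergence preserves the
    constraint ([minimizer_of_almost]). For this the continuity equation is used
    in the integrated form
    [int m_t rho = int m_0 rho + int_0^t int w_s rho' ds], for all [t] and all
    test functions [rho] of the space variable ([weak_form]), which is equivalent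
    to weak-* continuity together with the equation in the sense of distributions
    ([continuity_eq_weak_form], [weak_form_weakstar], [weak_form_continuity_eq]).

    To operate on the time variable, a curve on [[0, T]] is turned into a flow: a
    jointly Borel representative that is defined for all times ([curve_flow],
    [flow_curve]). Flows can be shifted, reversed, reparametrized by absolutely
    continuous changes of time, and spliced. By Cauchy-Schwarz the length of a
    curve is at most the square root of [T * energy] ([length_le_energy]);
    conversely a reparametrization by arc length makes [T' * energy] as close as
    desired to the square of the length, for every duration [T'] ([arc_length]).
    This identifies the three infima ([WM_length]).

    For a minimizer, the length is at least the distance [sqrt W] and the energy
    is [W]: equality in Cauchy-Schwarz makes the speed constant
    ([minimizer_speed]). Its pieces are then optimal, since a cheaper curve
    between two intermediate times could be spliced in ([minimizer_subcurve]). *)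

(** * Quadratic forms *)

Section QuadraticForms.
Context {R : realType} {n : nat}.
Implicit Types (A : 'M[R]_n) (u v q p z : 'cV[R]_n) (a b : R).

Lemma dotvE u v : dotv u v = \sum_i u i 0 * v i 0.
Proof. by rewrite /dotv mxE; apply: eq_bigr => i _; rewrite mxE. Qed.

Lemma qformE A v : qform A v = \sum_i \sum_j A i j * (v i 0 * v j 0).
Proof.
rewrite /qform mxE exchange_big /=; apply: eq_bigr => i _.
rewrite !mxE mulr_suml; apply: eq_bigr => j _; rewrite !mxE; ring.
Qed.

Lemma dotvC u v : dotv u v = dotv v u.
Proof. by rewrite !dotvE; apply: eq_bigr => i _; rewrite mulrC. Qed.

Lemma dotvDl u1 u2 v : dotv (u1 + u2) v = dotv u1 v + dotv u2 v.
Proof. by rewrite /dotv linearD mulmxDl mxE. Qed.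

Lemma dotvZl a u v : dotv (a *: u) v = a * dotv u v.
Proof. by rewrite /dotv linearZ /= -scalemxAl mxE. Qed.

Lemma dotv0l v : dotv 0 v = 0.
Proof. by rewrite /dotv trmx0 mul0mx mxE. Qed.

Lemma dotvZr a u v : dotv u (a *: v) = a * dotv u v.
Proof. by rewrite dotvC dotvZl dotvC. Qed.

Lemma qformZ a A v : qform A (a *: v) = a ^+ 2 * qform A v.
Proof. by rewrite /qform [(_ *: _)^T]linearZ /= -!scalemxAl -scalemxAr !mxE; ring. Qed.

Lemma qform0 A : qform A 0 = 0.
Proof. by rewrite /qform mulmx0 mxE. Qed.

Lemma qformB A q r : A^T = A ->
  qform A (q - r) = qform A q - 2 * dotv q (A *m r) + qform A r.
Proof.
move=> sA; have e : dotv r (A *m q) = dotv q (A *m r).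
  by rewrite dotvC /dotv trmx_mul sA mulmxA.
have <- : dotv q (A *m q) = qform A q by rewrite /dotv /qform mulmxA.
have <- : dotv r (A *m r) = qform A r by rewrite /dotv /qform mulmxA.
have -> : qform A (q - r) = dotv (q - r) (A *m (q - r)) by rewrite /dotv /qform mulmxA.
have dB (u v w : 'cV[R]_n) : dotv (u - v) w = dotv u w - dotv v w.
  by rewrite dotvDl -scaleN1r dotvZl mulN1r.
have dBr (u v w : 'cV[R]_n) : dotv w (u - v) = dotv w u - dotv w v.
  by rewrite dotvC dB !(dotvC w).
rewrite mulmxBr dB !dBr e; ring.
Qed.

Lemma qform_inv A p : A \in unitmx -> A^T = A ->
  qform (invmx A) p = 2 * dotv p (invmx A *m p) - qform A (invmx A *m p).
Proof.
move=> uA sA; have si : (invmx A)^T = invmx A by rewrite trmx_inv sA.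
have -> : dotv p (invmx A *m p) = qform (invmx A) p by rewrite /dotv /qform mulmxA.
have -> : qform A (invmx A *m p) = qform (invmx A) p.
  rewrite /qform trmx_mul si -[p^T *m _ *m A]mulmxA mulVmx // mulmx1.
  by rewrite mulmxA.
ring.
Qed.

Lemma posdef_unit A : sym_posdef A -> A \in unitmx.
Proof.
case=> sA pA; rewrite -row_free_unit -kermx_eq0.
apply/negPn/negP => /rowV0Pn[v vk vN0].
have vA : v *m A = 0 by apply/sub_kermxP.
have := pA v^T; rewrite /qform trmxK vA mul0mx mxE ltxx.
by rewrite -trmx0 (inj_eq trmx_inj) => /(_ vN0).
Qed.

(** Fenchel-Young for a positive definite quadratic form: the defect is the
    form at [A^-1 p - q]. *)
Lemma qform_inv_ge A p q : sym_posdef A ->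
  2 * dotv p q - qform A q <= qform (invmx A) p.
Proof.
move=> pdA; have uA := posdef_unit pdA; case: pdA => sA pA.
have si : (invmx A)^T = invmx A by rewrite trmx_inv sA.
have : 0 <= qform A (q - invmx A *m p).
  have [->|h] := eqVneq (q - invmx A *m p) 0; first by rewrite qform0.
  exact/ltW/pA.
rewrite qformB // mulmxA mulmxV // mul1mx.
have := qform_inv p uA sA; rewrite (dotvC q p); move: (qform _ q) => a.
have -> : dotv p (invmx A *m p) = qform (invmx A) p by rewrite /dotv /qform mulmxA.
lra.
Qed.

End QuadraticForms.

(** * Concavity of the mobility *)

Section Interior.
Context {R : realType} {n : nat}.
Implicit Types (S : set 'cV[R]_n).

Lemma convex_setE S (x y : 'cV[R]_n) (t : R) : convex_set S -> S x -> S y ->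
  0 <= t <= 1 -> S ((1 - t) *: x + t *: y).
Proof.
move=> cS Sx Sy /andP[t0 t1].
have := cS y x (Itv01 t0 t1) (mem_set Sy) (mem_set Sx).
by rewrite inE /conv /= addrC.
Qed.

(** A ball around the interior point [z0] shrinks homothetically towards [z]. *)
Lemma interior_segment S (z z0 : 'cV[R]_n) (s : R) : convex_set S ->
  S z -> S° z0 -> 0 < s <= 1 -> S° ((1 - s) *: z + s *: z0).
Proof.
move=> cS Sz /nbhs_ballP[e /= e0 he] /andP[s0 s1].
apply/nbhs_ballP; exists (s * e) => /=; first exact: mulr_gt0.
move=> y; rewrite mx_norm_ball /ball_ /= => hy.
have -> : y = (1 - s) *: z + s *: (z0 - s^-1 *: ((1 - s) *: z + s *: z0 - y)).
  by rewrite scalerBr scalerA divff ?gt_eqF // scale1r; apply/colP => i; rewrite !mxE; ring.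
apply: convex_setE => //; last by rewrite (ltW s0).
apply: he; rewrite mx_norm_ball /ball_ /= opprD opprK addrA subrr add0r.
by rewrite normrZ gtr0_norm ?invr_gt0 // ltr_pdivrMl.
Qed.

Lemma segment_cvg (z z0 : 'cV[R]_n) :
  (fun s : R => (1 - s) *: z + s *: z0) @ (0 : R)^'+ --> z.
Proof.
have -> : (fun s : R => (1 - s) *: z + s *: z0) = (fun s => z + s *: (z0 - z)).
  by apply/funext => s; apply/colP => i; rewrite !mxE; ring.
rewrite -[X in _ --> X]addr0 -(scale0r (z0 - z)).
apply: cvgD; first exact: cvg_cst.
by apply: cvgZr_tmp; apply: cvg_at_right_filter; exact: cvg_id.
Qed.

Lemma segment_within S (z z0 : 'cV[R]_n) : convex_set S -> S z -> S° z0 ->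
  (fun s : R => (1 - s) *: z + s *: z0) @ (0 : R)^'+ --> within S (nbhs z).
Proof.
move=> cS Sz Sz0 A /= wA.
have : \forall s \near (0 : R)^'+, S ((1 - s) *: z + s *: z0).
  near=> s; apply: interior_subset; apply: interior_segment => //.
  by apply/andP; split; near: s; [exact: nbhs_right_gt | exact: nbhs_right_le].
have := @segment_cvg z z0 _ wA; rewrite /nbhs /= /within /=.
by apply: filterS2 => s /= h1 h2; exact: h1.
Unshelve. all: by end_near.
Qed.

End Interior.

Lemma cvg_combination (R : realType) (T : Type) (F : set_system T) {FF : Filter F}
    (f g : T -> R) (s t a b : R) :
  f x @[x --> F] --> a -> g x @[x --> F] --> b ->
  s * f x + t * g x @[x --> F] --> s * a + t * b.
Proof. by move=> fa gb; apply: cvgD; apply: cvgMl_tmp. Qed.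

Section Concavity.
Context {R : realType} {n : nat}.
Variables (S : set 'cV[R]_n) (M : 'cV[R]_n -> 'M[R]_n).
Hypotheses (cS : convex_set S) (intS : S° !=set0) (mobM : mobility S M).

Let qf (q : 'cV[R]_n) (A : 'M[R]_n) : R := qform A q.

Let qf_is_linear q : linear (qf q).
Proof.
move=> a A B; rewrite /qf !qformE.
rewrite scaler_sumr -big_split; apply: eq_bigr => i _ /=.
rewrite scaler_sumr -big_split; apply: eq_bigr => j _ /=.
by rewrite !mxE /GRing.scale /=; ring.
Qed.

HB.instance Definition _ q := GRing.isLinear.Build R _ _ _ (qf q) (qf_is_linear q).

Let qf_continuous q : continuous (qf q).
Proof.
rewrite (_ : qf q = fun A => \sum_i \sum_j A i j * (q i 0 * q j 0)); last first.
  by apply/funext => B; rewrite /qf qformE.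
have cc i j (c : R) : continuous (fun A : 'M[R]_n => A i j * c).
  by move=> A; exact: cvgM (@coord_continuous R n n i j A) (cvg_cst c).
apply: (continuous_big add_continuous) => i _.
apply: (continuous_big add_continuous) => j _; exact: cc.
Qed.

Lemma qform_cvg q z : S z ->
  qform (M z') q @[z' --> within S (nbhs z)] --> qform (M z) q.
Proof.
case: mobM => -[/subspace_continuousP cM _] _ _ _ Sz.
by apply: (@cvg_comp _ _ _ M (qf q) _ (nbhs (M z))); [exact: cM | exact: qf_continuous].
Qed.

Let deriv_line (f : 'cV[R]_n -> 'M[R]_n) q x v (s : R) :
  differentiable f (x + s *: v) ->
  is_derive s 1 (fun s => qform (f (x + s *: v)) q) (qform ('D_v f (x + s *: v)) q).
Proof.
move=> df.
have dc : differentiable (qf q \o f) (x + s *: v).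
  apply: differentiable_comp => //; apply: linear_differentiable; exact: qf_continuous.
have dv := @diff_derivable _ _ _ _ _ v dc.
have e : 'D_v (qf q \o f) (x + s *: v) = qform ('D_v f (x + s *: v)) q.
  rewrite !deriveE // diff_comp //=; last by apply: linear_differentiable; exact: qf_continuous.
  by rewrite diff_lin //; exact: qf_continuous.
have eq : (fun h : R => h^-1 *: (qf q (f (x + (h *: 1 + s) *: v)) - qf q (f (x + s *: v))))
     = (fun h : R => h^-1 *: ((qf q \o f) (h *: v + (x + s *: v)) - (qf q \o f) (x + s *: v))).
  apply/funext => h /=; congr (_ *: (qf q (f _) - _)).
  by rewrite scalerDl [h *: 1]mulr1 addrCA.
split.
  by rewrite /derivable /= /shift; move: dv; rewrite /derivable -eq.
by rewrite -e /derive -eq.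
Qed.

(** Along a segment inside the interior, [q^T M q] has a nonpositive second
    derivative. *)
Let concave_int q x y (t : R) : S° x -> S° y -> 0 < t < 1 ->
  (1 - t) * qform (M x) q + t * qform (M y) q <=
  qform (M ((1 - t) *: x + t *: y)) q.
Proof.
case: mobM => -[_ smM] _ ndM _ Sx Sy /andP[t0 t1].
pose v := y - x; pose p (s : R) := x + s *: v.
have Sp (s : R) : 0 <= s <= 1 -> S° (p s).
  have -> : p s = (1 - s) *: x + s *: y.
    by apply/colP => i; rewrite !mxE; ring.
  move=> /andP[]; rewrite le_eqVlt => /orP[/eqP <- _|s0 s1].
    by rewrite subr0 scale1r scale0r addr0.
  by apply: interior_segment => //; [exact: interior_subset | rewrite s0].
have d1 (s : R) : 0 <= s <= 1 -> is_derive s 1 (fun s => qform (M (p s)) q) (qform ('D_v M (p s)) q).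
  by move=> s01; apply: deriv_line; exact: (smM [::] _ (Sp _ s01)).
have d2 (s : R) : 0 <= s <= 1 -> is_derive s 1 (fun s => qform ('D_v M (p s)) q)
    (qform ('D_v ('D_v M) (p s)) q).
  by move=> s01; apply: deriv_line; exact: (smM [:: v] _ (Sp _ s01)).
have itvW (a b c : R) : 0 <= a -> b <= 1 -> c \in `]a, b[ -> 0 <= c <= 1.
  by move=> a0 b1; rewrite in_itv /= => /andP[]; move=> *; lra.
have cont (f df : R -> R) (a b : R) : 0 <= a -> b <= 1 ->
    (forall s : R, 0 <= s <= 1 -> is_derive s 1 f (df s)) -> {within `[a, b], continuous f}.
  move=> a0 b1 dff; apply: derivable_within_continuous => s.
  rewrite in_itv /= => /andP[as_ sb].
  have s01 : 0 <= s <= 1 by apply/andP; split; lra.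
  by have [] := dff s s01.
have [c1 c1i e1] := MVT t0 (fun s si => d1 s (itvW _ _ _ (lexx 0) (ltW t1) si))
  (cont _ _ _ _ (lexx 0) (ltW t1) d1).
have [c2 c2i e2] := MVT t1 (fun s si => d1 s (itvW _ _ _ (ltW t0) (lexx 1) si))
  (cont _ _ _ _ (ltW t0) (lexx 1) d1).
have c12 : c1 < c2 by move: c1i c2i; rewrite !in_itv /= => /andP[_ c1t] /andP[c2t _]; exact: lt_trans c1t c2t.
have c1_0 : 0 <= c1 by move: c1i; rewrite in_itv /= => /andP[/ltW].
have c2_1 : c2 <= 1 by move: c2i; rewrite in_itv /= => /andP[_ /ltW].
have [c3 c3i e3] := MVT c12 (fun s si => d2 s (itvW _ _ _ c1_0 c2_1 si))
  (cont _ _ _ _ c1_0 c2_1 d2).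
have n3 : qform ('D_v ('D_v M) (p c3)) q <= 0.
  by have [|_ ->] := ndM (p c3) v _; first by apply: Sp; exact: itvW c3i.
have p0 : p 0 = x by rewrite /p scale0r addr0.
have p1 : p 1 = y by rewrite /p scale1r addrC subrK.
have pt : p t = (1 - t) *: x + t *: y by apply/colP => i; rewrite !mxE; ring.
rewrite -pt -{1}p0 -p1; move: e1 e2 e3 n3.
set A := qform (M (p t)) q; set B := qform (M (p 0)) q; set C := qform (M (p 1)) q.
set D1 := qform _ q; set D2 := qform _ q; set D3 := qform _ q => e1 e2 e3 n3.
move: t0 t1 e1 e2 e3 n3 c12; clearbody A B C D1 D2 D3; clear => t0 t1 e1 e2 e3 n3 c12.
have h : 0 <= D1 - D2.
  by rewrite -opprB e3 oppr_ge0 mulr_le0_ge0 // subr_ge0 ltW.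
have h2 : 0 <= t * (1 - t) * (D1 - D2).
  by apply: mulr_ge0 h; apply: mulr_ge0; rewrite ?subr_ge0 ltW.
have -> : B = A - D1 * t by rewrite -[t in D1 * t]subr0 -e1 opprB addrC subrK.
have -> : C = A + D2 * (1 - t) by rewrite -e2 addrC subrK.
lra.
Qed.

(** Points of [S] are approached from the interior along segments, where
    [concave_int] applies. *)
Lemma concave_mobility q x y (t : R) : S x -> S y -> 0 <= t <= 1 ->
  (1 - t) * qform (M x) q + t * qform (M y) q <=
  qform (M ((1 - t) *: x + t *: y)) q.
Proof.
move=> Sx Sy /andP[]; rewrite le_eqVlt => /orP[/eqP <- _|t0].
  by rewrite subr0 !scale1r !scale0r !addr0 mul1r mul0r addr0.
rewrite le_eqVlt => /orP[/eqP ->|t1].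
  by rewrite subrr !scale1r !scale0r !add0r mul1r mul0r add0r.
have [z0 Sz0] := intS.
have Sxy : S ((1 - t) *: x + t *: y) by apply: convex_setE; rewrite // !ltW.
pose seg (z : 'cV[R]_n) (s : R) := (1 - s) *: z + s *: z0.
have lim z : S z -> qform (M (seg z s)) q @[s --> (0 : R)^'+] --> qform (M z) q.
  move=> Sz; exact: (@cvg_comp _ _ _ (seg z) (fun z' => qform (M z') q) _ _ _
    (segment_within cS Sz Sz0) (qform_cvg Sz)).
have segE s : seg ((1 - t) *: x + t *: y) s = (1 - t) *: seg x s + t *: seg y s.
  by apply/colP => i; rewrite !mxE; ring.
apply: (@ler_cvg_to _ ((0 : R)^'+) _ _ (fun s => (1 - t) * qform (M (seg x s)) q + t * qform (M (seg y s)) q)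
   (fun s => qform (M (seg ((1 - t) *: x + t *: y) s)) q)).
- exact: cvg_combination (lim x Sx) (lim y Sy).
- exact: lim.
near=> s; rewrite segE; apply: concave_int; last by rewrite t0.
  apply: interior_segment => //; apply/andP; split; near: s; [exact: nbhs_right_gt | exact: nbhs_right_le].
apply: interior_segment => //; apply/andP; split; near: s; [exact: nbhs_right_gt | exact: nbhs_right_le].
Unshelve. all: by end_near.
Qed.

End Concavity.

(** * Convergence and measurability of vector-valued maps *)

Section MatrixConvergence.
Context {R : realType} {n : nat}.

Lemma cvg_cV (T : Type) (F : set_system T) {FF : Filter F}
    (u : T -> 'cV[R]_n) (l : 'cV[R]_n) :
  (forall i, u x i 0 @[x --> F] --> l i 0) -> u @ F --> l.
Proof.
move=> h; apply/cvg_ballP => e e0.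
have : \forall x \near F, forall i, `|l i 0 - u x i 0| < e.
  by apply: filter_forall => i; move/cvgrPdist_lt : (h i); exact.
by apply: filterS => x hx; split => // i j; rewrite ord1; exact: hx.
Qed.

Lemma cV_norm_lt (u : 'cV[R]_n) (e : R) : 0 < e ->
  (`|u| < e) <-> (forall i, `|u i 0| < e).
Proof.
move=> e0; have -> : (`|u| < e : Prop) = ball 0 e u.
  by rewrite mx_norm_ball /ball_ /= sub0r normrN.
split => [[_ h] i|h].
  by have := h i 0; rewrite /ball /= mxE sub0r normrN.
by split => // i j; rewrite ord1 /ball /= mxE sub0r normrN.
Qed.

Lemma coord_norm_le (A : 'M[R]_n) i j : `|A i j| <= `|A|.
Proof.
rewrite [leRHS]mx_normrE; exact: (@le_bigmax _ _ _ 0 (fun ij : 'I_n * 'I_n => `|A ij.1 ij.2|) (i, j)).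
Qed.

Lemma cV_coord_norm_le (u : 'cV[R]_n) i : `|u i 0| <= `|u|.
Proof.
rewrite [leRHS]mx_normrE; exact: (@le_bigmax _ _ _ 0 (fun ij : 'I_n * 'I_1 => `|u ij.1 ij.2|) (i, 0)).
Qed.

Lemma cV_norm_le_sum (u : 'cV[R]_n) : `|u| <= \sum_i `|u i 0|.
Proof.
rewrite [leLHS]mx_normrE; apply/bigmax_leP; split; first by apply: sumr_ge0.
by move=> [i j] _ /=; rewrite ord1 (bigD1 i) //= lerDl sumr_ge0.
Qed.

Lemma rational_cV (u : 'cV[R]_n) (e : R) : 0 < e ->
  exists q : 'cV[rat]_n, `|u - map_mx ratr q| < e.
Proof.
move=> e0; have h i : exists q : rat, `|u i 0 - ratr q| < e.
  have : u i 0 - e < u i 0 + e by lra.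
  by move=> /rat_in_itvoo[q]; rewrite in_itv /= => hq; exists q; rewrite distrC ltr_distl.
have [q hq] := choice h.
by exists (\col_i q i); apply/cV_norm_lt => // i; rewrite !mxE.
Qed.

End MatrixConvergence.

Section BorelMaps.
Context {d : measure_display} {X : measurableType d} {R : realType} {n : nat}.
Variables (D : set X) (m : X -> 'cV[R]_n).
Hypotheses (mD : measurable D) (mm : forall i, measurable_fun D (fun x => m x i 0)).

(** Open sets of [R^n] are countable unions of rational boxes. *)
Lemma measurable_preimage_open (V : set 'cV[R]_n) : open V ->
  measurable (D `&` m @^-1` V).
Proof.
move=> oV.
pose B (qk : 'cV[rat]_n * nat) : set 'cV[R]_n :=
  [set z | forall i, `|z i 0 - ratr (qk.1 i 0)| < qk.2.+1%:R^-1].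
pose F (qk : 'cV[rat]_n * nat) := if pselect (B qk `<=` V) then D `&` m @^-1` B qk else set0.
have -> : D `&` m @^-1` V = \bigcup_qk F qk.
  apply/seteqP; split => [x [Dx Vmx]|x [qk _]]; last first.
    by rewrite /F; case: pselect => // BV [Dx Bx]; split => //; exact: BV.
  have /nbhs_ballP[e /= e0 he] : nbhs (m x) V by exact: open_nbhs_nbhs.
  have [k hk] : exists k : nat, k.+1%:R^-1 < e / 2.
    have e2 : 0 < e / 2 by rewrite divr_gt0.
    have [k _ /(_ k (leqnn k)) hk] := near_infty_natSinv_lt (PosNum e2).
    by exists k.
  have k0 : 0 < k.+1%:R^-1 :> R by rewrite invr_gt0 ltr0n.
  have [q hq] := rational_cV (m x) k0.
  have hqi := (cV_norm_lt (m x - map_mx ratr q) k0).1 hq.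
  have BV : B (q, k) `<=` V.
    move=> z /= hz; apply: he; split => // i j; rewrite ord1 /ball /=.
    have := hz i; have := hqi i; rewrite !mxE /= => h1 h2.
    have -> : m x i 0 - z i 0 = (m x i 0 - ratr (q i 0)) - (z i 0 - ratr (q i 0)) by ring.
    apply: le_lt_trans (ler_normB _ _) _; apply: lt_trans (ltrD h1 h2) _.
    by rewrite [ltRHS]splitr ltrD.
  have FE : F (q, k) = D `&` m @^-1` B (q, k) by rewrite /F; case: pselect.
  exists (q, k) => //; rewrite FE; split => //= i.
  by have := hqi i; rewrite !mxE.
apply: countable_bigcupT_measurable => [|qk]; first exact: countableP.
rewrite /F; case: pselect => [?|?]; last exact: measurable0.
have -> : D `&` m @^-1` B qk = D `&` \bigcap_(i in [set: 'I_n])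
    (D `&` [set x | `|m x i 0 - ratr (qk.1 i 0)| < qk.2.+1%:R^-1]).
  apply/seteqP; split => [x [Dx h]|x [Dx h]]; split => // i; first by move=> _; split => //; exact: h.
  by have [] := h i I.
apply: measurableI => //; apply: fin_bigcap_measurable => // i _.
have : measurable_fun D (fun x => `|m x i 0 - ratr (qk.1 i 0)|).
  apply: measurableT_comp => //; apply: measurable_funB => //; exact: measurable_cst.
move=> /(_ mD `]-oo, (qk.2.+1%:R^-1 : R)[%classic); apply; exact: measurable_itv.
Qed.

Lemma measurable_preimage_closed (V : set 'cV[R]_n) : closed V ->
  measurable (D `&` m @^-1` V).
Proof.
move=> cV; have := measurable_preimage_open (closed_openC cV).
rewrite preimage_setC -setDE => h.
have -> : D `&` m @^-1` V = D `\` (D `\` m @^-1` V) by rewrite setDD.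
exact: measurableD.
Qed.

(** The superlevel sets of [f] are relatively open in [S], hence traces on [S]
    of open sets. *)
Lemma measurable_comp_within (S : set 'cV[R]_n) (f : 'cV[R]_n -> R) :
  (forall x, D x -> S (m x)) ->
  (forall z, S z -> f z' @[z' --> within S (nbhs z)] --> f z) ->
  measurable_fun D (f \o m).
Proof.
move=> Sm cf; apply: (measurability _ (RGenOInfty.measurableE R)).
move=> _ [_ [a ->]] <-.
pose V := [set z | S z -> a < f z]°.
have -> : D `&` (f \o m) @^-1` `]a, +oo[%classic = D `&` m @^-1` V.
  apply/seteqP; split => x [Dx]; rewrite /= in_itv /= andbT => h; split => //.
    rewrite /V /preimage /= /interior /=.
    have /cvgrPdist_lt/(_ (f (m x) - a)) := cf _ (Sm _ Dx).
    rewrite subr_gt0 => /(_ h); rewrite near_withinE; apply: filterS => z /= hz Sz.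
    have := hz Sz; rewrite ltr_norml => /andP[_]; lra.
  by have /= := interior_subset h; apply; exact: Sm.
apply: measurable_preimage_open; exact: open_interior.
Qed.

End BorelMaps.

(** * The action density *)

Section ActionDensity.
Context {R : realType} {n : nat}.
Implicit Types (M : 'cV[R]_n -> 'M[R]_n) (z p q : 'cV[R]_n).

Definition legendre M q z p : R := 2 * dotv p q - qform (M z) q.

(** The Legendre dual form of [p^T M(z)^-1 p]; it makes sense where [M] is
    degenerate. *)
Definition action_density M z p : \bar R :=
  ereal_sup [set (legendre M q z p)%:E | q in [set: 'cV[R]_n]].

Lemma legendre_le M q z p : ((legendre M q z p)%:E <= action_density M z p)%E.
Proof. by apply: ereal_sup_ubound; exists q. Qed.

Lemma action_density_ge0 M z p : (0 <= action_density M z p)%E.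
Proof.
have := legendre_le M 0 z p; apply: le_trans.
by rewrite /legendre qform0 dotvC dotv0l mulr0 subr0.
Qed.

Lemma action_density_leP M z p (a : \bar R) :
  (forall q, ((legendre M q z p)%:E <= a)%E) <-> (action_density M z p <= a)%E.
Proof.
split => [h|h q]; first by apply: ge_ereal_sup => _ [q _ <-].
exact: le_trans (legendre_le _ _ _ _) h.
Qed.

(** The supremum is attained at [q = M(z)^-1 p]. *)
Lemma action_density_posdef M z p : sym_posdef (M z) ->
  action_density M z p = (qform (invmx (M z)) p)%:E.
Proof.
move=> pd; apply/eqP; rewrite eq_le; apply/andP; split.
  by apply/action_density_leP => q; rewrite lee_fin; exact: qform_inv_ge.
rewrite (qform_inv _ (posdef_unit pd) pd.1); exact: legendre_le.
Qed.

Lemma action_densityZ M z p (a : R) : a != 0 ->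
  action_density M z (a *: p) = ((a ^+ 2)%:E * action_density M z p)%E.
Proof.
move=> a0; have a2 : 0 < a ^+ 2 by rewrite exprn_even_gt0.
have key (b : R) (p' : 'cV[R]_n) : b != 0 -> (action_density M z (b *: p') <= (b ^+ 2)%:E * action_density M z p')%E.
  move=> b0; apply/action_density_leP => q.
  have b2 : 0 < b ^+ 2 by rewrite exprn_even_gt0.
  have -> : legendre M q z (b *: p') = b ^+ 2 * legendre M (b^-1 *: q) z p'.
    rewrite /legendre dotvZl dotvZr qformZ; field; exact: b0.
  by rewrite EFinM lee_pmul2l // ?lte_fin //; exact: legendre_le.
apply/eqP; rewrite eq_le key //=.
have := key a^-1 (a *: p); rewrite invr_eq0 => /(_ a0).
rewrite scalerA mulVf // scale1r exprVn => h.
rewrite -(@lee_pmul2l _ (a ^+ 2)^-1%:E) // ?lte_fin ?invr_gt0 //.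
by rewrite muleA -EFinM mulVf ?mul1e // gt_eqF.
Qed.

End ActionDensity.

Section ActionDensityOnS.
Context {R : realType} {n : nat}.
Variables (S : set 'cV[R]_n) (M : 'cV[R]_n -> 'M[R]_n).
Hypotheses (cS : convex_set S) (kS : compact S) (intS : S° !=set0) (mobM : mobility S M).
Implicit Types (z p q : 'cV[R]_n).

(** As [M] is concave, each [legendre M q] is convex in [(z, p)]. *)
Lemma action_density_convex x y p p' (t : R) : S x -> S y -> 0 <= t <= 1 ->
  (action_density M ((1 - t) *: x + t *: y) ((1 - t) *: p + t *: p') <=
   (1 - t)%:E * action_density M x p + t%:E * action_density M y p')%E.
Proof.
move=> Sx Sy t01; apply/action_density_leP => q.
have /andP[t0 t1] := t01.
apply: (@le_trans _ _ ((1 - t)%:E * (legendre M q x p)%:E + t%:E * (legendre M q y p')%:E)%E).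
  rewrite -!EFinM -EFinD lee_fin /legendre dotvDl !dotvZl.
  have := concave_mobility cS intS mobM q Sx Sy t01.
  move: (qform _ _) (qform _ _) (qform _ _) (dotv _ _) (dotv _ _) => a b c d e; clear; lra.
by apply: leeD; apply: lee_wpmul2l; rewrite ?lee_fin ?subr_ge0 //; exact: legendre_le.
Qed.

Lemma mobility_psd z q : S z -> 0 <= qform (M z) q.
Proof.
move=> Sz; have [z0 Sz0] := intS.
have lim := @cvg_comp _ _ _ _ (fun z' => qform (M z') q) _ _ _
    (segment_within cS Sz Sz0) (qform_cvg mobM (q := q) Sz).
apply: (cvgr_to_ge lim); near=> s => /=.
have [_ pd _ _] := mobM.
have [->|q0] := eqVneq q 0; first by rewrite qform0.
apply/ltW/(pd _ _).2 => //; apply: interior_segment => //.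
by apply/andP; split; near: s; [exact: nbhs_right_gt | exact: nbhs_right_le].
Unshelve. all: by end_near.
Qed.

Lemma action_density0 z : S z -> action_density M z 0 = 0%E.
Proof.
move=> Sz; apply/eqP; rewrite eq_le action_density_ge0 andbT.
apply/action_density_leP => q.
by rewrite /legendre dotv0l mulr0 sub0r lee_fin oppr_le0 mobility_psd.
Qed.

Lemma legendre_cvg (T : Type) (F : set_system T) {FF : Filter F}
    (u v : T -> 'cV[R]_n) z p q : S z ->
  (\forall x \near F, S (u x)) -> u @ F --> z -> v @ F --> p ->
  legendre M q (u x) (v x) @[x --> F] --> legendre M q z p.
Proof.
move=> Sz Su uz vp; rewrite /legendre; apply: cvgB.
  apply: cvgMl_tmp; rewrite dotvE; under eq_cvg do rewrite dotvE.
  apply: (cvg_big add_continuous) => i _; apply: cvgMr_tmp.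
  exact: (cvg_comp _ _ vp (@coord_continuous R n 1 i 0 p)).
apply: (@cvg_comp _ _ _ u (fun z' => qform (M z') q) F (within S (nbhs z))); last first.
  exact: qform_cvg.
move=> A; rewrite /within /= => wA; rewrite /nbhs /=.
by apply: filterS2 (uz _ wA) Su => x /= h Sx; exact: h.
Qed.

(** Along the segment from [(z, p)] to [(z0, 0)], with [z0] interior, the
    convex function [action_density] does not increase; this gives [<=].  The
    converse holds because [action_density] is a supremum of functions that are
    continuous on [S]. *)
Lemma phi_action_density z p : S z -> phi S M (z, p) = action_density M z p.
Proof.
move=> Sz; have [z0 Sz0] := intS; have [_ pd _ _] := mobM.
have phiE zp : S° zp.1 -> phi_int M zp = action_density M zp.1 zp.2.
  by move=> Sz1; rewrite /phi_int action_density_posdef //; exact: pd.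
rewrite /phi limf_einfE; apply/eqP; rewrite eq_le; apply/andP; split.
  apply: ge_ereal_sup => _ [V wV <-].
  have : \forall s \near (0 : R)^'+, V ((1 - s) *: z + s *: z0, (1 - s) *: p + s *: 0).
    have cz : (fun s : R => ((1 - s) *: z + s *: z0, (1 - s) *: p + s *: 0)) @ (0 : R)^'+ --> (z, p).
      exact: (cvg_pair (@segment_cvg R n z z0) (@segment_cvg R n p 0)).
    move: wV; rewrite /within /= => wV; have := cz _ wV.
    rewrite /nbhs /= => h; near=> s; have /= := near h s; apply => //; split => //=.
    apply: interior_segment => //.
    by apply/andP; split; near: s; [exact: nbhs_right_gt | exact: nbhs_right_le].
  move=> h.
  have [s [Vs s0 s1]] : exists s : R, [/\ V ((1 - s) *: z + s *: z0, (1 - s) *: p + s *: 0), 0 < s & s <= 1].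
    have : \forall s \near (0 : R)^'+, [/\ V ((1 - s) *: z + s *: z0, (1 - s) *: p + s *: 0), 0 < s & s <= 1].
      near=> s; split; near: s => //; [exact: nbhs_right_gt | exact: nbhs_right_le].
    by move/filter_ex.
  apply: (@le_trans _ _ (phi_int M ((1 - s) *: z + s *: z0, (1 - s) *: p + s *: 0))).
    by apply: ereal_inf_lbound; exists ((1 - s) *: z + s *: z0, (1 - s) *: p + s *: 0).
  rewrite phiE /=; last by apply: interior_segment => //; rewrite s0.
  apply: le_trans (action_density_convex _ _ Sz (interior_subset Sz0) _) _.
    by rewrite (ltW s0).
  rewrite action_density0 ?mule0 ?adde0; last exact: interior_subset.
  rewrite -[leRHS]mul1e lee_wpmul2r ?action_density_ge0 // lee_fin; lra.
apply/action_density_leP => q; apply/lee_subgt0Pr => e e0.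
apply: le_ereal_sup_tmp.
exists (ereal_inf (phi_int M @` [set zp | S° zp.1 /\ ((legendre M q z p)%:E - e%:E <= phi_int M zp)%E])); last first.
  by apply: le_ereal_inf_tmp => _ [zp [_ h] <-].
exists [set zp | S° zp.1 /\ ((legendre M q z p)%:E - e%:E <= phi_int M zp)%E] => //.
pose F := within (S° `*` setT) (nbhs (z, p)).
have FF : Filter F by exact: within_filter.
have inS : \forall zp \near F, S° zp.1.
  by rewrite /F near_withinE; near=> zp; case.
have c1 : (fun zp : 'cV[R]_n * 'cV[R]_n => zp.1) @ F --> z.
  by apply: cvg_within_filter; exact: cvg_fst.
have c2 : (fun zp : 'cV[R]_n * 'cV[R]_n => zp.2) @ F --> p.
  by apply: cvg_within_filter; exact: cvg_snd.
have inS' : \forall zp \near F, S zp.1 by apply: filterS inS => zp; exact: interior_subset.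
have /cvgrPdist_le/(_ e e0) := legendre_cvg (FF := FF) (q := q) Sz inS' c1 c2.
apply: filterS2 inS => zp Szp h; split => //; rewrite phiE //.
apply: le_trans (legendre_le M q _ _); rewrite -EFinB lee_fin.
by move: h; rewrite ler_norml => /andP[_]; lra.
Unshelve. all: by end_near.
Qed.

Lemma action_density_lsc (u v : nat -> 'cV[R]_n) z p : S z ->
  (forall k, S (u k)) -> u @ \oo --> z -> v @ \oo --> p ->
  (action_density M z p <= limn_einf (fun k => action_density M (u k) (v k)))%E.
Proof.
move=> Sz Su uz vp; apply/action_density_leP => q; apply/lee_subgt0Pr => e e0.
rewrite -[X in (_ <= X)%E]/(limf_einf _ \oo) limf_einfE; apply: le_ereal_sup_tmp.
have Su' : \forall k \near \oo, S (u k) by exact: nearW.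
have /cvgrPdist_le/(_ e e0)[N _ hN] := legendre_cvg (FF := eventually_filter) (q := q) Sz Su' uz vp.
exists (ereal_inf ((fun k => action_density M (u k) (v k)) @` [set k | (N <= k)%N])).
  by exists [set k | (N <= k)%N] => //; exists N.
apply: le_ereal_inf_tmp => _ [k Nk <-].
apply: le_trans (legendre_le M q _ _); rewrite -EFinB lee_fin.
by have := hN k Nk; rewrite /= ler_norml => /andP[_]; lra.
Qed.

Lemma mobility_bounded : exists2 B : R, 0 < B & forall z i j, S z -> `|M z i j| <= B.
Proof.
have [[cM _] _ _ _] := mobM.
have := compact_bounded (continuous_compact cM kS) => -[B [_ hB]].
exists (Num.max (B + 1) 1); first by rewrite lt_max ltr01 orbT.
move=> z i j Sz; apply: le_trans (coord_norm_le _ _ _) _.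
apply: hB; last by exists z.
by rewrite lt_max ltrDl ltr01.
Qed.

(** Take [q = p / L], where [L] bounds the quadratic forms [M z]; the summand
    [1] in [L] keeps it positive when [n = 0]. *)
Lemma action_density_coercive : exists2 L : R, 0 < L &
  forall z p, S z -> ((\sum_i p i 0 ^+ 2)%:E <= L%:E * action_density M z p)%E.
Proof.
have [B B0 hB] := mobility_bounded.
pose L := B * n%:R + 1; have L0 : 0 < L by rewrite ltr_wpDl // mulr_ge0 // ltW.
exists L => // z p Sz.
have bound q : qform (M z) q <= L * \sum_i q i 0 ^+ 2.
  apply: (@le_trans _ _ (B * n%:R * \sum_i q i 0 ^+ 2)); last first.
    by rewrite ler_wpM2r ?lerDl // sumr_ge0 // => i _; exact: sqr_ge0.
  rewrite qformE; apply: (@le_trans _ _ (\sum_(i < n) \sum_(j < n) B / 2 * (q i 0 ^+ 2 + q j 0 ^+ 2))).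
    apply: ler_sum => i _; apply: ler_sum => j _.
    apply: (le_trans (ler_norm _)); rewrite normrM.
    apply: (@le_trans _ _ (B * `|q i 0 * q j 0|)).
      by rewrite ler_wpM2r // hB.
    rewrite -mulrA ler_wpM2l ?(ltW B0) // ler_norml; apply/andP; split.
      have := sqr_ge0 (q i 0 + q j 0); lra.
    have := sqr_ge0 (q i 0 - q j 0); lra.
  under eq_bigr do rewrite -mulr_sumr big_split /= sumr_const card_ord.
  rewrite -mulr_sumr big_split /= sumr_const card_ord sumrMnl.
  rewrite -mulr_natr; move: (\sum_(i < n) _) => s0.
  by rewrite le_eqVlt; apply/orP; left; apply/eqP; field.
apply: (@le_trans _ _ (L%:E * (legendre M (L^-1 *: p) z p)%:E)%E).
  rewrite -EFinM lee_fin /legendre dotvZr dotvE.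
  have e1 : \sum_i p i 0 * p i 0 = \sum_i p i 0 ^+ 2 by [].
  have := bound (L^-1 *: p).
  have -> : \sum_i (L^-1 *: p) i 0 ^+ 2 = L^-1 ^+ 2 * \sum_i p i 0 ^+ 2.
    by rewrite mulr_sumr; apply: eq_bigr => i _; rewrite mxE exprMn.
  rewrite e1; move: (qform _ _) (\sum_i _) => a b h.
  have : L * (L^-1 ^+ 2 * b) = L^-1 * b by field; exact: lt0r_neq0.
  move=> h2; rewrite h2 in h.
  apply: (@le_trans _ _ (L * (2 * (L^-1 * b) - L^-1 * b))); last first.
    by rewrite ler_wpM2l ?(ltW L0) //; lra.
  by rewrite le_eqVlt; apply/orP; left; apply/eqP; field; exact: lt0r_neq0.
by rewrite lee_wpmul2l ?lee_fin ?(ltW L0) //; exact: legendre_le.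
Qed.

Let rational_point (k : nat) : 'cV[R]_n :=
  if @unpickle ('cV[rat]_n) k is Some q then map_mx ratr q else 0.

(** By continuity in [q] a countable supremum suffices, which gives
    measurability. *)
Let action_density_rational z p : action_density M z p =
  ereal_sup (range (fun k => (legendre M (rational_point k) z p)%:E)).
Proof.
apply/eqP; rewrite eq_le; apply/andP; split; last first.
  by apply: ge_ereal_sup => _ [k _ <-]; exact: legendre_le.
apply/action_density_leP => q; apply/lee_subgt0Pr => e e0.
have cl : continuous (fun q : 'cV[R]_n => legendre M q z p).
  have cc i j : continuous (fun q : 'cV[R]_n => q i 0 * q j 0).
    by move=> x; exact: cvgM (@coord_continuous R n 1 i 0 x) (@coord_continuous R n 1 j 0 x).
  have c1 : continuous (fun q : 'cV[R]_n => dotv p q).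
    under eq_fun do rewrite dotvE.
    apply: (continuous_big add_continuous) => i _ x.
    exact: cvgM (cvg_cst (p i 0)) (@coord_continuous R n 1 i 0 x).
  have c2 : continuous (fun q : 'cV[R]_n => qform (M z) q).
    under eq_fun do rewrite qformE.
    apply: (continuous_big add_continuous) => i _.
    apply: (continuous_big add_continuous) => j _ x.
    exact: cvgM (cvg_cst (M z i j)) (cc i j x).
  by move=> x; exact: cvgB (cvgM (cvg_cst (2 : R)) (c1 x)) (c2 x).
have /cvgrPdist_le/(_ e e0) := cl q.
move=> /nbhs_ballP[r /= r0 hr]; have [q' hq'] := rational_cV q r0.
apply: le_ereal_sup_tmp; exists (legendre M (map_mx ratr q') z p)%:E.
  by exists (pickle q') => //; rewrite /rational_point pickleK.
rewrite -EFinB lee_fin; have := hr (map_mx ratr q').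
rewrite mx_norm_ball /ball_ /= => /(_ hq'); rewrite ler_norml => /andP[_]; lra.
Qed.

Lemma measurable_action_density (d : measure_display) (X : measurableType d)
    (D : set X) (m w : X -> 'cV[R]_n) : measurable D ->
  (forall i, measurable_fun D (fun x => m x i 0)) ->
  (forall i, measurable_fun D (fun x => w x i 0)) ->
  (forall x, D x -> S (m x)) ->
  measurable_fun D (fun x => action_density M (m x) (w x)).
Proof.
move=> mD mm mw Sm.
pose h k x := (legendre M (rational_point k) (m x) (w x))%:E.
have -> : (fun x => action_density M (m x) (w x)) = (fun x => esups (h ^~ x) 0).
  apply/funext => x; rewrite action_density_rational /esups /sdrop /=.
  by congr ereal_sup; apply/seteqP; split => _ [k _ <-]; exists k.
apply: measurable_fun_esups => k; apply/measurable_EFinP; rewrite /legendre.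
apply: measurable_funB.
  apply: measurable_funM; first exact: measurable_cst.
  under eq_fun do rewrite dotvE.
  apply: measurable_sum => i; apply: measurable_funM; [exact: mw | exact: measurable_cst].
apply: (@measurable_comp_within _ _ _ _ D m mD mm S (fun z => qform (M z) (rational_point k))) => //.
by move=> z Sz; exact: qform_cvg.
Qed.

End ActionDensityOnS.

(** * Nested midpoint-closed sets in L2 *)

Section GeometricIncrements.
Context {R : realType}.

Lemma geometric_increments (u : nat -> R) (C : R) :
  (forall k, `|u k.+1 - u k| <= C * 2^-1 ^+ k) ->
  cvgn u /\ forall k, `|u k| <= `|u 0%N| + 2 * C.
Proof.
move=> h; split; last first.
  have C0 : 0 <= C by have := h 0%N; rewrite expr0 mulr1; apply: le_trans.
  move=> k; suff : `|u k - u 0%N| <= 2 * C * (1 - 2^-1 ^+ k).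
    move=> h2; rewrite -[u k](subrK (u 0%N)) addrC.
    apply: (le_trans (ler_normD _ _)); rewrite lerD2l (le_trans h2) //.
    by rewrite ler_piMr ?mulr_ge0 // lerBlDr lerDl exprn_ge0.
  elim: k => [|k IH]; first by rewrite subrr normr0 expr0 subrr mulr0.
  have -> : u k.+1 - u 0%N = (u k.+1 - u k) + (u k - u 0%N) by ring.
  apply: (le_trans (ler_normD _ _)); apply: (le_trans (lerD (h k) IH)).
  by rewrite exprS le_eqVlt; apply/orP; left; apply/eqP; field.
suff : cvgn (series (telescope u)).
  move=> /(is_cvgD (is_cvg_cst (u 0%N))) /= hc.
  have -> : u = (fun n => u 0%N + series (telescope u) n) by apply/funext => n; exact: eq_sum_telescope.
  exact: hc.
apply: normed_cvg; apply: (@series_le_cvg _ _ (geometric C 2^-1)) => [n|n|n|] /=.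
- exact: normr_ge0.
- exact: le_trans (h n).
- exact: h.
- apply: is_cvg_geometric_series; rewrite ger0_norm //; lra.
Qed.

End GeometricIncrements.

Lemma measurable_sqrt (R : realType) : measurable_fun setT (@Num.sqrt R).
Proof. by apply: continuous_measurable_fun; exact: sqrt_continuous. Qed.

Section NestedMidpointSets.
Context {d : measure_display} {X : measurableType d} {R : realType} {I : finType}.
Variable mu : {measure set X -> \bar R}.
Variables (K : nat -> set (I -> X -> R)) (B : R).

Let N (f : I -> X -> R) : \bar R := (\int[mu]_x (\sum_i f i x ^+ 2)%:E)%E.

Hypothesis Km : forall k f, K k f -> forall i, measurable_fun setT (f i).
Hypothesis KB : forall k f, K k f -> (N f <= B%:E)%E.
Hypothesis Kd : forall k, K k.+1 `<=` K k.
Hypothesis K0 : forall k, K k !=set0.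
Hypothesis Kmid : forall k f g, K k f -> K k g ->
  K k (fun i x => 2^-1 * (f i x + g i x)).

Let Kle k l : (k <= l)%N -> K l `<=` K k.
Proof.
move=> kl; rewrite -(subnK kl); elim: (l - k)%N => [|m IH]; first by rewrite add0n.
by rewrite addSn => f /Kd; exact: IH.
Qed.

Let N0 f : (0 <= N f)%E.
Proof. by apply: integral_ge0 => x _; rewrite lee_fin sumr_ge0 // => i _; exact: sqr_ge0. Qed.

Let Nfin k f : K k f -> N f \is a fin_num.
Proof. by move=> Kf; rewrite ge0_fin_numE // (le_lt_trans (KB Kf)) // ltry. Qed.

Let rN f := fine (N f).

Let rNB k f : K k f -> 0 <= rN f <= B.
Proof.
move=> Kf; rewrite /rN fine_ge0 // -lee_fin fineK ?(Nfin Kf) //; exact: KB Kf.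
Qed.

Let msq (f : I -> X -> R) : (forall i, measurable_fun setT (f i)) ->
  measurable_fun setT (fun x => (\sum_i f i x ^+ 2)%:E).
Proof.
move=> mf; apply/measurable_EFinP; apply: measurable_sum => i.
by apply: measurable_funX.
Qed.

(** The parallelogram identity. *)
Let parallelogram k f g : K k f -> K k g ->
  N (fun i x => g i x - f i x) =
  (2 * rN f + 2 * rN g - 4 * rN (fun i x => 2^-1 * (f i x + g i x)))%:E.
Proof.
move=> Kf Kg; have Kh := Kmid Kf Kg; set h := fun i x => _ in Kh *.
have mf := Km Kf; have mg := Km Kg; have mh := Km Kh.
have mD i : measurable_fun setT (fun x => g i x - f i x) by exact: measurable_funB.
have sq0 (F : I -> X -> R) x : 0 <= \sum_i F i x ^+ 2.
  by apply: sumr_ge0 => i _; exact: sqr_ge0.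
set gf := fun i x => g i x - f i x.
have e : (N gf + 4%:E * N h = 2%:E * N f + 2%:E * N g)%E.
  have NZ (c : R) (F : I -> X -> R) : 0 <= c -> (forall i, measurable_fun setT (F i)) ->
      (c%:E * N F = \int[mu]_x (c * \sum_i F i x ^+ 2)%:E)%E.
    move=> c0 mF; under [in RHS]eq_integral do rewrite EFinM.
    by rewrite ge0_integralZl_EFin //; [move=> x _; rewrite lee_fin | exact: msq].
  have ND (u v : X -> R) : (forall x, 0 <= u x) -> (forall x, 0 <= v x) ->
      measurable_fun setT (EFin \o u) -> measurable_fun setT (EFin \o v) ->
      (\int[mu]_x (u x)%:E + \int[mu]_x (v x)%:E = \int[mu]_x (u x + v x)%:E)%E.
    by move=> u0 v0 mu_ mv; rewrite -ge0_integralD // => x _; rewrite lee_fin.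
  have mZ (c : R) (F : I -> X -> R) : (forall i, measurable_fun setT (F i)) ->
      measurable_fun setT (EFin \o (fun x => c * \sum_i F i x ^+ 2)).
    move=> mF; apply/measurable_EFinP; apply: measurable_funM => //.
    by apply/measurable_EFinP; exact: msq.
  rewrite !NZ // ND //; [|by move=> x; rewrite mulr_ge0|exact: msq|exact: mZ].
  rewrite ND; [|by move=> x; rewrite mulr_ge0|by move=> x; rewrite mulr_ge0|exact: mZ|exact: mZ].
  apply: eq_integral => x _; congr EFin.
  rewrite !mulr_sumr -!big_split; apply: eq_bigr => i _ /=; rewrite /h /gf.
  have i2 : (2^-1 : R) = 1 / 2 by rewrite mul1r.
  by rewrite i2; field.
have fD : N gf \is a fin_num.
  rewrite ge0_fin_numE // (@le_lt_trans _ _ (2%:E * N f + 2%:E * N g)%E) //.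
    by rewrite -e leeDl // mule_ge0.
  by rewrite -(fineK (Nfin Kf)) -(fineK (Nfin Kg)) -!EFinM -EFinD ltry.
rewrite -(fineK fD); congr EFin; move: e.
rewrite -(fineK fD) -(fineK (Nfin Kf)) -(fineK (Nfin Kg)) -(fineK (Nfin Kh)) /=.
by rewrite -!EFinM -!EFinD => -[]; rewrite /rN; lra.
Qed.

Let d_ k := inf (rN @` K k).

Let d_lb k f : K k f -> d_ k <= rN f.
Proof.
move=> Kf; apply: ge_inf; last by exists f.
by exists 0 => _ [g Kg <-]; have /andP[] := rNB Kg.
Qed.

Let d_B k : d_ k <= B.
Proof. by have [f Kf] := K0 k; apply: le_trans (d_lb Kf) _; have /andP[] := rNB Kf. Qed.

Let dd := sup (range d_).

Let d_le k : d_ k <= dd.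
Proof. by apply: ub_le_sup; [exists B => _ [l _ <-]; exact: d_B | exists k]. Qed.

Let d_mono k l : (k <= l)%N -> d_ k <= d_ l.
Proof.
move=> kl; apply: lb_le_inf; first by have [f Kf] := K0 l; exists (rN f); exists f.
by move=> _ [f Kf <-]; apply: d_lb; exact: Kle Kf.
Qed.

(** Chosen so that the squared increments, at most [8 * eps j], are still
    summable after multiplication by [4 ^ j]. *)
Let eps (j : nat) : R := (2 ^ (j + 1))%:R^-1 * 4^-1 ^+ j / 8.

Let eps_gt0 j : 0 < eps j.
Proof. by rewrite /eps !mulr_gt0 ?invr_gt0 ?ltr0n ?expn_gt0 ?exprn_gt0. Qed.

Let eps_mono j : eps j.+1 <= eps j.
Proof.
rewrite /eps ler_pM2r // ler_pM ?invr_ge0 // ?exprn_ge0 //.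
  by rewrite lef_pV2 ?posrE ?ltr0n ?expn_gt0 // ler_nat leq_exp2l.
by rewrite exprS ler_piMl ?exprn_ge0 //; lra.
Qed.

(** The infima [d_ k] increase to [dd]; so elements of late sets have norm at
    least [dd - eps j], and some of them at most [dd + eps j]. *)
Let near_min (j : nat) : exists kf : nat * (I -> X -> R),
  [/\ (j <= kf.1)%N, K kf.1 kf.2, dd - eps j < d_ kf.1 & rN kf.2 < dd + eps j].
Proof.
have [_ [k _ <-] hk] : exists2 e, range d_ e & sup (range d_) - eps j < e.
  apply: sup_adherent => //; split; first by exists (d_ 0%N); exists 0%N.
  by exists B => _ [l _ <-]; exact: d_B.
pose l := maxn j k.
have [_ [f Kf <-] hf] : exists2 e, (rN @` K l) e & e < inf (rN @` K l) + eps j.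
  apply: inf_adherent => //; split.
    by have [f Kf] := K0 l; exists (rN f); exists f.
  by exists 0 => _ [g Kg <-]; have /andP[] := rNB Kg.
exists (l, f); split => //=; first exact: leq_maxl.
  by apply: lt_le_trans hk _; apply: d_mono; exact: leq_maxr.
by apply: lt_le_trans hf _; rewrite lerD2r; exact: d_le.
Qed.

(** Elements of almost minimal norm of nested midpoint-closed sets form a
    Cauchy sequence of L2, by the parallelogram identity: the midpoint of two
    of them cannot have a much smaller norm.  Increments that decay
    geometrically give the pointwise convergence and the domination. *)
Lemma nested_midpoint_sets : exists (f : nat -> I -> X -> R) (D : X -> R),
  [/\ forall k, K k (f k),
      measurable_fun setT D,
      forall x, 0 <= D x,
      (\int[mu]_x (D x ^+ 2)%:E < +oo)%E &
      {ae mu, forall x, forall i, (forall k, `|f k i x| <= D x) /\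
                                 cvgn (fun k => f k i x)}].
Proof.
have [kf hkf] := choice near_min.
pose f j := (kf j).2.
have Kf j : K (kf j).1 (f j) by have [] := hkf j.
have mf j i : measurable_fun setT (f j i) by exact: Km (Kf j) i.
have incr j : (N (fun i x => (f j.+1 i x - f j i x)%R) <= (8 * eps j)%:E)%E.
  have [_ _ d1 r1] := hkf j; have [_ _ d2 r2] := hkf j.+1.
  have em := eps_mono j.
  pose k := minn (kf j).1 (kf j.+1).1.
  have K1 : K k (f j) by apply: Kle (Kf j); exact: geq_minl.
  have K2 : K k (f j.+1) by apply: Kle (Kf j.+1); exact: geq_minr.
  rewrite (parallelogram K1 K2) lee_fin.
  have hd : dd - eps j < d_ k by rewrite /k /minn; case: ifP => // _; lra.
  have hm := d_lb (Kmid K1 K2).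
  have {}r1 : rN (f j) < dd + eps j := r1.
  have {}r2 : rN (f j.+1) < dd + eps j.+1 := r2.
  clear d1 d2; move: hd hm r1 r2 em.
  move: (rN (fun i x => _)) (rN (f j)) (rN (f j.+1)) (d_ k) (eps j) (eps j.+1) dd.
  move=> m1 n1 n2 dk e1 e2 D1 h1 h2 h3 h4 h5; lra.
(* the weight [4 ^ j] leaves [A] integrable, while the [j]-th increment is at
   most [sqrt A / 2 ^ j] *)
pose a j x : \bar R := ((4 ^+ j) * \sum_i (f j.+1 i x - f j i x) ^+ 2)%:E.
have a0 j x : (0 <= a j x)%E.
  by rewrite lee_fin mulr_ge0 // sumr_ge0 // => i _; exact: sqr_ge0.
have ma j : measurable_fun setT (a j).
  apply/measurable_EFinP; apply: measurable_funM => //; apply/measurable_EFinP.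
  by apply: msq => i; apply: measurable_funB.
pose A x : \bar R := (\sum_(j <oo) a j x)%E.
have A0 x : (0 <= A x)%E by apply: nneseries_ge0 => j _ _; exact: a0.
have mA : measurable_fun setT A by apply: ge0_emeasurable_sum => // j x _ _; exact: a0.
have intA : (\int[mu]_x A x < +oo)%E.
  rewrite integral_nneseries //.
  apply: (@le_lt_trans _ _ (\sum_(j <oo) ((1 / (2 ^ (j + 0.+1))%:R)%:E : \bar R))%E).
    apply: lee_nneseries => [j _ _|j _]; first by apply: integral_ge0 => x _; exact: a0.
    rewrite /a; under eq_integral do rewrite EFinM.
    rewrite ge0_integralZl_EFin //; last 2 first.
    - by move=> x _; rewrite lee_fin sumr_ge0 // => i _; exact: sqr_ge0.
    - by apply: msq => i; apply: measurable_funB.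
    apply: (@le_trans _ _ ((4 ^+ j)%:E * (8 * eps j)%:E)%E).
      by apply: lee_wpmul2l; [rewrite lee_fin | exact: incr].
    rewrite -EFinM lee_fin /eps le_eqVlt; apply/orP; left; apply/eqP.
    have h2 : ((2 ^ (j + 1))%:R : R) != 0 by rewrite pnatr_eq0 expn_eq0.
    rewrite exprVn; field; rewrite h2 /=; exact: expf_neq0.
  have := @cvg_geometric_eseries_half R 1 0 => /cvg_lim -> //; exact: ltry.
pose D x := Num.sqrt (\sum_i f 0%N i x ^+ 2) + 2 * Num.sqrt (fine (A x)).
have s0 x : 0 <= \sum_i f 0%N i x ^+ 2 by apply: sumr_ge0 => i _; exact: sqr_ge0.
have D0 x : 0 <= D x by rewrite addr_ge0 // ?mulr_ge0 // sqrtr_ge0.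
have mA' : measurable_fun setT (fine \o A) by apply: measurableT_comp => //; exact: fine_measurable.
have ms : measurable_fun setT (fun x => \sum_i f 0%N i x ^+ 2).
  by apply/measurable_EFinP; exact: msq.
have mD : measurable_fun setT D.
  apply: measurable_funD; first by apply: measurableT_comp => //; exact: measurable_sqrt.
  by apply: measurable_funM => //; apply: measurableT_comp mA'; exact: measurable_sqrt.
have faeA : {ae mu, forall x, A x \is a fin_num}.
  have iA : mu.-integrable setT A.
    apply/integrableP; split => //; under eq_integral do rewrite gee0_abs //.
    exact: intA.
  by have := integrable_ae measurableT iA; apply: filterS => x; apply.
exists f, D; split => //.
- by move=> k; apply: Kle (Kf k); have [] := hkf k.
- apply: (@le_lt_trans _ _ (\int[mu]_x ((2%:E * (\sum_i f 0%N i x ^+ 2)%:E) + 8%:E * A x))%E).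
    apply: ge0_le_integral => //.
    + by move=> x _; rewrite lee_fin sqr_ge0.
    + by apply/measurable_EFinP; exact: measurable_funX.
    + apply: emeasurable_funD; apply: measurable_funeM => //; exact: msq.
    move=> x _; have [fA|] := boolP (A x \is a fin_num).
      rewrite -[in leRHS](fineK fA) -!EFinM -EFinD lee_fin /D.
      have h1 := sqr_sqrtr (s0 x); have h2 := sqr_sqrtr (fine_ge0 (A0 x)).
      rewrite -[in leRHS]h1 -[in leRHS]h2; set u := Num.sqrt (\sum_i _); set v := Num.sqrt (fine _).
      rewrite -subr_ge0 (_ : _ - _ = (u - 2 * v) ^+ 2) ?sqr_ge0 //; ring.
    rewrite ge0_fin_numE // -leNgt leye_eq => /eqP ->.
    by rewrite gt0_muley // addey ?leey.
  rewrite ge0_integralD //; last 4 first.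
  - by move=> x _; rewrite -EFinM lee_fin mulr_ge0.
  - by apply: measurable_funeM; exact: msq.
  - by move=> x _; rewrite mule_ge0.
  - exact: measurable_funeM.
  rewrite !ge0_integralZl_EFin //; last exact: msq.
  by rewrite lte_add_pinfty // lte_mul_pinfty // (le_lt_trans (KB (Kf 0%N))) // ltry.
  by move=> x _; rewrite lee_fin.
move: faeA; apply: filterS => x fA i.
have h k : `|f k.+1 i x - f k i x| <= Num.sqrt (fine (A x)) * 2^-1 ^+ k.
  rewrite -ler_sqr ?nnegrE ?mulr_ge0 ?sqrtr_ge0 ?exprn_ge0 //.
  rewrite real_normK ?num_real // exprMn sqr_sqrtr ?fine_ge0 //.
  have : (a k x <= A x)%E.
    apply: le_trans (nneseries_lim_ge k.+1 (fun j _ _ => a0 j x)).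
    by rewrite big_nat_recr //= leeDr // sume_ge0.
  rewrite -[X in (_ <= X)%E -> _](fineK fA) lee_fin => h.
  have -> : 2^-1 ^+ k ^+ 2 = (4 ^+ k)^-1 :> R.
    by rewrite -exprM mulnC exprM -exprVn; congr (_ ^+ k); field.
  rewrite ler_pdivlMr ?exprn_gt0 // mulrC; apply: le_trans h.
  rewrite ler_pM2l ?exprn_gt0 // (bigD1 i) //= lerDl sumr_ge0 // => ? _; exact: sqr_ge0.
have [cv bd] := geometric_increments h; split => // k.
apply: le_trans (bd k) _; rewrite lerD2r.
rewrite -sqrtr_sqr ler_wsqrtr // (bigD1 i) //= lerDl sumr_ge0 // => ? _; exact: sqr_ge0.
Qed.

End NestedMidpointSets.

(** * Smooth functions on the line *)

Section SmoothFunctions.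
Context {R : realType}.
Implicit Types (f g : R -> R).

(** Infinite differentiability on the line, as membership in some class of
    functions that is closed under differentiation. *)
Definition smooth1 f : Prop := exists2 P : set (R -> R), P f &
  forall g, P g -> exists2 g', P g' & forall x : R, is_derive x 1 g (g' x).

Lemma smooth1_derive f : smooth1 f ->
  smooth1 (derive1 f) /\ forall x : R, is_derive x 1 f ((derive1 f) x).
Proof.
case=> P Pf Pd; have [f' Pf' df] := Pd f Pf.
have e : (derive1 f) = f' by apply/funext => x; rewrite derive1E; have [_ ->] := df x.
by rewrite e; split => //; exists P.
Qed.

Lemma smooth1_continuous f : smooth1 f -> continuous f.
Proof.
move=> /smooth1_derive[_ df] x; apply/differentiable_continuous.
by apply/derivable1_diffP; have [] := df x.
Qed.

Let is_derive_mul f g (x a b : R) : is_derive x 1 f a -> is_derive x 1 g b ->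
  is_derive x 1 (fun y => f y * g y) (a * g x + f x * b).
Proof.
move=> df dg; have := @is_deriveM R R f g x 1 a b df dg.
by rewrite /GRing.scale /= addrC [g x * a]mulrC.
Qed.

Let is_derive_inv f (x a : R) : f x != 0 -> is_derive x 1 f a ->
  is_derive x 1 (fun y => (f y)^-1) (- 1 * (a * ((f x)^-1 * (f x)^-1))).
Proof.
move=> fx [df da]; split; first exact: derivableV.
by rewrite deriveV // da /GRing.scale /= expr2 invfM; ring.
Qed.

Lemma is_derive_affine f (x a c b : R) : is_derive (a * x + b) 1 f c ->
  is_derive x 1 (fun y => f (a * y + b)) (a * c).
Proof.
move=> df; have da : is_derive x 1 (fun y : R => a * y + b) a.
  have := is_deriveD (is_deriveZ a (is_derive_id x 1)) (is_derive_cst b x 1).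
  by rewrite addr0 /GRing.scale /= mulr1.
have h := @is_derive1_comp R f (fun y : R => a * y + b) x c a df da.
by rewrite [a * c]mulrC; exact: h.
Qed.

(** The least class of functions containing the smooth ones and closed under
    the operations below; being closed under differentiation, it consists of
    smooth functions. *)
Inductive smooth_algebra : (R -> R) -> Prop :=
| smooth_base f : smooth1 f -> smooth_algebra f
| smooth_cst c : smooth_algebra (fun=> c)
| smooth_add f g : smooth_algebra f -> smooth_algebra g ->
    smooth_algebra (fun x => f x + g x)
| smooth_mul f g : smooth_algebra f -> smooth_algebra g ->
    smooth_algebra (fun x => f x * g x)
| smooth_inv f : smooth_algebra f -> (forall x, f x != 0) ->
    smooth_algebra (fun x => (f x)^-1)
| smooth_affine f a b : smooth_algebra f ->
    smooth_algebra (fun x => f (a * x + b)).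

Lemma smooth_algebra_smooth1 f : smooth_algebra f -> smooth1 f.
Proof.
move=> sf; exists smooth_algebra => //= g; elim=> {f sf g}.
- move=> f /smooth1_derive[sf df]; exists (derive1 f) => //; exact: smooth_base.
- by move=> c; exists (fun=> 0); [exact: smooth_cst | move=> x; exact: is_derive_cst].
- move=> f g _ [f' sf' df] _ [g' sg' dg]; exists (fun x => f' x + g' x).
    exact: smooth_add.
  by move=> x; exact: is_deriveD (df x) (dg x).
- move=> f g sf [f' sf' df] sg [g' sg' dg].
  exists (fun x => f' x * g x + f x * g' x).
    by apply: smooth_add; exact: smooth_mul.
  by move=> x; exact: is_derive_mul.
- move=> f sf [f' sf' df] f0.
  exists (fun x => - 1 * (f' x * ((f x)^-1 * (f x)^-1))).
    apply: smooth_mul; first exact: smooth_cst.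
    by apply: smooth_mul => //; apply: smooth_mul; exact: smooth_inv.
  by move=> x; exact: is_derive_inv.
- move=> f a b sf [f' sf' df]; exists (fun x => a * f' (a * x + b)).
    by apply: smooth_mul; [exact: smooth_cst | exact: smooth_affine].
  by move=> x; exact: is_derive_affine.
Qed.

Lemma smooth1_cst (c : R) : smooth1 (fun=> c).
Proof. exact/smooth_algebra_smooth1/smooth_cst. Qed.

Lemma smooth1_add f g : smooth1 f -> smooth1 g -> smooth1 (fun x => f x + g x).
Proof. by move=> sf sg; apply: smooth_algebra_smooth1; apply: smooth_add; exact: smooth_base. Qed.

Lemma smooth1_mul f g : smooth1 f -> smooth1 g -> smooth1 (fun x => f x * g x).
Proof. by move=> sf sg; apply: smooth_algebra_smooth1; apply: smooth_mul; exact: smooth_base. Qed.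

Lemma smooth1_affine f (a b : R) : smooth1 f -> smooth1 (fun x => f (a * x + b)).
Proof. by move=> sf; apply: smooth_algebra_smooth1; apply: smooth_affine; exact: smooth_base. Qed.

Lemma smooth1_sum (I : Type) (s : seq I) (F : I -> R -> R) :
  (forall i, smooth1 (F i)) -> smooth1 (fun x => \sum_(i <- s) F i x).
Proof.
move=> sF; elim: s => [|i s IH].
  by under eq_fun do rewrite big_nil; exact: smooth1_cst.
by under eq_fun do rewrite big_cons; exact: smooth1_add.
Qed.

(** These functions vanish to the left of 0 and are flat at 0; their
    class is closed under differentiation. *)
Let flat (p : {poly R}) (x : R) : R := if 0 < x then p.[x^-1] * expR (- x^-1) else 0.

Let pow_expR_le (m : nat) (y : R) : 0 <= y -> y ^+ m.+1 * expR (- y) <= m.+1`!%:R.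
Proof.
move=> y0; rewrite expRN ler_pdivrMr ?expR_gt0 //.
have := @expR_ge1Dxn R y m y0; rewrite -lerBrDl => h.
have f0 : 0 < m.+1`!%:R :> R by rewrite ltr0n fact_gt0.
rewrite mulrC -ler_pdivrMr // (le_trans h) // gerBl; exact: ler01.
Qed.

(** With [y = 1 / x], a polynomial in [y] times [exp (- y)] is bounded; the
    quadratic bound makes the derivative at 0 vanish. *)
Let flat_quadratic p : exists C, forall x, `|flat p x| <= C * x ^+ 2.
Proof.
exists (\sum_(i < size p) `|p`_i| * i.+2`!%:R) => x.
have s0 : 0 <= \sum_(i < size p) `|p`_i| * i.+2`!%:R :> R by apply: sumr_ge0 => i _; exact: mulr_ge0.
rewrite /flat; case: ifPn => [x0|_]; last by rewrite normr0 mulr_ge0 // sqr_ge0.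
have y0 : 0 < x^-1 by rewrite invr_gt0.
rewrite -ler_pdivrMr ?exprn_gt0 // -exprVn normrM [`|expR _|]ger0_norm ?expR_ge0 //.
rewrite mulrAC; set y := x^-1 in y0 *.
have -> : `|p.[y]| * y ^+ 2 * expR (- y) = `|p.[y]| * (y ^+ 2 * expR (- y)) by rewrite -mulrA.
rewrite horner_coef; apply: (@le_trans _ _ ((\sum_(i < size p) `|p`_i| * y ^+ i) * (y ^+ 2 * expR (- y)))).
  rewrite ler_wpM2r ?mulr_ge0 ?exprn_ge0 ?expR_ge0 ?(ltW y0) //.
  apply: (le_trans (ler_norm_sum _ _ _)); apply: ler_sum => i _.
  by rewrite normrM [`|y ^+ i|]ger0_norm // exprn_ge0 // ltW.
rewrite mulr_suml; apply: ler_sum => i _; rewrite -mulrA ler_wpM2l //.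
rewrite mulrA -exprD addn2; exact: pow_expR_le (ltW y0).
Qed.

Let is_derive_quadratic f (C : R) : f 0 = 0 -> (forall x, `|f x| <= C * x ^+ 2) ->
  is_derive (0 : R) 1 f 0.
Proof.
move=> f0 hC.
have C0 : 0 <= C by have := hC 1; rewrite expr1n mulr1; apply: le_trans.
have h : (fun h : R => h^-1 *: (f (h *: 1 + 0) - f 0)) @ (0 : R)^' --> (0 : R).
  apply/cvgrPdist_le => e e0; near=> h.
  have h0 : h != 0 by near: h; exact: nbhs_dnbhs_neq.
  rewrite sub0r normrN f0 subr0 addr0 [h *: 1]mulr1 normrM normfV.
  rewrite ler_pdivrMl ?normr_gt0 //; apply: (le_trans (hC h)).
  rewrite -real_normK ?num_real // expr2 mulrCA ler_wpM2l //.
  have : `|h| < e / (C + 1).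
    near: h; apply: dnbhs0_lt; rewrite divr_gt0 //; lra.
  rewrite ltr_pdivlMr; last lra.
  have := normr_ge0 h; nra.
split; first by apply/cvg_ex; exists 0; exact: h.
by apply: cvg_lim => //; exact: h.
Unshelve. all: by end_near.
Qed.

Let flat_derive p (x : R) : is_derive x 1 (flat p) (flat ('X^2 * (p - p^`())) x).
Proof.
have [x0|x0|<-] := ltgtP 0 x; last first.
- have [C hC] := flat_quadratic p.
  rewrite [X in is_derive _ _ _ X](_ : _ = 0); last by rewrite /flat ltxx.
  by apply: (is_derive_quadratic (C := C)) => //; rewrite /flat ltxx.
- have -> : flat ('X^2 * (p - p^`())) x = 0 by rewrite /flat ltNge (ltW x0).
  apply: (@near_eq_is_derive R R R (cst 0)).
  near=> y; have y0 : y < 0 by near: y; exact: lt_nbhsl.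
  by rewrite /flat ltNge (ltW y0).
have -> : flat ('X^2 * (p - p^`())) x =
    (p^`().[x^-1] * (- 1 * (1 * (x^-1 * x^-1)))) * expR (- x^-1) +
    p.[x^-1] * (expR (- x^-1) * (- (- 1 * (1 * (x^-1 * x^-1))))).
  by rewrite /flat x0 hornerM hornerD hornerN hornerXn; ring.
apply: (@near_eq_is_derive R R R (fun y : R => p.[y^-1] * expR (- y^-1)) (flat p) x 1).
  near=> y; have y0 : 0 < y by near: y; exact: lt_nbhsr.
  by rewrite /flat y0.
have xN0 : x != 0 by rewrite gt_eqF.
have di := is_derive_inv xN0 (is_derive_id x 1).
have dp := is_derive1_comp (is_derive_poly p x^-1) di.
have de := @is_derive1_comp R expR (fun y => - y^-1) x _ _ (is_derive_expR (- x^-1)) (is_deriveN di).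
exact: is_derive_mul dp de.
Unshelve. all: by end_near.
Qed.

Let smooth1_flat p : smooth1 (flat p).
Proof.
exists (range flat) => [|_ [q _ <-]]; first by exists p.
by exists (flat ('X^2 * (q - q^`()))); [exists ('X^2 * (q - q^`())) | exact: flat_derive].
Qed.

(** A smooth transition from 0 on the negative axis to 1 beyond 1. *)
Definition smooth_step (x : R) : R :=
  flat 1 x / (flat 1 x + flat 1 (1 - x)).

Let flat1_ge0 x : 0 <= flat 1 x.
Proof. by rewrite /flat; case: ifP => // _; rewrite hornerC mul1r expR_ge0. Qed.

Let flat1_gt0 x : 0 < x -> 0 < flat 1 x.
Proof. by rewrite /flat => ->; rewrite hornerC mul1r expR_gt0. Qed.

Let flat1_sum_gt0 x : 0 < flat 1 x + flat 1 (1 - x).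
Proof.
have [x0|x0] := ltP 0 x; first by rewrite ltr_pwDl // flat1_gt0.
by rewrite ltr_wpDl // flat1_gt0 // subr_gt0 (le_lt_trans x0).
Qed.

Lemma smooth_step_smooth1 : smooth1 smooth_step.
Proof.
apply: smooth1_mul; first exact: smooth1_flat.
have e : (fun x => flat 1 (1 - x)) = (fun x => flat 1 ((- 1) * x + 1)).
  by apply/funext => x; congr flat; ring.
apply: smooth_algebra_smooth1; apply: smooth_inv.
  apply: smooth_base; apply: smooth1_add; first exact: smooth1_flat.
  by rewrite e; apply: smooth1_affine; exact: smooth1_flat.
by move=> x; rewrite gt_eqF.
Qed.

Lemma smooth_step0 x : x <= 0 -> smooth_step x = 0.
Proof. by move=> x0; rewrite /smooth_step {1}/flat ltNge x0 mul0r. Qed.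

Lemma smooth_step1 x : 1 <= x -> smooth_step x = 1.
Proof.
move=> x1; rewrite /smooth_step {3}/flat ltNge subr_le0 x1 addr0 divff //.
by rewrite gt_eqF // flat1_gt0 // (lt_le_trans ltr01).
Qed.

Lemma smooth_step_itv x : 0 <= smooth_step x <= 1.
Proof.
rewrite /smooth_step divr_ge0 ?(ltW (flat1_sum_gt0 _)) //=.
by rewrite ler_pdivrMr ?flat1_sum_gt0 // mul1r lerDl.
Qed.

End SmoothFunctions.

(** * Smooth functions on the plane and test functions *)

Section PlaneFunctions.
Context {R : realType}.
Implicit Types (psi : R * R -> R).

Lemma continuous_measurable_plane psi : continuous psi -> measurable_fun setT psi.
Proof.
move=> cpsi.
pose m (p : R * R) : 'cV[R]_2 := \col_i (if i == 0 then p.1 else p.2).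
pose g (v : 'cV[R]_2) : R := psi (v 0 0, v 1 0).
have -> : psi = g \o m.
  by apply/funext => -[t x]; rewrite /g /m /= !mxE.
have mm i : measurable_fun setT (fun p => m p i 0).
  rewrite /m; under eq_fun do rewrite mxE.
  by case: (i == 0); [exact: measurable_fst | exact: measurable_snd].
apply: (@measurable_comp_within _ _ _ _ setT m measurableT mm setT g) => // v _.
apply: cvg_within_filter.
apply: (@cvg_comp _ _ _ (fun v : 'cV[R]_2 => (v 0 0, v 1 0)) psi _ (nbhs (v 0 0, v 1 0))).
  exact: (cvg_pair (@coord_continuous R 2 1 0 0 v) (@coord_continuous R 2 1 1 0 v)).
exact: cpsi.
Qed.

Lemma smooth_on_derive psi (w : R * R) :
  smooth_on setT psi -> smooth_on setT ('D_w psi).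
Proof.
move=> s vs x _; have := s (rcons vs w) x I.
by rewrite /iter_derive foldr_rcons.
Qed.

Lemma smooth_on_continuous psi : smooth_on setT psi -> continuous psi.
Proof. by move=> s x; apply: differentiable_continuous; exact: (s [::] x I). Qed.

Let is_derive_section psi (p v : R * R) (s : R) : differentiable psi (p + s *: v) ->
  is_derive s 1 (fun s : R => psi (p + s *: v)) ('D_v psi (p + s *: v)).
Proof.
move=> dpsi; have dv := @diff_derivable _ _ _ _ _ v dpsi.
have e : (fun h : R => h^-1 *: (psi (p + (h *: 1 + s) *: v) - psi (p + s *: v)))
     = (fun h : R => h^-1 *: (psi (h *: v + (p + s *: v)) - psi (p + s *: v))).
  apply/funext => h /=; congr (_ *: (psi _ - _)).
  by rewrite scalerDl [h *: 1]mulr1 addrCA.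
split; last by rewrite /derive -e.
by rewrite /derivable /= /shift; move: dv; rewrite /derivable -e.
Qed.

Lemma is_derive_section1 psi (t x : R) : differentiable psi (t, x) ->
  is_derive t 1 (fun t : R => psi (t, x)) ('D_((1, 0) : R * R) psi (t, x)).
Proof.
have e (s : R) : (0, x) + s *: (1, 0) = (s, x) :> R * R.
  by congr pair => /=; rewrite /GRing.scale /= ?mulr1 ?mulr0 ?add0r ?addr0.
move=> d; have := @is_derive_section psi (0, x) (1, 0) t; rewrite e => /(_ d).
by rewrite (_ : (fun s : R => psi ((0, x) + s *: (1, 0))) = fun t => psi (t, x)) //; apply/funext => s; rewrite e.
Qed.

Lemma is_derive_section2 psi (t x : R) : differentiable psi (t, x) ->
  is_derive x 1 (fun x : R => psi (t, x)) ('D_((0, 1) : R * R) psi (t, x)).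
Proof.
have e (s : R) : (t, 0) + s *: (0, 1) = (t, s) :> R * R.
  by congr pair => /=; rewrite /GRing.scale /= ?mulr1 ?mulr0 ?add0r ?addr0.
move=> d; have := @is_derive_section psi (t, 0) (0, 1) x; rewrite e => /(_ d).
by rewrite (_ : (fun s : R => psi ((t, 0) + s *: (0, 1))) = fun x => psi (t, x)) //; apply/funext => s; rewrite e.
Qed.

Lemma smooth_on_section psi (t : R) : smooth_on setT psi ->
  smooth1 (fun x => psi (t, x)) /\
  derive1 (fun x => psi (t, x)) = (fun x => 'D_((0, 1) : R * R) psi (t, x)).
Proof.
move=> s; split.
  exists [set g | exists2 phi, smooth_on setT phi & g = fun x => phi (t, x)].
    by exists psi.
  move=> _ [phi sphi ->]; exists (fun x => 'D_((0, 1) : R * R) phi (t, x)).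
    by exists ('D_((0, 1) : R * R) phi) => //; exact: smooth_on_derive.
  by move=> x; apply: is_derive_section2; exact: (sphi [::] _ I).
apply/funext => x; rewrite derive1E.
by have [_ ->] := @is_derive_section2 psi t x (s [::] _ I).
Qed.

(** Finite sums of products [u(t) v(x)] of smooth functions are closed under
    directional derivatives. *)
Inductive tensor_span : (R * R -> R) -> Prop :=
| tensor_mul (u v : R -> R) : smooth1 u -> smooth1 v -> tensor_span (fun p => u p.1 * v p.2)
| tensor_add psi psi' : tensor_span psi -> tensor_span psi' ->
    tensor_span (fun p => psi p + psi' p).

Let proj1_continuous : continuous (@fst R R).
Proof. by move=> p; exact: cvg_fst. Qed.

Let proj2_continuous : continuous (@snd R R).
Proof. by move=> p; exact: cvg_snd. Qed.

Let differentiable_proj1 (p : R * R) : differentiable (fun p : R * R => p.1) p.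
Proof. by apply: (@linear_differentiable _ _ _ (@fst R R)); exact: proj1_continuous. Qed.

Let differentiable_proj2 (p : R * R) : differentiable (fun p : R * R => p.2) p.
Proof. by apply: (@linear_differentiable _ _ _ (@snd R R)); exact: proj2_continuous. Qed.

Let tensor_diff (u v : R -> R) (p : R * R) : smooth1 u -> smooth1 v ->
  differentiable (fun p : R * R => u p.1 * v p.2) p /\
  forall w : R * R, 'D_w (fun p : R * R => u p.1 * v p.2) p =
    (w.1 * derive1 u p.1) * v p.2 + u p.1 * (w.2 * derive1 v p.2).
Proof.
move=> /smooth1_derive[su du] /smooth1_derive[sv dv].
have d1 : differentiable (fun p : R * R => u p.1) p.
  apply: (@differentiable_comp _ _ _ _ (fun p : R * R => p.1) u); first exact: differentiable_proj1.
  by apply/derivable1_diffP; have [] := du p.1.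
have d2 : differentiable (fun p : R * R => v p.2) p.
  apply: (@differentiable_comp _ _ _ _ (fun p : R * R => p.2) v); first exact: differentiable_proj2.
  by apply/derivable1_diffP; have [] := dv p.2.
have dm : differentiable (fun p : R * R => u p.1 * v p.2) p by exact: differentiableM.
split => // w.
have D1 : 'D_w (fun p : R * R => u p.1) p = w.1 * derive1 u p.1.
  rewrite deriveE // (@diff_comp _ _ _ _ (fun p : R * R => p.1) u) /=.
  - rewrite diff1E; last by apply/derivable1_diffP; have [] := du p.1.
    by rewrite (@diff_lin _ _ _ (@fst R R)) //; exact: proj1_continuous.
  - exact: differentiable_proj1.
  - by apply/derivable1_diffP; have [] := du p.1.
have D2 : 'D_w (fun p : R * R => v p.2) p = w.2 * derive1 v p.2.
  rewrite deriveE // (@diff_comp _ _ _ _ (fun p : R * R => p.2) v) /=.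
  - rewrite diff1E; last by apply/derivable1_diffP; have [] := dv p.2.
    by rewrite (@diff_lin _ _ _ (@snd R R)) //; exact: proj2_continuous.
  - exact: differentiable_proj2.
  - by apply/derivable1_diffP; have [] := dv p.2.
rewrite (@deriveM _ _ (fun p : R * R => u p.1) (fun p : R * R => v p.2)); try exact: diff_derivable.
by rewrite D1 D2 /GRing.scale /=; ring.
Qed.

Let tensor_span_derive psi (w : R * R) : tensor_span psi ->
  (forall p, differentiable psi p) /\ tensor_span ('D_w psi).
Proof.
elim=> {psi} [u v su sv|psi psi' _ [d1 s1] _ [d2 s2]].
  split => [p|]; first by have [] := tensor_diff p su sv.
  have -> : 'D_w (fun p : R * R => u p.1 * v p.2) =
     fun p => (fun p => (w.1 * derive1 u p.1) * v p.2) p + (fun p => u p.1 * (w.2 * derive1 v p.2)) p.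
    by apply/funext => p; have [_ ->] := tensor_diff p su sv.
  have [su' _] := smooth1_derive su; have [sv' _] := smooth1_derive sv.
  apply: tensor_add.
    by apply: (tensor_mul (u := fun t => w.1 * derive1 u t)) => //; apply: smooth1_mul => //; exact: smooth1_cst.
  by apply: (tensor_mul (v := fun t => w.2 * derive1 v t)) => //; apply: smooth1_mul => //; exact: smooth1_cst.
split => [p|]; first exact: differentiableD.
have -> : 'D_w (fun p => psi p + psi' p) = fun p => 'D_w psi p + 'D_w psi' p.
  by apply/funext => p; rewrite deriveD //; exact: diff_derivable.
exact: tensor_add.
Qed.

Lemma tensor_smooth_on (u v : R -> R) : smooth1 u -> smooth1 v ->
  smooth_on setT (fun p : R * R => u p.1 * v p.2).
Proof.
move=> su sv vs p _.
have : tensor_span (iter_derive vs (fun p : R * R => u p.1 * v p.2)).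
  elim: vs => [|w vs IH] /=; first exact: tensor_mul.
  by have [] := tensor_span_derive w IH.
by move=> /(tensor_span_derive 0)[].
Qed.

Lemma tensor_derive (u v : R -> R) (t x : R) : smooth1 u -> smooth1 v ->
  'D_((1, 0) : R * R) (fun p : R * R => u p.1 * v p.2) (t, x) = derive1 u t * v x /\
  'D_((0, 1) : R * R) (fun p : R * R => u p.1 * v p.2) (t, x) = u t * derive1 v x.
Proof.
move=> su sv; have [_ h] := tensor_diff (t, x) su sv.
by rewrite !h /= !mul1r !mul0r mulr0 addr0 add0r.
Qed.

Lemma derive_vanish (V : normedModType R) (f : V -> R) (U : set V) (w : V) :
  open U -> (forall x, U x -> f x = 0) -> forall x, U x -> 'D_w f x = 0.
Proof.
move=> oU f0 x Ux; rewrite (@near_eq_derive _ _ _ _ (cst 0)) ?derive_cst //.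
by have : nbhs x U by [exact: open_nbhs_nbhs]; apply: filterS => y /f0.
Qed.

Lemma compact_support_bounded (V : normedModType R) (f g : V -> R) :
  continuous g -> compact (support_closure f) ->
  (forall x, ~ support_closure f x -> g x = 0) ->
  exists2 C, 0 < C & forall x, `|g x| <= C.
Proof.
move=> cg kf g0.
have := compact_bounded (continuous_compact (continuous_subspaceT cg) kf) => -[B [_ hB]].
exists (Num.max (B + 1) 1); first by rewrite lt_max ltr01 orbT.
move=> x; have [fx|nfx] := pselect (support_closure f x); last first.
  by rewrite g0 // normr0 le_max ler01 orbT.
apply: (hB (Num.max (B + 1) 1)); last by exists x.
by rewrite lt_max ltrDl ltr01.
Qed.

Lemma support_closureP (V : normedModType R) (f : V -> R) x :
  ~ support_closure f x -> f x = 0.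
Proof.
by move=> nsx; apply/eqP/negPn/negP => fx; apply: nsx; exact: subset_closure.
Qed.

Lemma support_derive (V : normedModType R) (f : V -> R) (w x : V) :
  ~ support_closure f x -> 'D_w f x = 0.
Proof.
apply: (@derive_vanish _ _ (~` support_closure f)) => [|y]; last exact: support_closureP.
by apply: closed_openC; exact: closed_closure.
Qed.

Lemma support_radius psi : compact (support_closure psi) ->
  exists2 r : R, 0 < r & forall p, support_closure psi p -> `|p.1| <= r /\ `|p.2| <= r.
Proof.
move=> /compact_bounded[B [_ hB]].
exists (Num.max (B + 1) 1); first by rewrite lt_max ltr01 orbT.
move=> p sp; have := hB (Num.max (B + 1) 1); rewrite lt_max ltrDl ltr01 => /(_ isT p sp).
by move=> h; split; apply: le_trans h; rewrite [leRHS]/Num.norm /= le_max lexx ?orbT.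
Qed.

Definition vanishes_outside (r : R) (rho : R -> R) := forall x, r < `|x| -> rho x = 0.

Lemma vanishes_outside_derive r rho : vanishes_outside r rho ->
  vanishes_outside r (derive1 rho).
Proof.
move=> h x rx; rewrite derive1E.
apply: (@derive_vanish _ rho [set x | r < `|x|]) => //.
apply: (@open_comp _ _ (@Num.norm R R) [set y | r < y]); last exact: open_gt.
by move=> y _; exact: norm_continuous.
Qed.

Lemma vanishes_outside_compact r rho : vanishes_outside r rho ->
  compact (support_closure rho) /\ support_closure rho `<=` `[- r, r]%classic.
Proof.
move=> h; have sub : support_closure rho `<=` `[- r, r]%classic.
  rewrite /support_closure; have cl : closed `[- r, r]%classic by exact: itv_closed.
  rewrite [X in _ `<=` X]((closure_id _).1 cl); apply: closure_subset => x /= rx.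
  rewrite in_itv /= -ler_norml leNgt; apply/negP => /h rx0; by rewrite rx0 eqxx in rx.
split => //; apply: subclosed_compact sub; [exact: closed_closure | exact: segment_compact].
Qed.

Lemma vanishes_outside_bounded r rho : continuous rho -> vanishes_outside r rho ->
  exists2 C, 0 < C & forall x, `|rho x| <= C.
Proof.
move=> c h; apply: (@compact_support_bounded _ rho) => //.
- exact: (vanishes_outside_compact h).1.
- exact: support_closureP.
Qed.

Definition test1 (rho : R -> R) := smooth1 rho /\ exists2 r, 0 < r & vanishes_outside r rho.

Lemma test1_bounds rho : test1 rho -> exists r C, [/\ 0 < r, 0 < C,
  vanishes_outside r rho, vanishes_outside r (derive1 rho) &
  forall x, `|rho x| <= C /\ `|derive1 rho x| <= C].
Proof.
move=> [s [r r0 h]]; have [s' _] := smooth1_derive s.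
have h' := vanishes_outside_derive h.
have [C C0 hC] := vanishes_outside_bounded (smooth1_continuous s) h.
have [C' C'0 hC'] := vanishes_outside_bounded (smooth1_continuous s') h'.
exists r, (Num.max C C'); split => //; first by rewrite lt_max C0.
by move=> x; rewrite !le_max hC hC' orbT.
Qed.

End PlaneFunctions.

(** * Real-valued integrals *)

Section RealIntegrals.
Context {d : measure_display} {X : measurableType d} {R : realType}.
Variable mu : {measure set X -> \bar R}.

(** The extended integral is infinite, and its [fine] part is [0]. *)
Lemma Rintegral_nonintegrable (D : set X) (f : X -> R) : measurable D ->
  measurable_fun D f -> ~ mu.-integrable D (EFin \o f) -> \int[mu]_(x in D) f x = 0.
Proof.
move=> mD mf nf; rewrite /Rintegral.
have : (\int[mu]_(x in D) (f x)%:E)%E \isn't a fin_num.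
  apply/negP => h; apply: nf; apply/integrableP; split; first exact/measurable_EFinP.
  by rewrite (integral_fin_num_abs mu mD mf).
by case: (\int[mu]_(x in D) (f x)%:E)%E.
Qed.

Lemma RintegralZl_measurable (D : set X) (c : R) (f : X -> R) : measurable D ->
  measurable_fun D f -> \int[mu]_(x in D) (c * f x) = c * \int[mu]_(x in D) f x.
Proof.
move=> mD mf; have [->|c0] := eqVneq c 0.
  by under eq_Rintegral do rewrite mul0r; rewrite Rintegral_cst // !mul0r.
have [fi|fni] := pselect (mu.-integrable D (EFin \o f)); first by rewrite RintegralZl.
rewrite (Rintegral_nonintegrable mD mf fni) mulr0 Rintegral_nonintegrable //.
  exact: measurable_funM.
move=> cfi; apply: fni.
apply: (eq_integrable mD _ _ _ (integrableZl mD c^-1 cfi)) => x _ /=.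
by rewrite -EFinM mulrA mulVf // mul1r.
Qed.

Lemma Rintegral_indic (D : set X) (f : X -> R) :
  \int[mu]_(x in D) f x = \int[mu]_x (\1_D x * f x).
Proof.
rewrite Rintegral_mkcond; apply: eq_Rintegral => x _.
by rewrite patch_indic /= mulrC.
Qed.

Lemma integrable_le_real (f g : X -> R) : measurable_fun setT f ->
  (forall x, `|f x| <= g x) -> mu.-integrable setT (EFin \o g) ->
  mu.-integrable setT (EFin \o f).
Proof.
move=> mf fg gi; apply: (le_integrable measurableT _ _ gi).
  exact/measurable_EFinP.
move=> x _; rewrite /= lee_fin; apply: le_trans (fg x) _; exact: ler_norm.
Qed.

Lemma ge0_integrable_real (f : X -> R) : measurable_fun setT f -> (forall x, 0 <= f x) ->
  (\int[mu]_x (f x)%:E < +oo)%E -> mu.-integrable setT (EFin \o f).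
Proof.
move=> mf f0 fi; apply/integrableP; split; first exact/measurable_EFinP.
by under eq_integral do rewrite /= ger0_norm //.
Qed.

Lemma integrable_indic_mul (D : set X) (f : X -> R) : measurable D ->
  mu.-integrable setT (EFin \o f) -> mu.-integrable setT (EFin \o (fun x => \1_D x * f x)).
Proof.
move=> mD fi; have /integrableP[/measurable_EFinP mf _] := fi.
apply: (integrable_le_real (g := fun x => `|f x|)); last exact: integrable_norm.
  by apply: measurable_funM => //; exact: measurable_indic.
by move=> x; rewrite normrM indicE; case: (x \in D); rewrite ?normr1 ?normr0 ?mul1r ?mul0r.
Qed.

Lemma integrable_restrictP (D : set X) (f : X -> R) : measurable D ->
  mu.-integrable D (EFin \o f) <-> mu.-integrable setT (EFin \o (fun x => \1_D x * f x)).
Proof.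
move=> mD; rewrite integrable_mkcond //.
rewrite (_ : (EFin \o f) \_ D = EFin \o (fun x => \1_D x * f x)) //.
by apply/funext => x; rewrite /patch /= indicE; case: ifP => _; rewrite ?mul1r ?mul0r.
Qed.

End RealIntegrals.

Section RealFubini.
Context {d1 d2 : measure_display} {T1 : measurableType d1} {T2 : measurableType d2} {R : realType}.
Variables (m1 : {sigma_finite_measure set T1 -> \bar R}) (m2 : {sigma_finite_measure set T2 -> \bar R}).
Variable F : T1 * T2 -> R.
Hypothesis Fi : (m1 \x m2)%E.-integrable setT (EFin \o F).

Let Rfubini_aux d (X : measurableType d) (m : {measure set X -> \bar R}) (G : X -> \bar R) :
  m.-integrable setT G -> m.-integrable setT (EFin \o (fine \o G)) /\
  \int[m]_s (fine (G s)) = fine (\int[m]_s G s)%E.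
Proof.
move=> Gi; have /integrableP[mG _] := Gi.
have mfG : measurable_fun setT (EFin \o (fine \o G)).
  by apply/measurable_EFinP; apply: measurableT_comp => //; exact: fine_measurable.
split.
  apply: (le_integrable measurableT mfG _ Gi) => x _ /=.
  by case: (G x) => [r| |] /=; rewrite ?lexx ?leey.
rewrite /Rintegral; congr fine; apply: ae_eq_integral => //.
have := integrable_ae measurableT Gi; apply: filterS => x /= h _.
by rewrite fineK //; exact: h.
Qed.

Lemma Rfubini1 : m1.-integrable setT (EFin \o (fun s => \int[m2]_y F (s, y))) /\
  \int[m1]_s \int[m2]_y F (s, y) = \int[(m1 \x m2)%E]_p F p.
Proof.
have [h1 h2] := Rfubini_aux (integrable_fubini_F Fi); split => //.
by rewrite [LHS]h2 /Rintegral -(integral12_prod_meas1 Fi).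
Qed.

Lemma Rfubini2 : m2.-integrable setT (EFin \o (fun y => \int[m1]_s F (s, y))) /\
  \int[m2]_y \int[m1]_s F (s, y) = \int[(m1 \x m2)%E]_p F p.
Proof.
have Gi : m2.-integrable setT (fubini_G m1 (EFin \o F)).
  have mF := measurable_int _ Fi.
  apply/integrableP; split; first exact: measurable_fubini_G Fi.
  apply: le_lt_trans ((integrable21ltyP m1 m2 mF).1 Fi).
  apply: ge0_le_integral => //.
  - by apply: measurableT_comp => //; exact: measurable_fubini_G Fi.
  - apply: (@measurable_fun_fubini_tonelli_G _ _ _ _ _ m1 (fun p => `|(EFin \o F) p|%E)).
      by apply: measurableT_comp.
    by move=> p; exact: abse_ge0.
  - move=> y _; apply: le_abse_integral => //.
    exact: (measurableT_comp mF (pair2_measurable y)).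
have [h1 h2] := Rfubini_aux Gi; split => //.
by rewrite [LHS]h2 /Rintegral -(integral21_prod_meas1 Fi).
Qed.

End RealFubini.

Section LineIntegrals.
Context {R : realType}.
Local Notation lam := (@lebesgue_measure R).

Lemma lebesgue_itv_cc (a b : R) : a <= b -> lam `[a, b]%classic = (b - a)%:E.
Proof.
by rewrite le_eqVlt => /orP[/eqP ->|ab]; rewrite lebesgue_measure_itv /= ?ltxx ?subrr // lte_fin ab.
Qed.

Lemma bounded_support_integrable (f : R -> R) (C r : R) : 0 < r ->
  measurable_fun setT f -> (forall x, `|f x| <= C) -> vanishes_outside r f ->
  lam.-integrable setT (EFin \o f) /\ `|\int[lam]_x f x| <= C * (2 * r).
Proof.
move=> r0 mf fC f0; have C0 : 0 <= C by apply: le_trans (fC 0).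
pose g x : R := C * \1_(`[- r, r]%classic) x.
have rr : - r <= r by lra.
have gi : lam.-integrable setT (EFin \o g).
  have := integrableZl measurableT C (integrable_indic_itv (- r) r true false).
  by apply: eq_integrable.
have fg x : `|f x| <= g x.
  rewrite /g indicE; case: (boolP (x \in _)) => [_|]; first by rewrite mulr1.
  rewrite notin_setE /= in_itv /= -ler_norml => /negP; rewrite -ltNge => /f0 ->.
  by rewrite normr0 mulr0.
have fi := integrable_le_real (mu := lam) mf fg gi; split => //.
apply: le_trans (le_normr_Rintegral measurableT fi) _.
apply: le_trans (le_Rintegral measurableT (integrable_norm fi) gi _) _; first by move=> x _; exact: fg.
rewrite RintegralZl //; last exact: (integrable_indic_itv (- r) r true false).
have e : lam `[- r, r]%classic = (2 * r)%:E.
  by rewrite lebesgue_itv_cc //; congr EFin; ring.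
by rewrite /Rintegral integral_indic // setIT [X in fine X]e.
Qed.

Lemma Heine (rho : R -> R) (r e : R) : continuous rho -> vanishes_outside r rho -> 0 < e ->
  exists2 dl : R, 0 < dl & forall x y, `|x - y| < dl -> `|rho x - rho y| < e.
Proof.
move=> c h e0; have e2 : 0 < e / 2 by rewrite divr_gt0.
pose K := `[- (r + 1), r + 1]%classic.
have cov : \forall dl \near (0 : R)^'+, K `<=` [set x | forall y, `|x - y| < dl -> `|rho x - rho y| < e].
  apply: ((compact_near_coveringP K).1 (@segment_compact R _ _) R _
    (fun dl x => forall y, `|x - y| < dl -> `|rho x - rho y| < e)) => x _.
  have /cvgrPdist_lt/(_ _ e2)/nbhs_ballP[dl /= dl0 hdl] := c x.
  have dl2 : 0 < dl / 2 by rewrite divr_gt0.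
  exists (ball x (dl / 2), [set d | d < dl / 2]) => /=.
    by split; [exact: nbhsx_ballx | exact: nbhs_right_lt].
  move=> [x' d] /= [xx' dd] y xy.
  have h1 : `|rho x - rho x'| < e / 2.
    by apply: hdl; apply: le_ball xx'; rewrite ler_pdivrMr // ler_pMr //; lra.
  have h2 : `|rho x - rho y| < e / 2.
    apply: hdl; rewrite /ball /=; have -> : x - y = (x - x') + (x' - y) by ring.
    apply: le_lt_trans (ler_normD _ _) _; rewrite [ltRHS]splitr ltrD //.
    exact: lt_trans xy dd.
  have -> : rho x' - rho y = (rho x - rho y) - (rho x - rho x') by ring.
  by apply: le_lt_trans (ler_normB _ _) _; rewrite [ltRHS]splitr ltrD.
have [dl [hdl dl0 dl1]] : exists dl : R, [/\ K `<=` [set x | forall y, `|x - y| < dl -> `|rho x - rho y| < e], 0 < dl & dl <= 1].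
  have : \forall dl \near (0 : R)^'+, [/\ K `<=` [set x | forall y, `|x - y| < dl -> `|rho x - rho y| < e], 0 < dl & dl <= 1].
    by near=> dl; split; near: dl => //; [exact: nbhs_right_gt | exact: nbhs_right_le].
  by move/filter_ex.
exists dl => // x y xy; have [xK|xK] := leP `|x| (r + 1).
  by apply: hdl => //; rewrite /K /= in_itv /= -ler_norml.
have -> : rho x = 0 by apply: h; lra.
have -> : rho y = 0.
  by apply: h; have := ler_normD y (x - y); rewrite addrC subrK; lra.
by rewrite subrr normr0.
Unshelve. all: by end_near.
Qed.

(** Partial sums of increments of [rho] at mesh points, each switched on by a
    smooth step: on the cell of [x] the sum is a convex combination of two
    nearby values of [rho]. *)
Lemma smooth_approximation (rho : R -> R) (r : nat) (e : R) : continuous rho ->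
  vanishes_outside r%:R rho -> 0 < e ->
  exists rho', [/\ smooth1 rho', vanishes_outside (r%:R + 2) rho' &
                  forall x, `|rho x - rho' x| <= e].
Proof.
move=> c h e0; have [dl dl0 hdl] := Heine c h e0.
have dl2 : 0 < dl / 2 by rewrite divr_gt0.
have [k0 _ hk0] := near_infty_natSinv_lt (PosNum dl2).
pose k := k0.+1; pose hh : R := k%:R^-1.
have hh0 : 0 < hh by rewrite invr_gt0 ltr0n.
have hhd : hh < dl / 2 by have := hk0 k0 (leqnn _).
have hh1 : hh <= 1 by rewrite invf_le1 ?ltr0n // ler1n.
pose xx (i : nat) : R := - (r%:R + 1) + i%:R * hh.
have xxS i : xx i.+1 = xx i + hh by rewrite /xx -natr1; ring.
pose S (N : nat) (x : R) := \sum_(0 <= i < N) (rho (xx i.+1) - rho (xx i)) * smooth_step (k%:R * x + (- (k%:R * xx i.+1))).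
have SS N x : S N.+1 x = S N x + (rho (xx N.+1) - rho (xx N)) * smooth_step (k%:R * x - k%:R * xx N.+1).
  by rewrite /S big_nat_recr.
have kk : k%:R * hh = 1 by rewrite /hh divff // pnatr_eq0.
have k00 : 0 < k%:R :> R by rewrite ltr0n.
have x0 : xx 0%N = - (r%:R + 1) by rewrite /xx mul0r addr0.
have rx0 : rho (xx 0%N) = 0.
  by apply: h; rewrite x0 normrN ger0_norm ?addr_ge0 //; lra.
have key N x : (xx N + hh <= x -> S N x = rho (xx N)) /\
               (x < xx N + hh -> `|rho x - S N x| <= e).
  elim: N => [|N [IH1 IH2]].
    rewrite /S big_nil rx0; split => // xl; rewrite subr0 h ?normr0 ?(ltW e0) //.
    rewrite x0 in xl; rewrite lter_normr; apply/orP; right; lra.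
  rewrite SS xxS; split => [xg|xl].
    rewrite IH1; last lra.
    rewrite smooth_step1 ?mulr1; first by rewrite addrC subrK.
    have : k%:R * hh <= k%:R * (x - (xx N + hh)) by rewrite ler_pM2l //; lra.
    by rewrite kk mulrBr.
  have [xl'|xg] := ltP x (xx N + hh).
    rewrite smooth_step0 ?mulr0 ?addr0; first exact: IH2.
    by rewrite -mulrBr pmulr_rle0 //; lra.
  rewrite IH1 //; set th := smooth_step _.
  have /andP[t0 t1] : 0 <= th <= 1 by exact: smooth_step_itv.
  clearbody th.
  have h1 : `|rho x - rho (xx N)| < e by apply: hdl; rewrite ltr_norml; apply/andP; split; lra.
  have h2 : `|rho x - rho (xx N + hh)| < e by apply: hdl; rewrite ltr_norml; apply/andP; split; lra.
  have -> : rho x - (rho (xx N) + (rho (xx N + hh) - rho (xx N)) * th) =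
     (1 - th) * (rho x - rho (xx N)) + th * (rho x - rho (xx N + hh)) by ring.
  apply: le_trans (ler_normD _ _) _; rewrite !normrM [`|th|]ger0_norm // [`|1 - th|]ger0_norm ?subr_ge0 //.
  have u1 := ler_wpM2l t0 (ltW h2).
  have t1' : 0 <= 1 - th by rewrite subr_ge0.
  have u2 := ler_wpM2l t1' (ltW h1).
  lra.
pose N := (k * (2 * r + 2))%N.
have xN : xx N = r%:R + 1.
  rewrite /xx /N natrM mulrAC kk mul1r natrD natrM; ring.
have rxN : rho (xx N) = 0 by apply: h; rewrite xN ger0_norm ?addr_ge0 //; lra.
exists (S N); split.
- apply: smooth1_sum => i; apply: smooth1_mul; first exact: smooth1_cst.
  by apply: smooth1_affine; exact: smooth_step_smooth1.
- move=> x; rewrite lter_normr => /orP[xr|xr].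
    by rewrite (key N x).1 ?rxN // xN; lra.
  rewrite /S; apply: big1_seq => i _; rewrite smooth_step0 ?mulr0 // -mulrBr pmulr_rle0 //.
  have : 0 <= i.+1%:R * hh by rewrite mulr_ge0 // ltW.
  rewrite /xx; lra.
- move=> x; have [xl|xg] := ltP x (xx N + hh); first exact: (key N x).2.
  rewrite (key N x).1 // rxN subr0 h ?normr0 ?(ltW e0) //.
  rewrite xN in xg; rewrite lter_normr; apply/orP; left; lra.
Qed.

End LineIntegrals.

(** * The continuity equation integrated in time *)

Section StripIntegrals.
Context {R : realType} {n : nat}.
Local Notation lam := (@lebesgue_measure R).
Local Notation lam2 := (lam \x lam)%E.
Implicit Types (mu w : R -> R -> 'cV[R]_n).

Lemma iterated_Rintegral (A : set R) (G : R -> R -> R) : measurable A ->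
  (forall s, A s -> measurable_fun setT (G s)) ->
  lam2.-integrable setT (EFin \o (fun p : R * R => \1_A p.1 * G p.1 p.2)) ->
  lam.-integrable A (EFin \o (fun s => \int[lam]_x G s x)) /\
  \int[lam]_(s in A) \int[lam]_x G s x = \int[lam2]_p (\1_A p.1 * G p.1 p.2).
Proof.
move=> mA mG iG; have [h1 h2] := Rfubini1 iG.
have e s : \int[lam]_x (\1_A s * G s x) = \1_A s * \int[lam]_x G s x.
  have [As|nAs] := pselect (A s).
    by rewrite RintegralZl_measurable //; exact: mG.
  rewrite indicE memNset // mul0r; under eq_Rintegral do rewrite mul0r.
  by rewrite Rintegral_cst // mul0r.
split.
  apply/(integrable_restrictP lam) => //.
  by move: h1; apply: eq_integrable => // s _ /=; rewrite e.
rewrite -h2 Rintegral_indic; apply: eq_Rintegral => s _; exact/esym/e.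
Qed.

Lemma measurable_time_indic (A : set R) : measurable A ->
  measurable_fun setT (fun p : R * R => \1_A p.1 : R).
Proof.
by move=> mA; apply: measurableT_comp; [exact: measurable_indic | exact: measurable_fst].
Qed.

Lemma measurable_norm_cV (d : measure_display) (X : measurableType d) (v : X -> 'cV[R]_n) :
  (forall i, measurable_fun setT (fun x => v x i 0)) ->
  measurable_fun setT (fun x => `|v x|).
Proof.
move=> mv; apply: (@measurable_comp_within _ _ _ _ setT v measurableT mv setT (fun z => `|z|)) => //.
by move=> z _; apply: cvg_within_filter; exact: norm_continuous.
Qed.

Section Strip.
Variables (T : R) (w : R -> R -> 'cV[R]_n).
Hypotheses (bw : borel_family T w).

Let strip : set (R * R) := `[0, T]%classic `*` setT.

Let mstrip : measurable strip.
Proof. exact: measurableX. Qed.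

Lemma measurable_strip_cut i :
  measurable_fun setT (fun p : R * R => \1_(`[0, T]%classic) p.1 * w p.1 p.2 i 0).
Proof.
have := (measurable_restrictT _ mstrip).1 (bw i); apply: eq_measurable_fun => p _.
rewrite patch_indic /= mulrC; congr (_ * _); rewrite !indicE; congr (_%:R).
by congr nat_of_bool; apply/idP/idP; rewrite !inE => // -[].
Qed.

Lemma measurable_strip_norm :
  measurable_fun setT (fun p : R * R => \1_(`[0, T]%classic) p.1 * `|w p.1 p.2|).
Proof.
have := @measurable_norm_cV _ _ (fun p : R * R => (\1_(`[0, T]%classic) p.1 : R) *: w p.1 p.2).
have h i : measurable_fun setT (fun p : R * R => ((\1_(`[0, T]%classic) p.1 : R) *: w p.1 p.2) i 0).
  by have := measurable_strip_cut i; apply: eq_measurable_fun => p _; rewrite mxE.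
move=> /(_ h); apply: eq_measurable_fun => p _; by rewrite normrZ ger0_norm.
Qed.

Lemma strip_integrableP : strip_integrable T w <-> forall r, 0 < r ->
  lam2.-integrable setT (EFin \o (fun p : R * R =>
    \1_(`[0, T]%classic) p.1 * (\1_(`[- r, r]%classic) p.2 * `|w p.1 p.2|))).
Proof.
have mN r : measurable_fun setT (fun p : R * R =>
    \1_(`[0, T]%classic) p.1 * (\1_(`[- r, r]%classic) p.2 * `|w p.1 p.2|)).
  under eq_fun do rewrite mulrCA.
  apply: measurable_funM; last exact: measurable_strip_norm.
  by apply: measurableT_comp; [exact: measurable_indic | exact: measurable_snd].
have N0 r (p : R * R) : 0 <= \1_(`[0, T]%classic) p.1 * (\1_(`[- r, r]%classic) p.2 * `|w p.1 p.2|).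
  by rewrite !mulr_ge0 // indicE.
have key r : (\int[lam2]_p (\1_(`[0%R, T]%classic) p.1 * (\1_(`[(- r)%R, r]%classic) p.2 * `|w p.1 p.2|))%:E =
  \int[lam]_(t in `[0%R, T]%classic) \int[lam]_(x in `[(- r)%R, r]%classic) `|w t x|%:E)%E.
  rewrite fubini_tonelli1; first last.
  - by move=> p; rewrite lee_fin; exact: N0.
  - by apply/measurable_EFinP; exact: mN.
  rewrite [RHS]integral_mkcond; apply: eq_integral => s _; rewrite /fubini_F /patch.
  case: ifPn => [sT|sT].
    rewrite [RHS]integral_mkcond; apply: eq_integral => x _; rewrite /patch /= !indicE sT mul1r.
    by case: ifPn => xr; rewrite ?mul1r ?mul0r.
  apply: integral0_eq => x _; by rewrite indicE (negbTE sT) mul0r.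
split => [h r r0|h r r0].
  by apply: ge0_integrable_real; [exact: mN | exact: N0 | rewrite key; exact: h].
rewrite -key; have /integrableP[_] := h r r0.
by under eq_integral do rewrite /= ger0_norm ?N0 //.
Qed.

Lemma measurable_strip_section i s : `[0, T]%classic s ->
  measurable_fun setT (fun x => w s x i 0).
Proof.
move=> sT; have := measurableT_comp (measurable_strip_cut i) (pair1_measurable s).
by apply: eq_measurable_fun => x _ /=; rewrite indicE mem_set // mul1r.
Qed.

Hypothesis hs : strip_integrable T w.

Lemma strip_kernel_integrable i (g : R * R -> R) C r : 0 < r -> measurable_fun setT g ->
  (forall p, `|g p| <= C) -> (forall p, r < `|p.2| -> g p = 0) ->
  lam2.-integrable setT
    (EFin \o (fun p : R * R => \1_(`[0, T]%classic) p.1 * (w p.1 p.2 i 0 * g p))).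
Proof.
move=> r0 mg gC g0.
have Hi := integrableZl (measurableT) C ((strip_integrableP.1 hs) r r0).
apply: (integrable_le_real (mu := lam2) (g := fun p : R * R =>
   C * (\1_(`[0, T]%classic) p.1 * (\1_(`[- r, r]%classic) p.2 * `|w p.1 p.2|)))) => //.
  under eq_fun do rewrite mulrA.
  by apply: measurable_funM => //; exact: measurable_strip_cut.
move=> p; rewrite normrM ger0_norm ?indicE // mulrCA ler_wpM2l //.
have C0 : 0 <= C by apply: le_trans (gC p).
have [pr|pr] := leP `|p.2| r.
  rewrite mem_set ?mul1r; last by rewrite /= in_itv /= -ler_norml.
  by rewrite normrM mulrC ler_pM // cV_coord_norm_le.
by rewrite g0 // mulr0 normr0 !mulr_ge0.
Qed.

Lemma strip_kernel_iterated i (g : R * R -> R) C r (A : set R) : 0 < r ->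
  measurable_fun setT g -> (forall p, `|g p| <= C) ->
  (forall p, r < `|p.2| -> g p = 0) -> measurable A -> A `<=` `[0, T]%classic ->
  [/\ lam.-integrable A (EFin \o (fun s => \int[lam]_x (w s x i 0 * g (s, x)))),
      lam2.-integrable setT
        (EFin \o (fun p : R * R => \1_A p.1 * (w p.1 p.2 i 0 * g p))) &
      \int[lam]_(s in A) \int[lam]_x (w s x i 0 * g (s, x)) =
      \int[lam2]_p (\1_A p.1 * (w p.1 p.2 i 0 * g p))].
Proof.
move=> r0 mg gC g0 mA AT.
have Hi := strip_kernel_integrable i r0 mg gC g0.
have H2 : lam2.-integrable setT
        (EFin \o (fun p : R * R => \1_A p.1 * (w p.1 p.2 i 0 * g p))).
  have mAp : measurable ((@fst R R) @^-1` A).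
    by have := @measurable_fst _ _ R R measurableT A mA; rewrite setTI.
  have := @integrable_indic_mul _ _ _ lam2 _ _ mAp Hi; apply: eq_integrable => // p _ /=.
  have -> : \1_(fst @^-1` A) p = \1_A p.1 :> R.
    by rewrite !indicE; congr ((nat_of_bool _)%:R); apply/idP/idP; rewrite !inE.
  have [Ap|nAp] := pselect (A p.1).
    by rewrite !indicE (mem_set Ap) (mem_set (AT _ Ap)) /= !mul1r.
  by rewrite !indicE (memNset nAp) /= !mul0r.
have mG s : A s -> measurable_fun setT (fun x => w s x i 0 * g (s, x)).
  move=> /AT sT; apply: measurable_funM; first exact: measurable_strip_section.
  exact: (measurableT_comp mg (pair1_measurable s)).
have e : (fun p : R * R => \1_A p.1 * (w p.1 p.2 i 0 * g (p.1, p.2))) =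
         (fun p : R * R => \1_A p.1 * (w p.1 p.2 i 0 * g p)).
  by apply/funext => -[].
have H3 : lam2.-integrable setT
   (EFin \o (fun p : R * R => \1_A p.1 * (fun s x => w s x i 0 * g (s, x)) p.1 p.2)).
  by rewrite /= e.
by have [h1 h2] := iterated_Rintegral mA mG H3; split; rewrite // h2 e.
Qed.

Lemma flux_iterated i (rho : R -> R) (A : set R) : test1 rho -> measurable A ->
  A `<=` `[0, T]%classic ->
  [/\ lam.-integrable A (EFin \o (fun s => \int[lam]_x (w s x i 0 * derive1 rho x))),
      lam2.-integrable setT
        (EFin \o (fun p : R * R => \1_A p.1 * (w p.1 p.2 i 0 * derive1 rho p.2))) &
      \int[lam]_(s in A) \int[lam]_x (w s x i 0 * derive1 rho x) =
      \int[lam2]_p (\1_A p.1 * (w p.1 p.2 i 0 * derive1 rho p.2))].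
Proof.
move=> t1 mA AT; have [r [C [r0 C0 _ h' hC]]] := test1_bounds t1.
have [s' _] := smooth1_derive t1.1.
apply: (@strip_kernel_iterated i (fun p => derive1 rho p.2) C r A) => //.
- by apply: measurableT_comp; [apply: continuous_measurable_fun; exact: smooth1_continuous | exact: measurable_snd].
- by move=> p; have [] := hC p.2.
- by move=> p; exact: h'.
Qed.

End Strip.

(** The continuity equation integrated in time and tested in space.  It
    controls [mu t] at every time, which the distributional form does not, and
    survives changes of the time variable that are merely absolutely
    continuous. *)
Definition weak_form (T : R) mu w : Prop :=
  forall (i : 'I_n) (rho : R -> R), test1 rho -> forall t, 0 <= t <= T ->
  \int[lam]_x (mu t x i 0 * rho x) = \int[lam]_x (mu 0 x i 0 * rho x) +
    \int[lam]_(s in `[0, t]%classic) \int[lam]_x (w s x i 0 * derive1 rho x).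

End StripIntegrals.

Section WeakForm.
Context {R : realType} {n : nat}.
Local Notation lam := (@lebesgue_measure R).
Local Notation lam2 := (lam \x lam)%E.
Variables (S : set 'cV[R]_n).
Hypothesis kS : compact S.

Lemma compact_coord_bounded : exists2 B : R, 0 < B & forall z i, S z -> `|z i 0| <= B.
Proof.
have [B [_ hB]] := compact_bounded kS.
exists (Num.max (B + 1) 1); first by rewrite lt_max ltr01 orbT.
move=> z i Sz; apply: le_trans (cV_coord_norm_le _ _) _; apply: hB => //.
by rewrite lt_max ltrDl ltr01.
Qed.

Lemma Mfun_test_integrable (f : R -> 'cV[R]_n) i (rho : R -> R) r B : Mfun S f ->
  continuous rho -> 0 < r -> vanishes_outside r rho ->
  (forall z i, S z -> `|z i 0| <= B) ->
  lam.-integrable setT (EFin \o (fun x => f x i 0 * rho x)) /\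
  forall e, (forall x, `|rho x| <= e) -> `|\int[lam]_x (f x i 0 * rho x)| <= B * e * (2 * r).
Proof.
move=> [mf Sf] cr r0 h hB; have [C C0 hC] := vanishes_outside_bounded cr h.
have mm : measurable_fun setT (fun x => f x i 0 * rho x).
  by apply: measurable_funM; [exact: mf | exact: continuous_measurable_fun].
have B0 : 0 <= B by apply: le_trans (hB (f 0) i (Sf 0)).
have v : vanishes_outside r (fun x => f x i 0 * rho x) by move=> x /h ->; rewrite mulr0.
have bd e : (forall x, `|rho x| <= e) -> forall x, `|f x i 0 * rho x| <= B * e.
  by move=> he x; rewrite normrM ler_pM // hB.
split; first by have [] := bounded_support_integrable r0 mm (bd C hC) v.
by move=> e he; have [] := bounded_support_integrable r0 mm (bd e he) v.
Qed.

Lemma within_continuous_approx (D : set R) (f : R -> R) :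
  (forall e, 0 < e -> exists2 g : R -> R, {within D, continuous g} &
     forall t, D t -> `|f t - g t| <= e) ->
  {within D, continuous f}.
Proof.
move=> h; apply/subspace_continuousP => t Dt; apply/cvgrPdist_lt => e e0.
have e4 : 0 < e / 4 by rewrite divr_gt0.
have [g /subspace_continuousP/(_ t Dt)/cvgrPdist_lt/(_ _ e4) cg fg] := h _ e4.
move: cg; rewrite !near_withinE; apply: filterS => s hs Ds.
have h1 : `|g t - g s| < e / 4 := hs Ds.
have h2 := fg t Dt; have h3 := fg s Ds.
have -> : f t - f s = (f t - g t) + (g t - g s) - (f s - g s) by ring.
apply: le_lt_trans (ler_normB _ _) _.
have := ler_normD (f t - g t) (g t - g s); lra.
Qed.

Lemma weak_form_continuous T mu (w : R -> R -> 'cV[R]_n) i rho : 0 < T ->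
  borel_family T w -> strip_integrable T w -> weak_form T mu w -> test1 rho ->
  {within `[0, T]%classic, continuous (fun t => \int[lam]_x (mu t x i 0 * rho x))}.
Proof.
move=> T0 bw sw wf tr.
have [fi _ _] := flux_iterated bw sw i tr (measurable_itv `[0, T]) (@subset_refl _ _).
have cJ := parameterized_integral_continuous (ltW T0) fi.
pose J t := \int[lam]_(s in `[0, t]%classic) \int[lam]_x (w s x i 0 * derive1 rho x).
have cJ' : {within `[0, T]%classic, continuous (fun t => \int[lam]_x (mu 0 x i 0 * rho x) + J t)}.
  by move=> t; apply: cvgD; [exact: cvg_cst | exact: cJ].
apply: (subspace_eq_continuous _ cJ') => t; rewrite inE /= in_itv /= => tT.
exact: esym (wf i rho tr t tT).
Qed.

(** Continuous test functions are uniform limits of smooth ones with a common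
    support, and [mu] is bounded. *)
Lemma weak_form_weakstar T mu (w : R -> R -> 'cV[R]_n) : 0 < T ->
  (forall t, 0 <= t <= T -> Mfun S (mu t)) ->
  borel_family T w -> strip_integrable T w -> weak_form T mu w ->
  weakstar_continuous T mu.
Proof.
move=> T0 Sm bw sw wf rho crho kr.
have [B B0 hB] := compact_coord_bounded.
have [r0 r00 vr0] : exists2 r : R, 0 < r & forall x, r < `|x| -> rho x = 0.
  have [b [_ hb]] := compact_bounded kr.
  exists (Num.max (b + 1) 1); first by rewrite lt_max ltr01 orbT.
  move=> x rx; apply: contrapT => nx.
  have sx : support_closure rho x by apply: subset_closure => /=; exact/eqP.
  have := hb (Num.max (b + 1) 1); rewrite lt_max ltrDl ltr01 => /(_ isT x sx) /= h.
  by move: rx; rewrite ltNge h.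
have [r hr] : exists r : nat, r0 <= r%:R.
  by exists (Num.bound r0); have := archi_boundP (ltW r00); move/ltW.
have r1 : 0 < r%:R :> R by apply: lt_le_trans hr.
have ci i : continuous (fun x => rho x i 0).
  by move=> x; exact: (cvg_comp _ _ (crho x) (@coord_continuous R n 1 i 0 (rho x))).
have vi i : vanishes_outside r%:R (fun x => rho x i 0).
  by move=> x rx; rewrite vr0 ?mxE // (le_lt_trans hr).
have vi' i : vanishes_outside (r%:R + 2) (fun x => rho x i 0).
  by move=> x rx; apply: vi; lra.
have r2 : 0 < r%:R + 2 :> R by rewrite addr_gt0.
have comp i : {within `[0, T]%classic, continuous (fun t => \int[lam]_x (mu t x i 0 * rho x i 0))}.
  apply: within_continuous_approx => e e0.
  pose e' := e / (B * (2 * (r%:R + 2))).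
  have e'0 : 0 < e' by rewrite divr_gt0 // !mulr_gt0.
  have [rho' [srho' vrho' hrho']] := smooth_approximation (ci i) (vi i) e'0.
  exists (fun t => \int[lam]_x (mu t x i 0 * rho' x)).
    have tr : test1 rho' by split => //; exists (r%:R + 2).
    exact: (weak_form_continuous (i := i) T0 bw sw wf tr).
  move=> t; rewrite /= in_itv /= => tT.
  have [i1 _] := Mfun_test_integrable i (Sm t tT) (ci i) r2 (vi' i) hB.
  have [i2 _] := Mfun_test_integrable i (Sm t tT) (smooth1_continuous srho') r2 vrho' hB.
  rewrite -RintegralB //.
  have cd : continuous (fun x => rho x i 0 - rho' x).
    by move=> x; apply: cvgB; [exact: ci | exact: smooth1_continuous].
  have vd : vanishes_outside (r%:R + 2) (fun x => rho x i 0 - rho' x).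
    by move=> x rx; rewrite vi' // vrho' // subrr.
  have [_ /(_ e')] := Mfun_test_integrable i (Sm t tT) cd r2 vd hB.
  move=> /(_ hrho'); under eq_Rintegral do rewrite mulrBr.
  move=> /le_trans; apply; rewrite /e' le_eqVlt; apply/orP; left; apply/eqP.
  by field; rewrite !gt_eqF.
have e t : 0 <= t <= T -> \int[lam]_x dotv (mu t x) (rho x) =
    \sum_i \int[lam]_x (mu t x i 0 * rho x i 0).
  move=> tT; under eq_Rintegral do rewrite dotvE.
  have ii i : lam.-integrable setT (EFin \o (fun x => mu t x i 0 * rho x i 0)).
    by have [] := Mfun_test_integrable i (Sm t tT) (ci i) r1 (vi i) hB.
  rewrite /Rintegral; under eq_integral do rewrite -sumEFin.
  rewrite integral_sum // -sum_fine // => i _; exact: (integrable_fin_num _ (ii i)).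
have cs : {within `[0, T]%classic, continuous (fun t => \sum_i \int[lam]_x (mu t x i 0 * rho x i 0))}.
  by move=> t; apply: (cvg_big add_continuous) => i _; exact: comp.
apply: (subspace_eq_continuous _ cs) => t; rewrite inE /= in_itv /= => tT.
exact/esym/e.
Qed.

End WeakForm.

(** * From the integrated equation to distributions *)

Section Dominated.
Context {d : measure_display} {X : measurableType d} {R : realType}.
Variable mu : {measure set X -> \bar R}.

Lemma Rdominated (D : set X) (f_ : nat -> X -> R) (f g : X -> R) : measurable D ->
  (forall k, measurable_fun D (f_ k)) -> measurable_fun D f ->
  {ae mu, forall x, D x -> (fun k => f_ k x) @ \oo --> f x} ->
  mu.-integrable D (EFin \o g) ->
  {ae mu, forall x k, D x -> `|f_ k x| <= g x} ->
  mu.-integrable D (EFin \o f) /\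
  (fun k => \int[mu]_(x in D) f_ k x) @ \oo --> \int[mu]_(x in D) f x.
Proof.
move=> mD mf_ mf cf gi fg.
have [fi _ c] : [/\ mu.-integrable D (EFin \o f),
   [sequence \int[mu]_(x in D) `|(EFin \o f_ k) x - (EFin \o f) x|]_k%E @ \oo --> 0%E &
   [sequence \int[mu]_(x in D) (EFin \o f_ k) x]_k%E @ \oo --> (\int[mu]_(x in D) (EFin \o f) x)%E].
  apply: (@dominated_convergence _ _ _ mu D mD (fun k => EFin \o f_ k) (EFin \o f) (EFin \o g)) => //.
  - by move=> k; exact/measurable_EFinP.
  - exact/measurable_EFinP.
  - move: cf; apply: filterS => x /= h Dx; apply: cvg_EFin; last exact: h.
    exact: nearW.
split => //; apply: fine_cvg; rewrite fineK //; exact: (integrable_fin_num _ fi).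
Qed.

End Dominated.

Lemma tensor_integrable {d1 d2 : measure_display} {T1 : measurableType d1} {T2 : measurableType d2}
    {R : realType} (m1 : {sigma_finite_measure set T1 -> \bar R})
    (m2 : {sigma_finite_measure set T2 -> \bar R}) (f : T1 -> R) (g : T2 -> R) :
  m1.-integrable setT (EFin \o f) -> m2.-integrable setT (EFin \o g) ->
  (m1 \x m2)%E.-integrable setT (EFin \o (fun q : T1 * T2 => f q.1 * g q.2)).
Proof.
move=> fi gi.
have /integrableP[/measurable_EFinP mf f8] := fi.
have /integrableP[/measurable_EFinP mg g8] := gi.
have mfg : measurable_fun setT (fun q : T1 * T2 => f q.1 * g q.2).
  apply: measurable_funM.
    exact: (measurable_comp measurableT (@subsetT _ _) mf measurable_fst).
  exact: (measurable_comp measurableT (@subsetT _ _) mg measurable_snd).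
have mE : measurable_fun setT (EFin \o (fun q : T1 * T2 => f q.1 * g q.2)) by exact/measurable_EFinP.
have {mE} H := @integrable12ltyP _ _ T1 T2 R m1 m2 _ mE.
apply: H.2.
have mnf : measurable_fun setT (fun x => (`|f x|)%:E) by apply/measurable_EFinP; exact: measurableT_comp.
have mng : measurable_fun setT (fun x => (`|g x|)%:E) by apply/measurable_EFinP; exact: measurableT_comp.
have -> : (\int[m1]_x \int[m2]_y `|(EFin \o (fun q : T1 * T2 => (f q.1 * g q.2)%R)) (x, y)| =
    \int[m1]_x (`|f x|%:E * \int[m2]_y `|g y|%:E))%E.
  apply: eq_integral => x _; rewrite -ge0_integralZl_EFin //.
  by apply: eq_integral => y _; rewrite /= normrM EFinM.
have gE : (\int[m2]_y `|g y|%:E)%E \is a fin_num.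
  by rewrite ge0_fin_numE ?integral_ge0 // => y _; rewrite lee_fin.
under eq_integral do rewrite -(fineK gE) muleC.
rewrite ge0_integralZl_EFin //; last by rewrite fine_ge0 // integral_ge0 // => y _; rewrite lee_fin.
by apply: lte_mul_pinfty => //; rewrite lee_fin fine_ge0 // integral_ge0 // => y _; rewrite lee_fin.
Qed.

Section PlaneMeasure.
Context {R : realType}.
Local Notation lam := (@lebesgue_measure R).

(** Lebesgue measure of the plane, as a measure that can again be a factor of
    a product measure. *)
Definition plane_measure : set (measurableTypeR R * measurableTypeR R) -> \bar R := (lam \x lam)%E.
HB.instance Definition _ := Measure.on plane_measure.

Let plane_measure_sigma_finite : sigma_finite setT plane_measure.
Proof.
pose I (k : nat) : set R := `[- k%:R, k%:R]%classic.
exists (fun k => (I k `*` I k : set (measurableTypeR R * measurableTypeR R))).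
  apply/seteqP; split => // -[x y] _.
  pose k := Num.bound (`|x| + `|y|).
  have lk : `|x| + `|y| < k%:R by apply: archi_boundP; apply: addr_ge0.
  have := normr_ge0 x; have := normr_ge0 y => y0 x0.
  by exists k => //; split; rewrite /I /= in_itv /= -ler_norml; lra.
move=> k; have mI : measurable (I k) by exact: measurable_itv.
split; first exact: measurableX.
have -> : plane_measure (I k `*` I k) = (lam (I k) * lam (I k))%E by exact: product_measure1E.
have kk : (- k%:R <= k%:R :> R) by rewrite (@le_trans _ _ 0) ?oppr_le0 ?ler0n.
by rewrite /I lebesgue_itv_cc // -EFinM ltry.
Qed.

HB.instance Definition _ := Measure_isSigmaFinite.Build _ _ _ plane_measure plane_measure_sigma_finite.

End PlaneMeasure.

Section WeakFormToDistributions.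
Context {R : realType} {n : nat}.
Local Notation lam := (@lebesgue_measure R).
Local Notation lam2 := (lam \x lam)%E.
Variables (S : set 'cV[R]_n) (T : R) (mu w : R -> R -> 'cV[R]_n).
Hypotheses (kS : compact S) (T0 : 0 < T) (Smu : forall t, 0 <= t <= T -> Mfun S (mu t)).
Hypotheses (bw : borel_family T w) (sw : strip_integrable T w) (wf : weak_form T mu w).

Section TestFunction.
Variables (psi : R * R -> R) (i : 'I_n).
Hypotheses (spsi : smooth_on setT psi) (kpsi : compact (support_closure psi)).
Hypothesis psiT : support_closure psi `<=` `]0, T[%classic `*` setT.

(** [psit], [psix] and [kap] stand for the derivatives of [psi] in [t], in [x]
    and in both; the argument uses only these properties of them. *)
Variables psit psix kap : R * R -> R.
Hypotheses (spsit : smooth_on setT psit) (spsix : smooth_on setT psix) (skap : smooth_on setT kap).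
Hypothesis dpsi1 : forall t x : R, is_derive t 1 (fun t => psi (t, x)) (psit (t, x)).
Hypothesis dpsi2 : forall t x : R, is_derive x 1 (fun x => psi (t, x)) (psix (t, x)).
Hypothesis dpsit : forall t x : R, is_derive x 1 (fun x => psit (t, x)) (kap (t, x)).
Hypothesis psit0 : forall p, ~ support_closure psi p -> psit p = 0.
Hypothesis psix0 : forall p, ~ support_closure psi p -> psix p = 0.
Hypothesis kap0 : forall p, ~ support_closure psi p -> kap p = 0.

Let outside : exists2 r : R, 0 < r & forall p, r < `|p.2| -> ~ support_closure psi p.
Proof.
have [r r0 hr] := support_radius kpsi; exists r => // p pr /hr[_].
by rewrite leNgt pr.
Qed.

Let bounds : exists r C, [/\ 0 < r, 0 < C, forall p, r < `|p.2| ->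
   [/\ psit p = 0, psix p = 0 & kap p = 0] &
   forall p, [/\ `|psit p| <= C, `|psix p| <= C & `|kap p| <= C]].
Proof.
have [r r0 hr] := outside.
have [C1 C10 h1] := compact_support_bounded (smooth_on_continuous spsit) kpsi psit0.
have [C2 C20 h2] := compact_support_bounded (smooth_on_continuous spsix) kpsi psix0.
have [C3 C30 h3] := compact_support_bounded (smooth_on_continuous skap) kpsi kap0.
exists r, (Num.max C1 (Num.max C2 C3)); split => //; first by rewrite lt_max C10.
  by move=> p /hr np; rewrite psit0 // psix0 // kap0.
by move=> p; rewrite !le_max h1 h2 h3 !orbT.
Qed.

Let test_psit tau : test1 (fun x => psit (tau, x)) /\
  derive1 (fun x => psit (tau, x)) = (fun x => kap (tau, x)).
Proof.
have [s _] := smooth_on_section tau spsit; split; last first.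
  by apply/funext => x; rewrite derive1E; have [_ ->] := dpsit tau x.
split; first exact: s.
have [r [C [r0 _ h _]]] := bounds.
by exists r => // x /(h (tau, x))[].
Qed.

Let end0 x : psi (0, x) = 0 /\ psi (T, x) = 0.
Proof.
by split; apply: support_closureP => /psiT[]; rewrite /= in_itv /= ?ltxx ?andbF.
Qed.

Let slice_cont (phi : R * R -> R) x : smooth_on setT phi -> continuous (fun t => phi (t, x)).
Proof.
move=> s t; apply: differentiable_continuous; apply/derivable1_diffP.
by have [] := is_derive_section1 (s [::] (t, x) I).
Qed.

Let itv_integrable (f : R -> R) a b : continuous f -> lam.-integrable `[a, b]%classic (EFin \o f).
Proof.
by move=> cf; apply: continuous_compact_integrable; [exact: segment_compact | exact: continuous_subspaceT].
Qed.

Let primitive t x : 0 <= t <= T ->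
  \int[lam]_(tau in `[t, T]%classic) psit (tau, x) = - psi (t, x).
Proof.
move=> /andP[t0]; rewrite le_eqVlt => /orP[/eqP ->|tT].
  by rewrite set_itv1 Rintegral_set1 (end0 x).2 oppr0.
have cpsi := @slice_cont psi x spsi.
rewrite /Rintegral (@continuous_FTC2 _ _ (fun s => psi (s, x))) //.
- by rewrite -EFinB /= (end0 x).2 sub0r.
- by apply: continuous_subspaceT; exact: slice_cont.
- split; first by move=> s _; have [] := dpsi1 s x.
    by apply: cvg_at_right_filter; exact: cpsi.
  by apply: cvg_at_left_filter; exact: cpsi.
by move=> s _; rewrite derive1E; have [_ ->] := dpsi1 s x.
Qed.

(** Differentiating [primitive] in [x]. *)
Let primitive_x t x : 0 <= t <= T ->
  \int[lam]_(tau in `[t, T]%classic) kap (tau, x) = - psix (t, x).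
Proof.
move=> tT; have [r [C [r0 C0 _ hC]]] := bounds.
have e1 : (fun y => \int[lam]_(tau in `[t, T]%classic) psit (tau, y)) = (fun y => - psi (t, y)).
  by apply/funext => y; exact: primitive.
have xI : `](x - 1), (x + 1)[%classic x by rewrite /= in_itv /=; apply/andP; split; lra.
have := @differentiation_under_integral R _ _ lam (fun y tau => psit (tau, y)) `[t, T]%classic
  (measurable_itv _) x (x - 1) (x + 1) xI _ _ (fun=> C).
rewrite e1.
have der y tau : derive1 (fun y => psit (tau, y)) y = kap (tau, y).
  by rewrite derive1E; have [_ ->] := dpsit tau y.
have -> : derive1 (fun y => - psi (t, y)) x = - psix (t, x).
  by rewrite derive1E; have [_ ->] := is_deriveN (dpsi2 t x).
move=> H; rewrite H.
- by apply: eq_Rintegral => tau _; rewrite /partial1of2 der.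
- by move=> y _; apply: itv_integrable; exact: slice_cont.
- by move=> y tau _ _; have [] := dpsit tau y.
- by move=> _; exact: ltW.
- by apply: itv_integrable; exact: cst_continuous.
- by move=> y tau _ _; rewrite /partial1of2 der; have [] := hC (tau, y).
Qed.

Let flux_term : R := \int[lam]_(t in `[0, T]%classic) \int[lam]_x (psix (t, x) * w t x i 0).

(** This is [w(s, x) * d_x d_t psi(tau, x)] on [0 <= s <= tau <= T]. Integrated
    in [tau] first it gives the flux term, integrated in [(s, x)] first the
    increment of [mu] from [0] to [tau], by the weak form. *)
Let kernel (q : (R * R) * R) : R := \1_(`[0, T]%classic) q.1.1 * (w q.1.1 q.1.2 i 0 *
  (\1_(`[0, T]%classic) q.2 * (\1_[set q : (R * R) * R | q.1.1 <= q.2] q * kap (q.2, q.1.2)))).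

Let measurable_last : measurable_fun setT (fun q : (R * R) * R => \1_(`[0, T]%classic) q.2 : R).
Proof.
have mi : measurable_fun setT (\1_(`[0, T]%classic) : R -> R) by exact: measurable_indic.
have ms : measurable_fun setT (snd : (R * R) * R -> R) by exact: measurable_snd.
exact: (measurable_comp measurableT (@subsetT _ _) mi ms).
Qed.

Let measurable_kernel : measurable_fun setT kernel.
Proof.
have m1 : measurable_fun setT (fun q : (R * R) * R => q.1.1).
  by apply: measurableT_comp; [exact: measurable_fst | exact: measurable_fst].
have m2 : measurable_fun setT (fun q : (R * R) * R => q.1.2).
  by apply: measurableT_comp; [exact: measurable_snd | exact: measurable_fst].
have mle : measurable [set q : (R * R) * R | q.1.1 <= q.2].
  have := measurable_fun_ler m1 (@measurable_snd _ _ (R * R)%type R).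
  by move=> /(_ measurableT [set true] I); rewrite setTI preimage_true.
have mw := measurable_strip_cut bw i.
have -> : kernel = (fun q : (R * R) * R => (\1_(`[0, T]%classic) q.1.1 * w q.1.1 q.1.2 i 0) *
  (\1_(`[0, T]%classic) q.2 * (\1_[set q : (R * R) * R | q.1.1 <= q.2] q * kap (q.2, q.1.2)))).
  by apply/funext => q; rewrite /kernel !mulrA.
apply: measurable_funM.
  have mf : measurable_fun setT (fst : (R * R) * R -> R * R) by exact: measurable_fst.
  exact: (measurable_comp measurableT (@subsetT _ _) mw mf).
apply: measurable_funM; first exact: measurable_last.
apply: measurable_funM; first exact: measurable_indic.
apply: (measurableT_comp (continuous_measurable_plane (smooth_on_continuous skap))).
apply/measurable_fun_pairP; split; [exact: measurable_snd | exact: m2].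
Qed.

Let integrable_kernel : (plane_measure \x lam)%E.-integrable setT (EFin \o kernel).
Proof.
have [r [C [r0 C0 h0 hC]]] := bounds.
pose N (p : R * R) := \1_(`[0, T]%classic) p.1 * (\1_(`[- r, r]%classic) p.2 * `|w p.1 p.2|).
have Ni : plane_measure.-integrable setT (EFin \o N) by exact: (strip_integrableP bw).1.
have N0 p : 0 <= N p by rewrite /N !indicE !mulr_ge0.
have /integrableP[/measurable_EFinP mN _] := Ni.
pose D (q : (R * R) * R) := N q.1 * (C * \1_(`[0, T]%classic) q.2).
have D0 q : 0 <= D q by rewrite /D !indicE !mulr_ge0 // ltW.
have ci : lam.-integrable setT (EFin \o (fun s => C * \1_(`[0, T]%classic) s)).
  exact: (integrableZl measurableT C (integrable_indic_itv 0 T true false)).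
have Di : (plane_measure \x lam)%E.-integrable setT (EFin \o D) .
  have H := @tensor_integrable _ _ _ _ R plane_measure lam N _ Ni ci.
  exact: H.
apply: (integrable_le_real (mu := (plane_measure \x lam)%E) measurable_kernel _ Di) => q.
rewrite /kernel !normrM; case: (ltP r `|q.1.2|) => [/(h0 (q.2, q.1.2)) [_ _ ->]|pr].
  by rewrite normr0 !mulr0; exact: D0.
have -> : D q = \1_(`[0, T]%classic) q.1.1 * (`|w q.1.1 q.1.2| * (\1_(`[0, T]%classic) q.2 * (1 * C))).
  have e1 : \1_(`[- r, r]%classic) q.1.2 = 1 :> R by rewrite indicE mem_set //= in_itv /= -ler_norml.
  by rewrite /D /N e1; ring.
have ni (A : set R) x : `|\1_A x| = \1_A x :> R by rewrite ger0_norm // indicE.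
rewrite !ni; apply: ler_wpM2l; first by rewrite indicE.
have n0 (A : set R) x : 0 <= \1_A x :> R by rewrite indicE.
have m0 : (0 <= \1_[set q : (R * R) * R | q.1.1 <= q.2] q :> R) && (\1_[set q : (R * R) * R | q.1.1 <= q.2] q <= 1 :> R).
  by rewrite indicE; case: (_ \in _); rewrite /= lexx ler01.
case/andP: m0 => m0 ml1; rewrite (ger0_norm m0).
apply: ler_pM; [exact: normr_ge0 | | exact: cV_coord_norm_le | ].
  by rewrite mulr_ge0 // mulr_ge0.
apply: ler_wpM2l; first exact: n0.
by apply: ler_pM => //; have [] := hC (q.2, q.1.2).
Qed.

Let kernel_sections (p : R * R) (tau : R) :
  kernel (p, tau) = \1_(`[0, T]%classic) p.1 * (w p.1 p.2 i 0 * (\1_(`[p.1, T]%classic) tau * kap (tau, p.2))) /\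
  kernel (p, tau) = \1_(`[0, T]%classic) tau * (\1_(`[0, tau]%classic) p.1 * (w p.1 p.2 i 0 * kap (tau, p.2))).
Proof.
rewrite /kernel /=.
have iE (a b x : R) : \1_(`[a, b]%classic) x = ((a <= x) && (x <= b))%:R :> R.
  by rewrite indicE mem_setE in_itv.
have jE : \1_[set q : (R * R) * R | q.1.1 <= q.2] (p, tau) = ((p.1 <= tau)%R)%:R :> R.
  by rewrite indicE; congr (nat_of_bool _)%:R; apply/idP/idP => [/set_mem|h]; [|apply/mem_set].
rewrite !iE jE.
have h1 : 0 <= p.1 -> p.1 <= tau -> 0 <= tau by exact: le_trans.
have h2 : p.1 <= tau -> tau <= T -> p.1 <= T by exact: le_trans.
have h3 : forall b1 b2 b3 b4 b5 : bool, (b1 -> b5 -> b3) -> (b5 -> b4 -> b2) -> forall a c : R,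
   (b1 && b2)%:R * (a * ((b3 && b4)%:R * (b5%:R * c))) = (b1 && b2)%:R * (a * ((b5 && b4)%:R * c)) /\
   (b1 && b2)%:R * (a * ((b3 && b4)%:R * (b5%:R * c))) = (b3 && b4)%:R * ((b1 && b5)%:R * (a * c)).
  move=> [] [] [] [] [] // x y a c; rewrite /= ?mul0r ?mul1r ?mulr0 //; by [have := x isT isT|have := y isT isT].
exact: h3.
Qed.

Let mkap1 x : measurable_fun setT (fun tau => kap (tau, x)).
Proof. by apply: continuous_measurable_fun; exact: slice_cont. Qed.

Let mpsit1 x : measurable_fun setT (fun tau => psit (tau, x)).
Proof. by apply: continuous_measurable_fun; exact: slice_cont. Qed.

Let kernel_flux : \int[plane_measure]_p \int[lam]_tau kernel (p, tau) = - flux_term.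
Proof.
have [r [C [r0 C0 h0 hC]]] := bounds.
have mpsix := continuous_measurable_plane (smooth_on_continuous spsix).
have bpsix p : `|psix p| <= C by have [] := hC p.
have zpsix p : r < `|p.2| -> psix p = 0 by move=> /h0[].
have [_ gi fE] := strip_kernel_iterated bw sw i r0 mpsix bpsix zpsix (measurable_itv _) (@subset_refl _ _).
have -> : flux_term = \int[lam2]_p (\1_(`[0, T]%classic) p.1 * (w p.1 p.2 i 0 * psix p)).
  rewrite -fE /flux_term; apply: eq_Rintegral => s _; apply: eq_Rintegral => x _.
  exact: mulrC.
have -> : \int[plane_measure]_p \int[lam]_tau kernel (p, tau) =
    \int[lam2]_p (- 1 * (\1_(`[0, T]%classic) p.1 * (w p.1 p.2 i 0 * psix p))).
  apply: eq_Rintegral => p _.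
  transitivity (\int[lam]_tau ((\1_(`[0, T]%classic) p.1 * w p.1 p.2 i 0) * (\1_(`[p.1, T]%classic) tau * kap (tau, p.2)))).
    by apply: eq_Rintegral => tau _; rewrite (kernel_sections p tau).1; ring.
  rewrite RintegralZl_measurable //; last first.
    by apply: measurable_funM; [exact: measurable_indic | exact: mkap1].
  rewrite -(Rintegral_indic lam).
  have [pT|pT] := boolP (p.1 \in `[0, T]); last first.
    by rewrite indicE mem_setE (negbTE pT) /= !mul0r mulr0.
  by rewrite primitive_x; [case: p pT => s x _ /=; ring | move: pT; rewrite in_itv].
rewrite RintegralZl_measurable // ?mulN1r //.
by case/integrableP: gi => /measurable_EFinP.
Qed.

Let a tau : R := \int[lam]_x (mu tau x i 0 * psit (tau, x)).
Let b tau : R := \int[lam]_x (mu 0 x i 0 * psit (tau, x)).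

Let kernel_time tau : \int[plane_measure]_p kernel (p, tau) = \1_(`[0, T]%classic) tau * (a tau - b tau).
Proof.
have [tT|tT] := boolP (tau \in `[0, T]); last first.
  have i0 : \1_(`[0, T]%classic) tau = 0 :> R by rewrite indicE mem_setE (negbTE tT).
  rewrite i0 mul0r; transitivity (\int[plane_measure]_p ((cst (0 : R)) p)).
    by apply: eq_Rintegral => p _; rewrite (kernel_sections p tau).2 i0 mul0r.
  by rewrite /Rintegral integral0.
have i1 : \1_(`[0, T]%classic) tau = 1 :> R by rewrite indicE mem_setE tT.
rewrite i1 mul1r.
have {}tT : 0 <= tau <= T by move: tT; rewrite in_itv.
have [tp dE] := test_psit tau.
have sub : `[0, tau]%classic `<=` `[0, T]%classic.
  move=> s /=; rewrite !in_itv /= => /andP[-> /le_trans]; apply.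
  by case/andP: tT.
have [_ _ fE] := flux_iterated bw sw i tp (measurable_itv _) sub.
rewrite /a (wf i tp tT) fE /b addrC addKr; apply: eq_Rintegral => p _.
by rewrite (kernel_sections p tau).2 dE i1 mul1r.
Qed.

Let initial_integrable : lam2.-integrable setT
  (EFin \o (fun p : R * R => \1_(`[0, T]%classic) p.1 * (mu 0 p.2 i 0 * psit p))).
Proof.
have [r [C [r0 C0 h0 hC]]] := bounds.
have [B B0 hB] := compact_coord_bounded kS.
have S0 : Mfun S (mu 0) by apply: Smu; rewrite lexx ltW.
have i1 := integrable_indic_itv (0 : R) T true false.
have i2 := integrableZl measurableT (B * C) (integrable_indic_itv (- r) r true false).
have H := @tensor_integrable _ _ _ _ R lam lam _ _ i1 i2.
have ms : measurable_fun setT (snd : R * R -> R) by exact: measurable_snd.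
have mf : measurable_fun setT (fst : R * R -> R) by exact: measurable_fst.
have mi : measurable_fun setT (\1_(`[0, T]%classic) : R -> R) by exact: measurable_indic.
apply: (integrable_le_real (mu := lam2) _ _ H).
  apply: measurable_funM; first exact: (measurable_comp measurableT (@subsetT _ _) mi mf).
  apply: measurable_funM; last exact: (continuous_measurable_plane (smooth_on_continuous spsit)).
  exact: (measurable_comp measurableT (@subsetT _ _) (S0.1 i) ms).
move=> p; rewrite normrM ger0_norm; last by rewrite indicE.
apply: ler_wpM2l; first by rewrite indicE.
case: (ltP r `|p.2|) => [/h0[-> _ _]|pr].
  by rewrite mulr0 normr0 /= !mulr_ge0 ?indicE // ltW.
rewrite /= indicE mem_set ?mulr1 /=; last by rewrite in_itv /= -ler_norml.
by rewrite normrM; apply: ler_pM => //; [exact: hB (S0.2 _) | have [] := hC p].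
Qed.

(** [psi] vanishes at both end times. *)
Let initial_pairing : lam.-integrable `[0, T]%classic (EFin \o b) /\
  \int[lam]_(tau in `[0, T]%classic) b tau = 0.
Proof.
have mT : measurable `[0, T]%classic by exact: measurable_itv.
have S0 : Mfun S (mu 0) by apply: Smu; rewrite lexx ltW.
have [i1 e1] := Rfubini1 (m1 := lam) (m2 := lam) initial_integrable.
have [_ e2] := Rfubini2 (m1 := lam) (m2 := lam) initial_integrable.
have bE : (fun s => \int[lam]_y (\1_(`[0, T]%classic) s * (mu 0 y i 0 * psit (s, y)))) =
    (fun s => \1_(`[0, T]%classic) s * b s).
  apply/funext => s; rewrite RintegralZl_measurable //.
  apply: measurable_funM; first exact: S0.1.
  have [s1 _] := smooth_on_section s spsit.
  by apply: continuous_measurable_fun; exact: smooth1_continuous.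
split; first by apply/(integrable_restrictP lam) => //; move: i1; rewrite /= bE.
rewrite (Rintegral_indic lam) -bE [LHS]e1 -[LHS]e2.
transitivity (\int[lam]_y ((cst (0 : R)) y)); last by rewrite /Rintegral integral0.
apply: eq_Rintegral => y _ /=.
transitivity (\int[lam]_s (mu 0 y i 0 * (\1_(`[0, T]%classic) s * psit (s, y)))).
  by apply: eq_Rintegral => s _; ring.
rewrite RintegralZl_measurable //; last first.
  by apply: measurable_funM; [exact: measurable_indic | exact: mpsit1].
by rewrite -(Rintegral_indic lam) primitive ?lexx ?ltW // (end0 y).1 oppr0 mulr0.
Qed.

Lemma test_function_pairing :
  \int[lam]_(t in `[0, T]%classic) \int[lam]_x (psit (t, x) * mu t x i 0) +
  \int[lam]_(t in `[0, T]%classic) \int[lam]_x (psix (t, x) * w t x i 0) = 0.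
Proof.
have mT : measurable `[0, T]%classic by exact: measurable_itv.
have [_ e1] := Rfubini1 (m1 := plane_measure) (m2 := lam) integrable_kernel.
have [i2 e2] := Rfubini2 (m1 := plane_measure) (m2 := lam) integrable_kernel.
rewrite -/flux_term.
have -> : flux_term = - \int[lam]_(t in `[0, T]%classic) (a t - b t).
  rewrite (Rintegral_indic lam); under eq_Rintegral do rewrite -kernel_time.
  by rewrite e2 -e1 kernel_flux opprK.
have -> : (fun t => \int[lam]_x (psit (t, x) * mu t x i 0)) = a.
  by apply/funext => t; apply: eq_Rintegral => x _; exact: mulrC.
have [bi b0] := initial_pairing.
have abi : lam.-integrable `[0, T]%classic (EFin \o (fun t => a t - b t)).
  apply/(integrable_restrictP lam) => //; move: i2; congr (lam.-integrable _ _).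
  by apply/funext => t /=; rewrite kernel_time.
have -> : \int[lam]_(t in `[0, T]%classic) a t =
    \int[lam]_(t in `[0, T]%classic) ((a t - b t) + b t).
  by apply: eq_Rintegral => t _; rewrite subrK.
by rewrite RintegralD // b0 addr0 subrr.
Qed.

End TestFunction.

Lemma weak_form_continuity_eq : continuity_eq T mu w.
Proof.
move=> psi spsi kpsi psiT i.
have st : smooth_on setT ('D_((1, 0) : R * R) psi) by exact: smooth_on_derive.
have sx : smooth_on setT ('D_((0, 1) : R * R) psi) by exact: smooth_on_derive.
have sk : smooth_on setT ('D_((0, 1) : R * R) ('D_((1, 0) : R * R) psi)) by exact: smooth_on_derive.
have zt p : ~ support_closure psi p -> 'D_((1, 0) : R * R) psi p = 0 by exact: support_derive.
have zx p : ~ support_closure psi p -> 'D_((0, 1) : R * R) psi p = 0 by exact: support_derive.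
apply: (test_function_pairing i spsi kpsi psiT st sx sk _ _ _ zt zx).
- by move=> t x; exact: (is_derive_section1 (spsi [::] (t, x) I)).
- by move=> t x; exact: (is_derive_section2 (spsi [::] (t, x) I)).
- by move=> t x; exact: (is_derive_section2 (st [::] (t, x) I)).
move=> p pS; apply: (@derive_vanish _ _ _ (~` support_closure psi)) => //.
by apply: closed_openC; exact: closed_closure.
Qed.

End WeakFormToDistributions.

(** * From distributions to the integrated equation *)

Section Primitives.
Context {R : realType}.
Local Notation lam := (@lebesgue_measure R).

Lemma continuous_itv_integrable (f : R -> R) (a b : R) :
  {within `[a, b]%classic, continuous f} -> lam.-integrable `[a, b]%classic (EFin \o f).
Proof. by move=> cf; apply: continuous_compact_integrable => //; exact: segment_compact. Qed.

Lemma Rintegral_derive1 (f : R -> R) (a b : R) : smooth1 f -> a <= b ->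
  \int[lam]_(t in `[a, b]%classic) derive1 f t = f b - f a.
Proof.
move=> sf; rewrite le_eqVlt => /orP[/eqP ->|ab].
  by rewrite set_itv1 Rintegral_set1 subrr.
have [sf' df] := smooth1_derive sf.
have cf := smooth1_continuous sf; have cf' := smooth1_continuous sf'.
rewrite /Rintegral (@continuous_FTC2 _ _ f) //.
- exact: continuous_subspaceT.
- split; first by move=> s _; have [] := df s.
    by apply: cvg_at_right_filter; exact: cf.
  by apply: cvg_at_left_filter; exact: cf.
Qed.

Lemma Rintegral_itv_cat (h : R -> R) (a b c : R) : a <= b -> b <= c ->
  lam.-integrable `[a, c]%classic (EFin \o h) ->
  \int[lam]_(t in `[a, c]%classic) h t =
  \int[lam]_(t in `[a, b]%classic) h t + \int[lam]_(t in `[b, c]%classic) h t.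
Proof.
move=> ab bc hi.
have := @Rintegral_itvB R h (BLeft a) (BRight c) b hi.
rewrite !bnd_simp => /(_ ab bc) H.
rewrite -(Rintegral_itv_obnd_cbnd (r := b) (b := BRight c)); last first.
  apply: integrableS hi => // x /=; rewrite !in_itv /= => /andP[bx ->].
  by rewrite andbT; exact: (le_trans ab (ltW bx)).
by rewrite -H addrC subrK.
Qed.

Let theta := @smooth_step R.

Let step_derivative : exists2 C, 0 < C & forall x, `|derive1 theta x| <= C.
Proof.
have [s' _] := smooth1_derive (@smooth_step_smooth1 R).
have [] := @vanishes_outside_bounded R 1 (derive1 theta) (smooth1_continuous s').
  move=> x x1; have [x0|x0] := ltP x 0.
    rewrite derive1E; apply: (@derive_vanish R R theta [set y : R | y < 0]) => //.
    by move=> y /= /ltW; exact: smooth_step0.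
  have xg1 : 1 < x by move: x1; rewrite ger0_norm.
  have v1 : 'D_1 (fun y => theta y - 1) x = 0.
    apply: (@derive_vanish R R (fun y => theta y - 1) [set y : R | 1 < y]) => //.
    by move=> y /= /ltW h; rewrite /theta smooth_step1 // subrr.
  have [_ d] := smooth1_derive (@smooth_step_smooth1 R).
  have [_ e] := is_deriveB (d x) (is_derive_cst (1 : R) x 1).
  by move: v1; rewrite e subr0.
by move=> C C0 h; exists C.
Qed.

(** A steep smooth step from 0 to 1, rising on [a, a + 1/(k+1)]. *)
Let ramp (k : nat) (a t : R) := theta (k.+1%:R * t + - (k.+1%:R * a)).

Let ramp_smooth k a : smooth1 (ramp k a).
Proof. exact: smooth1_affine (@smooth_step_smooth1 R). Qed.

Let ramp0 k a t : t <= a -> ramp k a t = 0.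
Proof.
move=> ta; apply: smooth_step0; rewrite -mulrBr pmulr_rle0 ?subr_le0 //.
Qed.

Let ramp1 k a t : a + k.+1%:R^-1 <= t -> ramp k a t = 1.
Proof.
move=> ta; apply: smooth_step1; by rewrite -mulrBr -ler_pdivrMl // mulr1 lerBrDl.
Qed.

Let ramp_derive k a C : (forall x, `|derive1 theta x| <= C) -> forall t,
  `|derive1 (ramp k a) t| <= k.+1%:R * C * \1_(`[a, a + k.+1%:R^-1]%classic) t.
Proof.
move=> hC t; have [tI|tI] := boolP (t \in `[a, a + k.+1%:R^-1]).
  rewrite indicE mem_setE tI mulr1.
  have [_ d] := smooth1_derive (@smooth_step_smooth1 R).
  have [_] := is_derive_affine (a := k.+1%:R) (b := - (k.+1%:R * a)) (d (k.+1%:R * t + - (k.+1%:R * a))).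
  rewrite -derive1E => ->; rewrite normrM ger0_norm //.
  by apply: ler_wpM2l => //; exact: hC.
rewrite indicE mem_setE (negbTE tI) mulr0 normr_le0 derive1E; apply/eqP.
move: tI; rewrite in_itv /= negb_and -!ltNge => /orP[ta|ta].
  apply: (@derive_vanish R R (ramp k a) [set y : R | y < a]) => //.
  by move=> y /= /ltW; exact: ramp0.
have v1 : 'D_1 (fun y => ramp k a y - 1) t = 0.
  apply: (@derive_vanish R R (fun y => ramp k a y - 1) [set y : R | a + k.+1%:R^-1 < y]) => //.
  by move=> y /= /ltW h; rewrite ramp1 // subrr.
have [_ d] := smooth1_derive (ramp_smooth k a).
have [_ e] := is_deriveB (d t) (is_derive_cst (1 : R) t 1).
by move: v1; rewrite e subr0 derive1E.
Qed.

Variables (T : R) (m h : R -> R).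
Hypotheses (T0 : 0 < T) (cm : {within `[0, T]%classic, continuous m}).
Hypothesis hi : lam.-integrable `[0, T]%classic (EFin \o h).

Let ramp_m_integrable k a :
  lam.-integrable `[0, T]%classic (EFin \o (fun t => derive1 (ramp k a) t * m t)).
Proof.
apply: continuous_itv_integrable => t; apply: cvgM; last exact: cm.
have [s' _] := smooth1_derive (ramp_smooth k a).
exact: (continuous_subspaceT (smooth1_continuous s')).
Qed.

(** The derivatives of the steps are approximate units at [a]. *)
Let ramp_approximate_unit a : 0 <= a < T ->
  (fun k => \int[lam]_(t in `[0, T]%classic) (derive1 (ramp k a) t * m t)) @ \oo --> m a.
Proof.
move=> /andP[a0 aT]; have [C C0 hC] := step_derivative.
have aI : `[0, T]%classic a by rewrite /= in_itv /= a0 ltW.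
apply/cvgrPdist_le => e e0.
have eC : 0 < e / C by rewrite divr_gt0.
have /subspace_continuousP/(_ a aI)/cvgrPdist_lt/(_ _ eC) := cm.
rewrite near_withinE => /nbhs_ballP[dl /= dl0 hdl].
have m0 : 0 < Num.min dl (T - a) by rewrite lt_min dl0 subr_gt0.
near=> k.
have kd : k.+1%:R^-1 < Num.min dl (T - a) by near: k; exact: near_infty_natSinv_lt (PosNum m0).
move: kd; rewrite lt_min => /andP[kd kT].
have k0 : 0 < k.+1%:R^-1 :> R by rewrite invr_gt0.
have [s' _] := smooth1_derive (ramp_smooth k a).
have i1 : lam.-integrable `[0, T]%classic (EFin \o derive1 (ramp k a)).
  by apply: continuous_itv_integrable; exact: (continuous_subspaceT (smooth1_continuous s')).
have i2 := integrableZl (mu := lam) (measurable_itv _) (m a) i1.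
have e1 : m a = \int[lam]_(t in `[0, T]%classic) (m a * derive1 (ramp k a) t).
  rewrite RintegralZl // (Rintegral_derive1 (ramp_smooth k a) (ltW T0)).
  rewrite (ramp0 k a0) ramp1; first by rewrite subr0 mulr1.
  by rewrite -lerBrDl ltW.
rewrite [X in `|X - _|]e1 -RintegralB; [|by []|exact: i2|exact: ramp_m_integrable].
have i3 : lam.-integrable `[0, T]%classic (EFin \o (fun t => m a * derive1 (ramp k a) t - derive1 (ramp k a) t * m t)).
  exact: (integrableB (mu := lam) (measurable_itv _) i2 (ramp_m_integrable k a)).
apply: le_trans (le_normr_Rintegral _ i3) _ => //.
have i4 : lam.-integrable `[0, T]%classic (EFin \o (fun t => k.+1%:R * e * \1_(`[a, a + k.+1%:R^-1]%classic) t)).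
  apply: (integrableS measurableT) => //.
  exact: (integrableZl measurableT _ (integrable_indic_itv _ _ true false)).
have i5 := integrable_norm i3.
apply: (@le_trans _ _ (\int[lam]_(t in `[0, T]%classic) (k.+1%:R * e * \1_(`[a, a + k.+1%:R^-1]%classic) t))).
  apply: le_Rintegral => // t tT.
  have -> : m a * derive1 (ramp k a) t - derive1 (ramp k a) t * m t = derive1 (ramp k a) t * (m a - m t) by ring.
  rewrite normrM; have := ramp_derive k a hC t.
  have [tI|tI] := boolP (t \in `[a, a + k.+1%:R^-1]); rewrite indicE mem_setE ?tI ?(negbTE tI) ?mulr1 ?mulr0; last first.
    by rewrite normr_le0 => /eqP ->; rewrite normr0 mul0r.
  move=> h1; have h2 : `|m a - m t| < e / C.
    apply: hdl => //; rewrite /ball /= ltr_norml.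
    by move: tI; rewrite in_itv /=; move: (k.+1%:R^-1) kd => q kd /andP[? ?]; apply/andP; split; lra.
  apply: (@le_trans _ _ ((k.+1%:R * C) * (e / C))); first by apply: ler_pM => //; exact: ltW.
  by rewrite le_eqVlt; apply/orP; left; apply/eqP; field; rewrite gt_eqF.
rewrite RintegralZl //; last first.
  by apply: (integrableS measurableT) => //; exact: (integrable_indic_itv _ _ true false).
rewrite /Rintegral integral_indic //.
have ii : fine (lam (`[a, a + k.+1%:R^-1]%classic `&` `[0, T]%classic)) <= k.+1%:R^-1.
  have := lebesgue_itv_cc (a := a) (b := a + k.+1%:R^-1); rewrite lerDl (ltW k0) => /(_ isT) eL.
  have le1 : (lam (`[a, (a + k.+1%:R^-1)%R]%classic `&` `[0%R, T]%classic) <= lam `[a, (a + k.+1%:R^-1)%R]%classic)%E.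
    apply: le_measure; rewrite ?inE //; first exact: measurableI.
  have fin : lam (`[a, a + k.+1%:R^-1]%classic `&` `[0, T]%classic) \is a fin_num.
    by rewrite ge0_fin_numE //; apply: le_lt_trans le1 _; rewrite [ltLHS]eL ltry.
  by rewrite -lee_fin fineK //; apply: le_trans le1 _; rewrite [leLHS]eL lee_fin addrAC subrr add0r.
apply: (@le_trans _ _ (k.+1%:R * e * k.+1%:R^-1)).
  by apply: ler_wpM2l => //; rewrite mulr_ge0 // ltW.
by rewrite mulrAC divff // mul1r.
Unshelve. all: by end_near. Qed.

Hypothesis weak : forall eta : R -> R, smooth1 eta ->
  (exists a b, [/\ 0 < a, b < T & forall t, ~ (a <= t <= b) -> eta t = 0]) ->
  \int[lam]_(t in `[0, T]%classic) (derive1 eta t * m t) +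
  \int[lam]_(t in `[0, T]%classic) (eta t * h t) = 0.

(** The test functions are smoothed indicators of [[a, b]], differences of two
    ramps. *)
Let interior_increment a b : 0 < a -> a <= b -> b < T ->
  m b = m a + \int[lam]_(t in `[a, b]%classic) h t.
Proof.
move=> a0 ab bT.
pose eta k t := ramp k a t + -1 * ramp k b t.
have seta k : smooth1 (eta k).
  by apply: smooth1_add; [exact: ramp_smooth | apply: smooth1_mul; [exact: smooth1_cst | exact: ramp_smooth]].
have deta k t : derive1 (eta k) t = derive1 (ramp k a) t - derive1 (ramp k b) t.
  have [_ da] := smooth1_derive (ramp_smooth k a); have [_ db] := smooth1_derive (ramp_smooth k b).
  have [_] := is_deriveD (da t) (is_deriveZ (-1) (db t)).
  by rewrite -derive1E => e; rewrite [LHS]e /GRing.scale /= mulN1r.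
have bT' : a < T by apply: le_lt_trans bT.
have c1 : (fun k => \int[lam]_(t in `[0, T]%classic) (derive1 (eta k) t * m t)) @ \oo --> m a - m b.
  have -> : (fun k => \int[lam]_(t in `[0, T]%classic) (derive1 (eta k) t * m t)) =
    (fun k => \int[lam]_(t in `[0, T]%classic) (derive1 (ramp k a) t * m t) -
              \int[lam]_(t in `[0, T]%classic) (derive1 (ramp k b) t * m t)).
    apply/funext => k; rewrite -RintegralB //; try exact: ramp_m_integrable.
    by apply: eq_Rintegral => t _; rewrite deta mulrBl.
  apply: cvgB; apply: ramp_approximate_unit; first by rewrite ltW.
  by rewrite bT andbT; apply: ltW; apply: lt_le_trans ab.
have /integrableP[/measurable_EFinP mh _] := hi.
have c2 : (fun k => \int[lam]_(t in `[0, T]%classic) (eta k t * h t)) @ \oo -->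
    \int[lam]_(t in `[0, T]%classic) (\1_(`]a, b]%classic) t * h t).
  have hi' := integrableZl (mu := lam) (measurable_itv _) 2 (integrable_norm hi).
  apply: (@Rdominated _ _ R lam _ (fun k t => eta k t * h t) _ (fun t => 2 * `|h t|) (measurable_itv _) _ _ _ hi' _).2.
  - by move=> k; apply: measurable_funM => //; apply: measurable_funTS; exact: (continuous_measurable_fun (smooth1_continuous (seta k))).
  - by apply: measurable_funM => //; exact: measurable_indic.
  - apply: aeW => t _; apply: cvgM; last exact: cvg_cst.
    have ev (x : R) : 0 < x -> \forall k \near \oo, k.+1%:R^-1 < x.
      by move=> x0; exact: near_infty_natSinv_lt (PosNum x0).
    apply: (@cvg_near_cst _ _ _ _ _ _); rewrite /= /eta.
    have [ta|ta] := leP t a.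
      apply: nearW => k; rewrite !ramp0 ?(le_trans ta) // mulr0 addr0.
      by rewrite indicE mem_setE in_itv /= ltNge ta.
    have [tb|tb] := leP t b.
      have := ev (t - a); rewrite subr_gt0 => /(_ ta); apply: filterS => k hk.
      have hk' : a + k.+1%:R^-1 <= t by rewrite -lerBrDl ltW.
      rewrite (ramp1 hk') (ramp0 k tb).
      by rewrite indicE mem_setE in_itv /= ta tb mulr0 addr0.
    have := ev (t - b); rewrite subr_gt0 => /(_ tb); apply: filterS => k hk.
    have hk' : b + k.+1%:R^-1 <= t by rewrite -lerBrDl ltW.
    have hk2 : a + k.+1%:R^-1 <= t by apply: le_trans hk'; rewrite lerD2r.
    rewrite (ramp1 hk') (ramp1 hk2).
    by rewrite indicE mem_setE in_itv /= ta leNgt tb mulr1 subrr.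
  - apply: aeW => t k _; rewrite normrM; apply: ler_wpM2r => //.
    have /andP[x0 x1] := smooth_step_itv (k.+1%:R * t + - (k.+1%:R * a)).
    have /andP[y0 y1] := smooth_step_itv (k.+1%:R * t + - (k.+1%:R * b)).
    rewrite /eta /ramp /theta ler_norml; apply/andP; split; lra.
have z : (fun k => \int[lam]_(t in `[0, T]%classic) (derive1 (eta k) t * m t) +
     \int[lam]_(t in `[0, T]%classic) (eta k t * h t)) @ \oo --> (0 : R).
  apply: (@cvg_near_cst _ _ _ _ _ _).
  have x0 : 0 < (T - b) / 2 by rewrite divr_gt0 // subr_gt0.
  have := near_infty_natSinv_lt (PosNum x0); apply: filterS => k /= hk.
  apply: weak (seta k) _; exists a, (b + k.+1%:R^-1); split => //.
    by move: hk; move: (k.+1%:R^-1) => q hk; lra.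
  move=> t tI; rewrite /eta; have [ta|ta] := leP t a.
    by rewrite !ramp0 ?(le_trans ta) // mulr0 addr0.
  have [tb|tb] := leP t (b + k.+1%:R^-1); first by exfalso; apply: tI; rewrite ltW.
  have hk2 : a + k.+1%:R^-1 <= t by apply: le_trans (ltW tb); rewrite lerD2r.
  by rewrite (ramp1 (ltW tb)) (ramp1 hk2) mulr1 subrr.
have := cvg_unique _ z (cvgD c1 c2) => /(_ (@Rhausdorff R)) E.
have -> : \int[lam]_(t in `[a, b]%classic) h t = \int[lam]_(t in `[0, T]%classic) (\1_(`]a, b]%classic) t * h t).
  have sub : `[a, b]%classic `<=` `[0, T]%classic.
    move=> t /=; rewrite !in_itv /= => /andP[at_ tb]; apply/andP; split; first by apply: ltW; apply: lt_le_trans at_.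
    by apply: ltW; apply: le_lt_trans bT.
  have hab : lam.-integrable `[a, b]%classic (EFin \o h) by apply: integrableS hi.
  rewrite -(Rintegral_itv_obnd_cbnd (b := BRight b)); last first.
    by apply: integrableS hab => // t /=; rewrite !in_itv /= => /andP[/ltW -> ->].
  rewrite (Rintegral_indic lam) [RHS](Rintegral_indic lam); apply: eq_Rintegral => t _.
  rewrite !indicE !mem_setE;
  case: (boolP (t \in `]a, b])) => tI; last by rewrite !mul0r mulr0.
  have -> : t \in `[0, T]; last by rewrite !mul1r.
  apply: (sub t); move: tI; rewrite /= !in_itv /= => /andP[/ltW -> ->] //.
set I := \int[lam]_(t in _) _.
have E' : 0 = m a - m b + I by rewrite E.
by rewrite -[LHS]addr0 [X in _ + X = _]E'; ring.
Qed.

(** Inside the interval by [interior_increment], at the end points by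
    continuity. *)
Lemma weak_derivative_primitive t : 0 <= t <= T ->
  m t = m 0 + \int[lam]_(s in `[0, t]%classic) h s.
Proof.
pose g t := m t - \int[lam]_(s in `[0, t]%classic) h s.
have cJ := parameterized_integral_continuous (ltW T0) hi.
have cg : {within `[0, T]%classic, continuous g} by move=> s; apply: cvgB; [exact: cm | exact: cJ].
have sub a b : 0 <= a -> b <= T -> `[a, b]%classic `<=` `[0, T]%classic.
  by move=> a0 bT s /=; rewrite !in_itv /= => /andP[/(le_trans a0) -> /le_trans]; exact.
have gin a b : 0 < a -> a <= b -> b < T -> g a = g b.
  move=> a0 ab bT; rewrite /g (interior_increment a0 ab bT).
  rewrite (@Rintegral_itv_cat h 0 a b) // ?(ltW a0) //; first by lra.
  by apply: integrableS hi => //; apply: sub => //; exact: ltW.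
pose c := g (T / 2).
have gc s : 0 < s < T -> g s = c.
  move=> /andP[s0 sT]; rewrite /c; have [l|l] := leP s (T / 2).
    by apply: gin => //; lra.
  by apply/esym/gin => //; [lra | exact: ltW].
have gall s : 0 <= s <= T -> g s = c.
  move=> sT; apply/eqP; rewrite -subr_eq0 -normr_le0; apply/ler_addgt0Pr => e e0; rewrite add0r.
  have sI : `[0, T]%classic s by rewrite /= in_itv.
  have /subspace_continuousP/(_ s sI)/cvgrPdist_lt/(_ _ e0) := cg.
  rewrite near_withinE => /nbhs_ballP[dl /= dl0 hdl].
  pose q := Num.min (dl / 2) (T / 4).
  have q0 : 0 < q by rewrite lt_min !divr_gt0.
  have [qd qT] : q <= dl / 2 /\ q <= T / 4 by split; rewrite ge_min lexx ?orbT.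
  clearbody q.
  have [s' s'T d] : exists2 s', 0 < s' < T & `|s - s'| < dl.
    case/andP: sT => s0 sT; have [l|l] := leP s (T / 2).
      exists (s + q); first by apply/andP; split; lra.
      by rewrite opprD addrA subrr sub0r normrN gtr0_norm //; lra.
    exists (s - q); first by apply/andP; split; lra.
    by rewrite opprB addrC subrK gtr0_norm //; lra.
  have s'I : `[0, T]%classic s' by move: s'T; rewrite /= in_itv /= => /andP[/ltW -> /ltW ->].
  by have h1 : `|g s - g s'| < e := hdl s' d s'I; rewrite (gc s' s'T) in h1; exact: ltW.
move=> tT; have := gall t tT; rewrite -(gall 0) ?lexx ?ltW // /g.
rewrite set_itv1 Rintegral_set1; lra.
Qed.

End Primitives.

Section CurvesToWeakForm.
Context {R : realType} {n : nat}.
Local Notation lam := (@lebesgue_measure R).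
Variables (S : set 'cV[R]_n) (T : R) (mu w : R -> R -> 'cV[R]_n).
Hypotheses (T0 : 0 < T) (Smu : forall t, 0 <= t <= T -> Mfun S (mu t)).
Hypotheses (wmu : weakstar_continuous T mu) (bw : borel_family T w) (sw : strip_integrable T w).
Hypothesis ce : continuity_eq T mu w.

Lemma weakstar_coordinate i (rho : R -> R) r : continuous rho -> vanishes_outside r rho ->
  {within `[0, T]%classic, continuous (fun t => \int[lam]_x (mu t x i 0 * rho x))}.
Proof.
move=> crho vrho.
pose V (x : R) : 'cV[R]_n := rho x *: delta_mx i 0.
have cV : continuous V by move=> x; apply: cvgZr_tmp; exact: crho.
have kV : compact (support_closure V).
  apply: (@subclosed_compact _ _ `[- r, r]%classic); [exact: closed_closure | exact: segment_compact | ].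
  have cr : closed `[- r, r]%classic by exact: itv_closed.
  rewrite ((closure_id _).1 cr); apply: closure_subset => x /= Vx.
  rewrite in_itv /= -ler_norml leNgt; apply/negP => rx; move/eqP: Vx; apply.
  by rewrite /V vrho // scale0r.
apply: (subspace_eq_continuous _ (wmu cV kV)) => t _; apply: eq_Rintegral => x _.
rewrite dotvE (bigD1 i) //= big1 ?addr0 ?mxE ?eqxx ?mulr1 // => j ji.
by rewrite !mxE (negbTE ji) /= !mulr0.
Qed.

(** Test with the products [eta t * rho x]: the pairing of [mu t] with [rho] is
    continuous in time, and its weak derivative is the flux. *)
Lemma continuity_eq_weak_form : weak_form T mu w.
Proof.
move=> i rho trho; have [r [C [r0 C0 vr vr' hC]]] := test1_bounds trho.
have [srho _] := trho.
have cm := @weakstar_coordinate i rho r (smooth1_continuous srho) vr.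
have [hi _ _] := flux_iterated bw sw i trho (measurable_itv `[0, T]) (@subset_refl _ _).
move=> t tT; apply: (@weak_derivative_primitive R T _ _ T0 cm hi) => // eta seta [a [b [a0 bT veta]]].
pose psi (p : R * R) := eta p.1 * rho p.2.
have spsi : smooth_on setT psi by exact: tensor_smooth_on.
have sub : support_closure psi `<=` `[a, b]%classic `*` `[- r, r]%classic.
  have cl : closed (`[a, b]%classic `*` `[- r, r]%classic : set (R * R))
    by apply: compact_closed; [exact: norm_hausdorff | apply: compact_setX; exact: segment_compact].
  rewrite ((closure_id _).1 cl); apply: closure_subset => -[s x] /= /eqP nz; split => /=; rewrite in_itv /=.
    by apply/negPn/negP => sI; apply: nz; rewrite /psi /= veta ?mul0r //; exact/negP.
  rewrite -ler_norml leNgt; apply/negP => rx; apply: nz; by rewrite /psi /= vr // mulr0.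
have kpsi : compact (support_closure psi).
  apply: (subclosed_compact (@closed_closure _ _) _ sub).
  by apply: compact_setX; exact: segment_compact.
have spT : support_closure psi `<=` `]0, T[%classic `*` setT.
  move=> p /sub[/= + _]; rewrite !in_itv /= => /andP[ap pb]; split => //=.
  by rewrite (lt_le_trans a0 ap) (le_lt_trans pb bT).
rewrite -[RHS](ce spsi kpsi spT i); congr (_ + _); apply: eq_Rintegral => s.
  rewrite inE /= in_itv /= => sT.
  have ms : measurable_fun setT (fun x => mu s x i 0 * rho x).
    by apply: measurable_funM; [exact: (Smu sT).1 | exact: continuous_measurable_fun (smooth1_continuous srho)].
  rewrite -RintegralZl_measurable //; apply: eq_Rintegral => x _.
  rewrite (tensor_derive s x seta srho).1; ring.
move=> sT; have [srho' _] := smooth1_derive srho.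
have ms : measurable_fun setT (fun x => w s x i 0 * derive1 rho x).
  apply: measurable_funM; last exact: continuous_measurable_fun (smooth1_continuous srho').
  by apply: measurable_strip_section bw _ _ _; move: sT; rewrite inE.
rewrite -RintegralZl_measurable //; apply: eq_Rintegral => x _.
rewrite (tensor_derive s x seta srho).2; ring.
Qed.

End CurvesToWeakForm.

(** * Averages against tents *)

Section HatAverages.
Context {R : realType}.
Local Notation lam := (@lebesgue_measure R).

(** A tent of height 1 and half-width 1/(k+1) around x: averages against it are
    continuous in x, and weak-* continuity in time applies to them. *)
Definition hat (k : nat) (x y : R) : R := Num.max 0 (1 - k.+1%:R * `|y - x|).

Lemma hat_ge0 k x y : 0 <= hat k x y.
Proof. by rewrite le_max lexx. Qed.

Lemma hat_le1 k x y : hat k x y <= 1.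
Proof. by rewrite ge_max ler01 /= gerBl mulr_ge0. Qed.

Lemma hat_continuous k x : continuous (hat k x).
Proof.
move=> y; have c1 : {for y, continuous (fun y : R => 1 - k.+1%:R * `|y - x|)}.
  apply: cvgB; first exact: cvg_cst.
  apply: cvgMl_tmp; apply: cvg_norm; apply: cvgB; [exact: cvg_id | exact: cvg_cst].
exact: (continuous_max (@cst_continuous _ R 0 y) c1).
Qed.

Lemma hat_vanish k x y : k.+1%:R^-1 <= `|y - x| -> hat k x y = 0.
Proof.
move=> h; apply/max_idPl; rewrite subr_le0 -ler_pdivrMl // mulr1; exact: h.
Qed.

Lemma hat_vanishes_outside k x r : `|x| + 1 <= r -> vanishes_outside r (hat k x).
Proof.
move=> xr y ry; apply: hat_vanish; apply: (@le_trans _ _ 1).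
  by rewrite invf_le1 // ler1n.
have := lerB_dist y x; have := normr_ge0 x; lra.
Qed.

Lemma hat_lipschitz k x x' y : `|hat k x y - hat k x' y| <= k.+1%:R * `|x - x'|.
Proof.
have K0 : 0 <= k.+1%:R :> R by [].
have h1 : `|y - x'| <= `|y - x| + `|x - x'|.
  have -> : y - x' = (y - x) + (x - x') by ring.
  exact: ler_normD.
have h2 : `|y - x| <= `|y - x'| + `|x - x'|.
  rewrite [`|x - x'|]distrC; have -> : y - x = (y - x') + (x' - x) by ring.
  exact: ler_normD.
have := ler_wpM2l K0 h1; have := ler_wpM2l K0 h2; rewrite !mulrDr.
have := mulr_ge0 K0 (normr_ge0 (x - x')).
rewrite /hat; set a := _ * `|y - x|; set b := _ * `|y - x'|; set c := _ * `|x - x'|.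
clearbody a b c; move=> c0 ab ba; rewrite ler_norml.
by apply/andP; split; rewrite /Num.max; case: ifP => h3; case: ifP => h4; lra.
Qed.

Lemma hat_average_continuous (F : R -> R -> R) (B : R) k :
  (forall t, measurable_fun setT (F t)) -> (forall t y, `|F t y| <= B) ->
  (forall rho r, continuous rho -> vanishes_outside r rho ->
     continuous (fun t => \int[lam]_y (F t y * rho y))) ->
  continuous (fun p : R * R => \int[lam]_y (F p.1 y * hat k p.2 y)).
Proof.
move=> mF bF cF [t0 x0]; apply/cvgrPdist_le => e e0 /=.
have B0 : 0 <= B by apply: le_trans (bF t0 0).
pose r := `|x0| + 2.
have r0 : 0 < r by rewrite /r; have := normr_ge0 x0; lra.
have fi t x : `|x| + 1 <= r -> lam.-integrable setT (EFin \o (fun y => F t y * hat k x y)).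
  move=> xr; apply: (bounded_support_integrable (C := B) r0 _ _ _).1.
  - by apply: measurable_funM => //; apply: continuous_measurable_fun; exact: hat_continuous.
  - move=> y; rewrite normrM (ger0_norm (hat_ge0 _ _ _)) -[leRHS]mulr1.
    by apply: ler_pM => //; [exact: hat_ge0 | exact: hat_le1].
  - by move=> y ry; rewrite (hat_vanishes_outside _ xr) ?mulr0.
pose C := B * k.+1%:R * (2 * r).
have C0 : 0 <= C by rewrite !mulr_ge0 // ltW.
pose dl := Num.min 1 (e / 2 / (C + 1)).
have C1 : 0 < C + 1 by rewrite ltr_wpDl.
have dl0 : 0 < dl by rewrite lt_min ltr01 !divr_gt0.
have d1 : dl <= 1 by rewrite ge_min lexx.
have d2 : dl * (C + 1) <= e / 2 by rewrite -ler_pdivlMr // ge_min lexx orbT.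
have e2 : 0 < e / 2 by rewrite divr_gt0.
have xr0 : `|x0| + 1 <= r by rewrite /r lerD2l ler1n.
have /cvgrPdist_le/(_ _ e2) nt := cF _ _ (@hat_continuous k x0) (hat_vanishes_outside _ xr0) t0.
have nx : \forall x \near x0, `|x0 - x| < dl by exact: (nbhsx_ballx x0 dl dl0).
have : \forall p \near (t0, x0), `|x0 - p.2| < dl /\
   `|\int[lam]_y (F t0 y * hat k x0 y) - \int[lam]_y (F p.1 y * hat k x0 y)| <= e / 2.
  by exists ([set t | `|\int[lam]_y (F t0 y * hat k x0 y) - \int[lam]_y (F t y * hat k x0 y)| <= e / 2],
     [set x | `|x0 - x| < dl]) => // -[t x] [/= h1 h2].
apply: filterS => -[t x] /= [xx tt].
have xr : `|x| + 1 <= r.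
  have h := lerB_dist x x0; rewrite distrC in h.
  by rewrite /r; clearbody dl; lra.
have h3 : `|\int[lam]_y (F t y * hat k x0 y) - \int[lam]_y (F t y * hat k x y)| <= e / 2.
  rewrite -RintegralB //; [|exact: fi|exact: fi].
  have bd y : `|F t y * hat k x0 y - F t y * hat k x y| <= B * (k.+1%:R * dl).
    rewrite -mulrBr normrM; apply: ler_pM => //; apply: le_trans (hat_lipschitz _ _ _ _) _.
    by apply: ler_wpM2l => //; exact: ltW.
  have md : measurable_fun setT (fun y => F t y * hat k x0 y - F t y * hat k x y).
    by apply: measurable_funB; apply: measurable_funM => //; apply: continuous_measurable_fun; exact: hat_continuous.
  have vd : vanishes_outside r (fun y => F t y * hat k x0 y - F t y * hat k x y).
    by move=> y ry; rewrite (hat_vanishes_outside _ xr0) // (hat_vanishes_outside _ xr) // mulr0 subrr.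
  apply: le_trans (bounded_support_integrable r0 md bd vd).2 _.
  have -> : B * (k.+1%:R * dl) * (2 * r) = dl * C by rewrite /C; ring.
  by apply: le_trans d2; apply: ler_wpM2l; [exact: ltW | rewrite lerDl].
rewrite -[X in X - _](subrK (\int[lam]_y (F t y * hat k x0 y))) -addrA.
by apply: le_trans (ler_normD _ _) _; rewrite [leRHS](splitr e); apply: lerD.
Qed.

Let hat_integrable k x : lam.-integrable setT (EFin \o hat k x).
Proof.
have r0 : 0 < `|x| + 1 by rewrite ltr_wpDl.
apply: (bounded_support_integrable (C := 1) r0 _ _ (hat_vanishes_outside _ (lexx _))).1.
  by apply: continuous_measurable_fun; exact: hat_continuous.
by move=> y; rewrite ger0_norm ?hat_ge0 // hat_le1.
Qed.

(** The tent is at least 1/2 on the inner half of its support. *)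
Lemma hat_mass k x : (2 * k.+1%:R)^-1 <= \int[lam]_y hat k x y.
Proof.
pose q : R := (2 * k.+1%:R)^-1.
have q0 : 0 < q by rewrite invr_gt0 mulr_gt0.
have kq : k.+1%:R * q = 2^-1.
  by rewrite /q invfM mulrCA divff ?mulr1.
have i1 : lam.-integrable setT (EFin \o (fun y => 2^-1 * \1_(`[x - q, x + q]%classic) y)).
  exact: (integrableZl measurableT _ (integrable_indic_itv _ _ true false)).
have e1 : \int[lam]_y (2^-1 * \1_(`[x - q, x + q]%classic) y) = q.
  rewrite RintegralZl //; last exact: (integrable_indic_itv _ _ true false).
  rewrite /Rintegral integral_indic // setIT.
  have := lebesgue_itv_cc (a := x - q) (b := x + q).
  have -> : (x - q <= x + q) = true by apply/idP; lra.
  by move=> /(_ isT) eL; rewrite [X in fine X]eL /=; lra.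
rewrite -/q -[leLHS]e1; apply: le_Rintegral => // y _.
rewrite indicE; case: (boolP (y \in _)) => [/set_mem|_]; last by rewrite mulr0 hat_ge0.
rewrite /= in_itv /= mulr1 => /andP[y1 y2].
have yx : `|y - x| <= q by rewrite ler_norml; apply/andP; split; lra.
have := ler_wpM2l (ler0n R k.+1) yx; rewrite kq /hat le_max => h; apply/orP; right; lra.
Qed.

(** The tent is supported in a ball whose measure is comparable to its mass, so
    the averages converge at Lebesgue points. *)
Lemma hat_average_cvg (F : R -> R) (B x : R) :
  measurable_fun setT F -> (forall y, `|F y| <= B) -> lebesgue_pt F x ->
  (fun k => (\int[lam]_y (F y * hat k x y)) / \int[lam]_y hat k x y) @ \oo --> F x.
Proof.
move=> mF bF lp; apply/cvgrPdist_le => e e0.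
have cr : (fun k : nat => (k.+1%:R^-1 : R)) @ \oo --> (0 : R)^'+.
  move=> P h; have /nbhs_ballP[dl /= dl0 hP] : nbhs (0 : R) (fun y => 0 < y -> P y) by exact: h.
  have := near_infty_natSinv_lt (PosNum dl0); apply: filterS => k hk.
  apply: hP => /=; last by rewrite invr_gt0.
  by rewrite /ball /= sub0r normrN ger0_norm // invr_ge0.
have cd : (fun k : nat => davg F x k.+1%:R^-1) @ \oo --> 0%E by exact: (cvg_comp _ _ cr lp).
have e4 : 0 < e / 4 by rewrite divr_gt0.
have near_d : \forall k \near \oo, (davg F x k.+1%:R^-1 < (e / 4)%:E)%E.
  apply: (cd [set z | (z < (e / 4)%:E)%E]).
  by apply: open_nbhs_nbhs; split; [exact: open_ereal_lt_ereal | rewrite /= lte_fin].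
move: near_d; apply: filterS => k; rewrite /davg /iavg => hd.
set K : R := k.+1%:R in hd *; have K0 : 0 < K by rewrite ltr0n.
have Ki : 0 < K^-1 by rewrite invr_gt0.
set Z := \int[lam]_y hat k x y; have Z0 : 0 < Z.
  by apply: lt_le_trans (hat_mass k x); rewrite invr_gt0 mulr_gt0.
have i1 := hat_integrable k x.
have r0 : 0 < `|x| + 1 by rewrite ltr_wpDl.
have i2 : lam.-integrable setT (EFin \o (fun y => F y * hat k x y)).
  apply: (bounded_support_integrable (C := B) r0 _ _ _).1.
  - by apply: measurable_funM => //; apply: continuous_measurable_fun; exact: hat_continuous.
  - move=> y; rewrite normrM (ger0_norm (hat_ge0 _ _ _)) -[leRHS]mulr1.
    by apply: ler_pM => //; [exact: hat_ge0 | exact: hat_le1].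
  - by move=> y ry; rewrite (hat_vanishes_outside _ (lexx _)) ?mulr0.
have i3 : lam.-integrable setT (EFin \o (fun y => F x * hat k x y)) by exact: (integrableZl (mu := lam) measurableT (F x) i1).
have i4 : lam.-integrable setT (EFin \o (fun y => F x * hat k x y - F y * hat k x y)).
  exact: (integrableB (mu := lam) measurableT i3 i2).
have e1 : F x - (\int[lam]_y (F y * hat k x y)) / Z =
   (\int[lam]_y (F x * hat k x y - F y * hat k x y)) / Z.
  by rewrite RintegralB // RintegralZl // -/Z mulrBl mulfK // gt_eqF.
rewrite e1 normrM (ger0_norm (x := Z^-1)) ?invr_ge0 ?(ltW Z0) // ler_pdivrMr //.
apply: (@le_trans _ _ (e / 4 * (2 * K^-1))); last first.
  have h := hat_mass k x; rewrite -/Z -/K in h.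
  have -> : e / 4 * (2 * K^-1) = e * (2 * K)^-1 by field; rewrite gt_eqF.
  by apply: ler_wpM2l => //; exact: ltW.
apply: le_trans (le_normr_Rintegral _ i4) _ => //.
have i5 := integrable_norm i4.
have mb : measurable (ball x K^-1) by exact: measurable_ball.
rewrite -lee_fin /Rintegral fineK; last exact: (integrable_fin_num _ i5).
have mFc : measurable_fun setT (fun y => (`|F y - F x|)%:E).
  by apply/measurable_EFinP; apply: measurableT_comp => //; apply: measurable_funB.
apply: (@le_trans _ _ (\int[lam]_(y in ball x K^-1) `|F y - F x|%:E)%E).
  rewrite [leRHS]integral_mkcond; apply: ge0_le_integral => //.
  - exact: (measurable_int _ i5).
  - by apply/(measurable_restrictT _ mb); exact: measurable_funTS.
  move=> y _; rewrite patchE; case: ifPn => [_|].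
    rewrite lee_fin -mulrBl normrM (ger0_norm (hat_ge0 _ _ _)) distrC -[leRHS]mulr1.
    by apply: ler_wpM2l => //; exact: hat_le1.
  rewrite notin_setE /ball /= => /negP; rewrite -leNgt distrC => h.
  by rewrite (hat_vanish h) !mulr0 subrr normr0.
move: hd; rewrite lebesgue_measure_ball ?(ltW Ki) // inver mulrn_eq0 /= gt_eqF //.
rewrite -[X in (X * _)%E]/((K^-1 *+ 2)^-1%:E) muleC lte_pdivrMr ?mulrn_wgt0 //.
move=> /ltW /le_trans; apply.
by rewrite -EFinM lee_fin mulr_natl.
Qed.

End HatAverages.

(** * Jointly measurable representatives and flows *)

Lemma ae_impl {d : measure_display} {X : measurableType d} {R : realType}
    (mu : {measure set X -> \bar R}) (P Q : X -> Prop) : (forall x, P x -> Q x) ->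
  {ae mu, forall x, P x} -> {ae mu, forall x, Q x}.
Proof. by move=> PQ; apply: filterS. Qed.

Lemma ae_impl2 {d : measure_display} {X : measurableType d} {R : realType}
    (mu : {measure set X -> \bar R}) (P Q U : X -> Prop) : (forall x, P x -> Q x -> U x) ->
  {ae mu, forall x, P x} -> {ae mu, forall x, Q x} -> {ae mu, forall x, U x}.
Proof. by move=> PQ; apply: filterS2. Qed.

Lemma ae_forall_fin {d : measure_display} {X : measurableType d} {R : realType} {I : finType}
    (mu : {measure set X -> \bar R}) (P : I -> X -> Prop) : (forall i, {ae mu, forall x, P i x}) ->
  {ae mu, forall x, forall i, P i x}.
Proof. by move=> h; apply: filter_forall. Qed.

(** The value is read off the upper limits where these lie in the closed set
    [A], and is an arbitrary point of [A] elsewhere. *)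
Lemma limit_selection {d : measure_display} {X : measurableType d} {R : realType} {n : nat}
    (A : set 'cV[R]_n) (z0 : 'cV[R]_n) (u : nat -> X -> 'cV[R]_n) : closed A -> A z0 ->
  (forall k i, measurable_fun setT (fun x => u k x i 0)) ->
  exists v : X -> 'cV[R]_n, [/\ forall i, measurable_fun setT (fun x => v x i 0), forall x, A (v x) &
    forall x l, A l -> (forall i, (fun k => u k x i 0) @ \oo --> l i 0) -> v x = l].
Proof.
move=> cA Az0 mu.
pose l i x := fine (limn_esup (fun k => (u k x i 0)%:E)).
have ml i : measurable_fun setT (l i).
  apply: (measurableT_comp (f := fine)); first exact: fine_measurable.
  by apply: measurable_fun_limn_esup => k; apply/measurable_EFinP.
have lE x i a : (fun k => u k x i 0) @ \oo --> a -> l i x = a.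
  move=> ha.
  have cE : (fun k => (u k x i 0)%:E) @ \oo --> a%:E by apply: cvg_EFin; [exact: nearW | exact: ha].
  have cv : cvgn (fun k => (u k x i 0)%:E) by apply/cvg_ex; exists a%:E.
  by rewrite /l is_cvg_limn_esupE // (cvg_lim _ cE).
pose L x : 'cV[R]_n := \col_i l i x.
have mL i : measurable_fun setT (fun x => L x i 0).
  by have -> : (fun x => L x i 0) = l i by apply/funext => x; rewrite mxE.
pose D := [set x | A (L x)].
have mD : measurable D by have := @measurable_preimage_closed _ _ R n setT L measurableT mL A cA; rewrite setTI.
have mi : measurable_fun setT (\1_D : X -> R) by exact: measurable_indic.
exists (fun x => \1_D x *: L x + (1 - \1_D x) *: z0); split.
- move=> i; have -> : (fun x => (\1_D x *: L x + (1 - \1_D x) *: z0) i 0) =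
      (fun x => \1_D x * L x i 0 + (1 - \1_D x) * z0 i 0).
    by apply/funext => x; rewrite !mxE.
  by apply: measurable_funD; apply: measurable_funM => //; exact: measurable_funB.
- move=> x; rewrite indicE; case: (boolP (x \in D)) => [/set_mem h|_].
    by rewrite scale1r subrr scale0r addr0.
  by rewrite scale0r subr0 scale1r add0r.
move=> x a Aa ca.
have La : L x = a by apply/colP => i; rewrite mxE; exact: lE.
have DL : D x by rewrite /D /= La.
by rewrite indicE mem_set // scale1r subrr scale0r addr0.
Qed.

Lemma limit_selection_closed {d : measure_display} {X : measurableType d} {R : realType} {n : nat}
    (A : set 'cV[R]_n) (z0 : 'cV[R]_n) (u : nat -> X -> 'cV[R]_n) : closed A -> A z0 ->
  (forall k i, measurable_fun setT (fun x => u k x i 0)) -> (forall k x, A (u k x)) ->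
  exists v : X -> 'cV[R]_n, [/\ forall i, measurable_fun setT (fun x => v x i 0), forall x, A (v x) &
    forall x, (forall i, cvgn (fun k => u k x i 0)) -> forall i, (fun k => u k x i 0) @ \oo --> v x i 0].
Proof.
move=> cA Az0 mu Au; have [v [mv Av vE]] := limit_selection cA Az0 mu.
exists v; split; [exact: mv | exact: Av | move=> x cx i].
pose l : 'cV[R]_n := \col_i lim ((fun k => u k x i 0) @ \oo).
have cl j : (fun k => u k x j 0) @ \oo --> l j 0 by rewrite mxE; exact: cx.
have Al : A l by apply: (closed_cvg _ cA _ _ (cvg_cV cl)); exact: nearW.
by rewrite (vE x l Al cl); exact: cl.
Qed.

Section JointRepresentative.
Context {R : realType} {n : nat}.
Local Notation lam := (@lebesgue_measure R).
Variables (S : set 'cV[R]_n) (T : R) (mu : R -> R -> 'cV[R]_n).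
Hypotheses (kS : compact S) (T0 : 0 < T) (Smu : forall t, 0 <= t <= T -> Mfun S (mu t)).
Hypothesis wmu : weakstar_continuous T mu.

Definition clamp (T t : R) := Num.max 0 (Num.min t T).

Lemma clamp_itv t : 0 <= clamp T t <= T.
Proof. by rewrite /clamp le_max lexx /= ge_max (ltW T0) ge_min lexx orbT. Qed.

Lemma clamp_id t : 0 <= t <= T -> clamp T t = t.
Proof. by move=> /andP[t0 tT]; rewrite /clamp (min_idPl tT) (max_idPr t0). Qed.

Lemma clamp_continuous : continuous (clamp T).
Proof.
move=> t; have c1 : {for t, continuous (fun t : R => Num.min t T)}.
  have c0 : {for t, continuous (fun t : R => t)} by exact: cvg_id.
  exact: (continuous_min c0 (@cst_continuous _ R T t)).
exact: (continuous_max (@cst_continuous _ R 0 t) c1).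
Qed.

Lemma clamp_within (g : R -> R) : {within `[0, T]%classic, continuous g} ->
  continuous (fun t => g (clamp T t)).
Proof.
move=> cg t.
have tI : `[0, T]%classic (clamp T t) by rewrite /= in_itv; exact: clamp_itv.
have ct : clamp T @ t --> within `[0, T]%classic (nbhs (clamp T t)).
  move=> P hP.
  have {}hP : nbhs (clamp T t) (fun y => `[0, T]%classic y -> P y) by exact: hP.
  have h2 : nbhs t (fun s => `[0, T]%classic (clamp T s) -> P (clamp T s)) by exact: (clamp_continuous hP).
  suff : nbhs t (fun s => P (clamp T s)) by [].
  move: h2; apply: filterS => s; apply; rewrite /= in_itv; exact: clamp_itv.
have /subspace_continuousP/(_ _ tI) h := cg.
exact: (cvg_comp _ _ ct h).
Qed.

Lemma bounded_locally_integrable (f : R -> R) (B : R) :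
  measurable_fun setT f -> (forall x, `|f x| <= B) -> locally_integrable setT f.
Proof.
move=> mf bf; split => //; first exact: openT.
move=> K _ kK; have [b [_ hb]] := compact_bounded kK.
pose r := Num.max (b + 1) 1.
have r0 : 0 < r by rewrite lt_max ltr01 orbT.
have Kr : K `<=` `[- r, r]%classic.
  move=> x Kx; rewrite /= in_itv /= -ler_norml; apply: hb => //.
  by rewrite lt_max ltrDl ltr01.
have mK : measurable K by exact: compact_measurable.
have B0 : 0 <= B by apply: le_trans (bf 0).
have mi : measurable_fun setT (\1_K : R -> R) by exact: measurable_indic.
have bK x : `|\1_K x * f x| <= B.
  by rewrite indicE normrM; case: (_ \in _); rewrite ?normr1 ?mul1r // normr0 mul0r.
have vK : vanishes_outside r (fun x => \1_K x * f x).
  move=> x rx; rewrite indicE memNset ?mul0r // => /Kr /=.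
  by rewrite in_itv /= -ler_norml leNgt rx.
have [/integrableP[_ h] _] := bounded_support_integrable r0 (measurable_funM mi mf) bK vK.
rewrite integral_mkcond; apply: le_lt_trans h.
rewrite le_eqVlt; apply/orP; left; apply/eqP; apply: eq_integral => x _.
by rewrite patchE /= indicE; case: (x \in K); rewrite ?mul1r // mul0r normr0.
Qed.

(** Each time slice is defined up to null sets only; limits of hat averages
    select representatives that depend measurably on time. *)
Lemma joint_representative : exists m : R -> R -> 'cV[R]_n,
  [/\ forall i, measurable_fun setT (fun p : R * R => m p.1 p.2 i 0),
      forall t x, S (m t x) & forall t, ae_equal (m t) (mu (clamp T t))].
Proof.
have [B B0 hB] := compact_coord_bounded kS.
have Sc t : Mfun S (mu (clamp T t)) by exact: Smu (clamp_itv t).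
pose F i t y := mu (clamp T t) y i 0.
have mF i t : measurable_fun setT (F i t) by exact: (Sc t).1.
have bF i t y : `|F i t y| <= B by exact: hB ((Sc t).2 y).
have cF i rho r : continuous rho -> vanishes_outside r rho ->
    continuous (fun t => \int[lam]_y (F i t y * rho y)).
  move=> cr vr; apply: (clamp_within (g := fun t => \int[lam]_y (mu t y i 0 * rho y))).
  exact: (@weakstar_coordinate _ _ _ _ wmu i rho r cr vr).
pose Z k x := \int[lam]_y hat k x y.
have Z0 k x : Z k x != 0.
  by rewrite gt_eqF //; apply: lt_le_trans (hat_mass k x); rewrite invr_gt0 mulr_gt0.
have cZ k : continuous (fun p : R * R => Z k p.2).
  have := @hat_average_continuous R (fun _ _ => 1) 1 k (fun=> measurable_cst _) _ _.
  rewrite /Z; under [X in _ -> _ -> continuous X]eq_fun do under eq_Rintegral do rewrite mul1r.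
  apply; first by move=> ? ?; rewrite normr1.
  by move=> rho r _ _; exact: cst_continuous.
pose A i k (p : R * R) := (\int[lam]_y (F i p.1 y * hat k p.2 y)) / Z k p.2.
have cA i k : continuous (A i k).
  move=> p; apply: cvgM; last by apply: cvgV; [exact: Z0 | exact: cZ].
  exact: (@hat_average_continuous R (F i) B k (mF i) (bF i) (cF i) p).
have mA i k : measurable_fun setT (A i k) by exact: continuous_measurable_plane.
pose u k (p : R * R) : 'cV[R]_n := \col_i A i k p.
have mu' k i : measurable_fun setT (fun p => u k p i 0).
  by have -> : (fun p => u k p i 0) = A i k by apply/funext => p; rewrite mxE.
have closedS : closed S by apply: compact_closed => //; exact: norm_hausdorff.
have [v [mv Sv vE]] := limit_selection closedS ((Sc 0).2 0) mu'.
exists (fun t x => v (t, x)); split => [i|t x|t]; [ | exact: Sv | ].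
  by have := mv i; congr measurable_fun; apply/funext => -[].
have lp i : {ae lam, forall x, lebesgue_pt (F i t) x}.
  by apply: lebesgue_differentiation; exact: (bounded_locally_integrable (mF i t) (bF i t)).
have : {ae lam, forall x, forall i, lebesgue_pt (F i t) x} by exact: ae_forall_fin.
apply: ae_impl => x hx; apply: vE => [|i]; first exact: (Sc t).2.
have -> : (fun k => u k (t, x) i 0) = (fun k => A i k (t, x)) by apply/funext => k; rewrite mxE.
exact: (hat_average_cvg (mF i t) (bF i t) (hx i)).
Qed.

End JointRepresentative.

Section Flows.
Context {R : realType} {n : nat}.
Local Notation lam := (@lebesgue_measure R).
Implicit Types (m w : R -> R -> 'cV[R]_n).

Definition window (w : R -> R -> 'cV[R]_n) (r t : R) : \bar R :=
  (\int[lam]_(x in `[(- r)%R, r]%classic) `|w t x|%:E)%E.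

(** Curves that are defined for all times and jointly Borel: on these, time
    changes, restrictions and gluing need no care at end points. *)
Definition flow (S : set 'cV[R]_n) m w : Prop :=
  [/\ forall i, measurable_fun setT (fun p : R * R => m p.1 p.2 i 0),
      forall i, measurable_fun setT (fun p : R * R => w p.1 p.2 i 0),
      forall t x, S (m t x),
      forall r, 0 < r -> (\int[lam]_(t in `[(- r)%R, r]%classic) window w r t < +oo)%E &
      forall i rho, test1 rho -> forall s t, s <= t ->
        \int[lam]_x (m t x i 0 * rho x) =
        \int[lam]_x (m s x i 0 * rho x) +
        \int[lam]_(u in `[s, t]%classic) \int[lam]_x (w u x i 0 * derive1 rho x)].

Lemma window_ge0 w r t : (0 <= window w r t)%E.
Proof. by apply: integral_ge0 => x _; rewrite lee_fin. Qed.

Lemma measurable_norm_plane w : (forall i, measurable_fun setT (fun p : R * R => w p.1 p.2 i 0)) ->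
  measurable_fun setT (fun p : R * R => `|w p.1 p.2|).
Proof. by move=> mw; exact: (@measurable_norm_cV R n _ _ (fun p : R * R => w p.1 p.2)). Qed.

Lemma measurable_window w r : (forall i, measurable_fun setT (fun p : R * R => w p.1 p.2 i 0)) ->
  measurable_fun setT (window w r).
Proof.
move=> mw.
pose f (p : R * R) : \bar R := (\1_(`[- r, r]%classic) p.2 * `|w p.1 p.2|)%:E.
have mi : measurable_fun setT (\1_(`[- r, r]%classic) : R -> R) by exact: measurable_indic.
have ms : measurable_fun setT (snd : R * R -> R) by exact: measurable_snd.
have mf : measurable_fun setT f.
  apply/measurable_EFinP; apply: measurable_funM; last exact: measurable_norm_plane.
  exact: (measurable_comp measurableT (@subsetT _ _) mi ms).
have f0 p : (0 <= f p)%E by rewrite lee_fin mulr_ge0 // indicE.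
have := @measurable_fun_fubini_tonelli_F _ _ _ _ R lam f mf f0.
congr measurable_fun; apply/funext => t; rewrite /fubini_F /window [RHS]integral_mkcond.
apply: eq_integral => x _; rewrite /f patchE indicE /=.
by case: (x \in _); rewrite ?mul1r // mul0r.
Qed.

Lemma measurable_Rintegral_section (F : R * R -> R) : measurable_fun setT F ->
  measurable_fun setT (fun t => \int[lam]_x F (t, x)).
Proof.
move=> mF; apply: (measurableT_comp (f := fine)); first exact: fine_measurable.
have mE : measurable_fun setT (EFin \o F) by exact/measurable_EFinP.
have mp := @measurable_fun_fubini_tonelli_F _ _ _ _ R lam _ (measurable_funepos mE) (funepos_ge0 _).
have mn := @measurable_fun_fubini_tonelli_F _ _ _ _ R lam _ (measurable_funeneg mE) (funeneg_ge0 _).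
have := emeasurable_funB mp mn; congr measurable_fun; apply/funext => t.
rewrite [RHS]integralE; congr (_ - _)%E; apply: eq_integral => x _; by rewrite ?funeposE ?funenegE.
Qed.

Lemma measurable_section (F : R * R -> R) t : measurable_fun setT F -> measurable_fun setT (fun x => F (t, x)).
Proof. by move=> mF; apply: (measurableT_comp mF); exact: pair1_measurable. Qed.

Section FluxOfFlow.
Variables (S : set 'cV[R]_n) (m w : R -> R -> 'cV[R]_n).
Hypothesis fl : flow S m w.
Variables (i : 'I_n) (rho : R -> R).
Hypothesis trho : test1 rho.

Let h u := \int[lam]_x (w u x i 0 * derive1 rho x).

Lemma measurable_flux_kernel : measurable_fun setT (fun p : R * R => w p.1 p.2 i 0 * derive1 rho p.2).
Proof.
have [_ mw _ _ _] := fl.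
have [srho _] := trho; have [srho' _] := smooth1_derive srho.
have mr := continuous_measurable_fun (smooth1_continuous srho').
have ms : measurable_fun setT (snd : R * R -> R) by exact: measurable_snd.
by apply: measurable_funM => //; exact: (measurable_comp measurableT (@subsetT _ _) mr ms).
Qed.

Lemma measurable_flux : measurable_fun setT h.
Proof. exact: (measurable_Rintegral_section measurable_flux_kernel). Qed.

Lemma flux_window : exists r C : R, [/\ 0 < r, 0 < C & forall u r', r <= r' -> (`|h u|%:E <= C%:E * window w r' u)%E].
Proof.
have [_ mw _ _ _] := fl.
have [r [C [r0 C0 vr vr' hC]]] := test1_bounds trho.
exists r, C; split => // u r' rr'.
have mk := measurable_section u measurable_flux_kernel.
have mkE : measurable_fun setT (EFin \o (fun x => w u x i 0 * derive1 rho x)) by exact/measurable_EFinP.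
have mn : measurable_fun setT (fun x => `|w u x|%:E).
  by apply/measurable_EFinP; exact: (measurable_section u (measurable_norm_plane mw)).
have mI : measurable `[- r', r']%classic by exact: measurable_itv.
apply: (@le_trans _ _ `|\int[lam]_x (w u x i 0 * derive1 rho x)%:E|%E).
  by rewrite /h /Rintegral; case: (integral _ _ _) => [a| |] //=; rewrite normr0 leey.
apply: le_trans (le_abse_integral lam measurableT mkE) _.
rewrite /window [X in (_ * X)%E]integral_mkcond -ge0_integralZl_EFin //; last 3 first.
- by move=> x _; rewrite patchE; case: ifP => // _; rewrite lee_fin.
- by apply/(measurable_restrictT _ mI); exact: measurable_funTS.
- exact: ltW.
apply: ge0_le_integral => //.
- exact: measurableT_comp.
- by apply: measurable_funeM; apply/(measurable_restrictT _ mI); exact: measurable_funTS.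
move=> x _; rewrite patchE /=; case: ifPn => [_|].
  rewrite -EFinM lee_fin normrM mulrC; apply: ler_pM => //; last exact: cV_coord_norm_le.
  by have [] := hC x.
rewrite notin_setE /= in_itv /= -ler_norml => /negP; rewrite -ltNge => rx.
by rewrite vr' ?mulr0 ?normr0 ?mule0 //; apply: le_lt_trans rx.
Qed.

Lemma flow_flux_integrable a b : lam.-integrable `[a, b]%classic (EFin \o h).
Proof.
have [_ mw _ lw _] := fl.
have [r [C [r0 C0 hr]]] := flux_window.
pose q := Num.max r (Num.max `|a| `|b|).
have q0 : 0 < q by rewrite lt_max r0.
have rq : r <= q by rewrite le_max lexx.
have sub : `[a, b]%classic `<=` `[- q, q]%classic.
  move=> x /=; rewrite !in_itv /= => /andP[ax xb]; rewrite -ler_norml !le_max.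
  by have := ler_norm (- a); have := ler_norm b; have [x0|x0] := leP 0 x; rewrite ?(ger0_norm x0) ?(ltr0_norm x0) normrN => ? ?; apply/orP; right; apply/orP; [right|left]; lra.
suff hq : lam.-integrable `[- q, q]%classic (EFin \o h) by apply: integrableS hq.
apply/integrableP; split; first by apply/measurable_EFinP; apply: measurable_funTS; exact: measurable_flux.
have mI : measurable `[- q, q]%classic by exact: measurable_itv.
apply: (@le_lt_trans _ _ (C%:E * \int[lam]_(t in `[(- q)%R, q]%classic) window w q t)%E); last first.
  by apply: lte_mul_pinfty; [rewrite lee_fin ltW | | exact: lw].
rewrite -ge0_integralZl_EFin //; last 3 first.
- by move=> x _; exact: window_ge0.
- by apply: measurable_funTS; exact: measurable_window.
- exact: ltW.
apply: ge0_le_integral => //.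
- by apply: measurableT_comp => //; apply/measurable_EFinP; apply: measurable_funTS; exact: measurable_flux.
- by apply: measurable_funeM; apply: measurable_funTS; exact: measurable_window.
by move=> x _; exact: hr.
Qed.

End FluxOfFlow.

Lemma ae_equal_Rintegral (f g : R -> 'cV[R]_n) i (rho : R -> R) : ae_equal f g ->
  measurable_fun setT (fun x => f x i 0) -> measurable_fun setT (fun x => g x i 0) ->
  measurable_fun setT rho ->
  \int[lam]_x (f x i 0 * rho x) = \int[lam]_x (g x i 0 * rho x).
Proof.
move=> fg mf mg mr; rewrite /Rintegral; congr fine; apply: ae_eq_integral => //.
- by apply/measurable_EFinP; exact: measurable_funM.
- by apply/measurable_EFinP; exact: measurable_funM.
by apply: (ae_impl _ fg) => x -> _.
Qed.

End Flows.

(** * Curves and flows *)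

Section ClampIncrement.
Context {R : realType}.
Local Notation lam := (@lebesgue_measure R).

Lemma clamp_increment (T : R) (h : R -> R) (s t : R) : 0 < T -> s <= t ->
  lam.-integrable `[0, T]%classic (EFin \o h) ->
  \int[lam]_(u in `[s, t]%classic) (\1_(`[0, T]%classic) u * h u) =
  \int[lam]_(u in `[0, clamp T t]%classic) h u -
  \int[lam]_(u in `[0, clamp T s]%classic) h u.
Proof.
move=> T0 st hi.
have [cs0 csT] := andP (clamp_itv T0 s); have [ct0 ctT] := andP (clamp_itv T0 t).
have cst : clamp T s <= clamp T t.
  by rewrite /clamp ge_max !le_max lexx /= ge_min; apply/orP; right; rewrite le_min !ge_min st lexx ?orbT.
rewrite (@Rintegral_itv_cat R h 0 (clamp T s) (clamp T t)) //; last first.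
  apply: integrableS hi => // x /=; rewrite !in_itv /= => /andP[-> xt]; exact: le_trans xt ctT.
rewrite addrAC subrr add0r [LHS](Rintegral_indic lam) [RHS](Rintegral_indic lam).
have i0 t' : ~~ (0 <= t' <= T) -> \1_(`[0, T]%classic) t' = 0 :> R by move=> tT; rewrite indicE mem_setE in_itv /= (negbTE tT).
have clmin u : u < 0 -> clamp T u = 0.
  move=> u0; rewrite /clamp; apply/max_idPl; rewrite ge_min (ltW u0) //.
have clmax u : T < u -> clamp T u = T.
  by move=> uT; rewrite /clamp (min_idPr (ltW uT)) (max_idPr (ltW T0)).
have [t0|t0] := ltP t 0.
  rewrite (clmin t) // (clmin s) ?(le_lt_trans st) //.
  rewrite -[RHS](Rintegral_indic lam) set_itv1 [RHS]Rintegral_set1.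
  under eq_Rintegral => u _.
    have -> : \1_(`[s, t]%classic) u * (\1_(`[0, T]%classic) u * h u) = 0.
      rewrite indicE mem_setE in_itv /=; case: (boolP (s <= u <= t)) => [/andP[_ ut]|_]; last by rewrite mul0r.
      by rewrite i0 ?mul0r ?mulr0 // negb_and -ltNge (le_lt_trans ut).
    over.
  by rewrite /Rintegral integral0.
have [sT|sT] := ltP T s.
  rewrite (clmax s) // (clmax t) ?(lt_le_trans sT) //.
  rewrite -[RHS](Rintegral_indic lam) set_itv1 [RHS]Rintegral_set1.
  under eq_Rintegral => u _.
    have -> : \1_(`[s, t]%classic) u * (\1_(`[0, T]%classic) u * h u) = 0.
      rewrite indicE mem_setE in_itv /=; case: (boolP (s <= u <= t)) => [/andP[su _]|_]; last by rewrite mul0r.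
      by rewrite i0 ?mul0r ?mulr0 // negb_and -!ltNge (lt_le_trans sT) ?orbT.
    over.
  by rewrite /Rintegral integral0.
apply: eq_Rintegral => u _; rewrite mulrA; congr (_ * _).
have -> : clamp T s = Num.max 0 s by rewrite /clamp (min_idPl sT).
have -> : clamp T t = Num.min t T by rewrite /clamp; apply/max_idPr; rewrite le_min t0 ltW.
rewrite !indicE !mem_setE !in_itv /= -natrM mulnb; congr (nat_of_bool _)%:R.
by rewrite ge_max le_min; case: (s <= u); case: (0 <= u); case: (u <= t); case: (u <= T).
Qed.

End ClampIncrement.

Section FlowsAndCurves.
Context {R : realType} {n : nat}.
Local Notation lam := (@lebesgue_measure R).
Variables (S : set 'cV[R]_n) (M : 'cV[R]_n -> 'M[R]_n).
Hypotheses (cS : convex_set S) (kS : compact S) (intS : S° !=set0) (mobM : mobility S M).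
Implicit Types (m w : R -> R -> 'cV[R]_n).

Lemma flow_window_lty m w r a b : flow S m w ->
  (\int[lam]_(t in `[a, b]%classic) window w r t < +oo)%E.
Proof.
move=> [_ mw _ lw _].
pose q := Num.max (Num.max 1 r) (Num.max `|a| `|b|).
have q1 : 1 <= q by rewrite !le_max lexx.
have q0 : 0 < q by apply: lt_le_trans q1.
have qr : r <= q by rewrite !le_max lexx orbT.
have qa : `|a| <= q by rewrite !le_max lexx !orbT.
have qb : `|b| <= q by rewrite !le_max lexx !orbT.
have qa' : - q <= a by move: qa; rewrite ler_norml => /andP[].
have qb' : b <= q by move: qb; rewrite ler_norml => /andP[].
clearbody q; apply: le_lt_trans (lw q q0).
have mI (c d : R) : measurable `[c, d]%classic by exact: measurable_itv.
have mW r' (D : set R) : measurable_fun D (window w r') by apply: measurable_funTS; exact: measurable_window.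
apply: (@le_trans _ _ (\int[lam]_(t in `[a, b]%classic) window w q t)%E).
  apply: ge0_le_integral; [exact: mI | by move=> t _; exact: window_ge0 | exact: mW | exact: mW | ].
  move=> t _; apply: ge0_subset_integral; [exact: mI | exact: mI | | by [] | ].
    by apply/measurable_EFinP; apply: measurable_funTS; exact: (measurable_section t (measurable_norm_plane mw)).
  by move=> x /=; rewrite !in_itv /= => /andP[x1 x2]; apply/andP; split; lra.
apply: ge0_subset_integral; [exact: mI | exact: mI | exact: mW | by move=> t _; exact: window_ge0 | ].
by move=> x /=; rewrite !in_itv /= => /andP[x1 x2]; apply/andP; split; lra.
Qed.

Lemma flow_curve T m w : 0 < T -> flow S m w -> curves S T (m, w).
Proof.
move=> T0 fl; have [mm mw Sm lw wf] := fl.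
have mT : measurable `[0, T]%classic by exact: measurable_itv.
have SM t : 0 <= t <= T -> Mfun S (m t).
  by move=> _; split=> [i|x] //; exact: (measurable_section t (mm i)).
have bw : borel_family T w by move=> i; apply: measurable_funTS.
have sw : strip_integrable T w by move=> r r0; exact: (flow_window_lty r 0 T fl).
have wf0 : weak_form T m w by move=> i rho tr t /andP[t0 _]; exact: wf.
split => //=; first exact: (weak_form_weakstar kS).
exact: (weak_form_continuity_eq kS).
Qed.

(** Outside [[0, T]] the flux is 0 and [m] stays at its end values. *)
Lemma curve_flow T c : 0 < T -> curves S T c -> exists m w,
  [/\ flow S m w, forall t, 0 <= t <= T -> ae_equal (m t) (c.1 t) &
      forall t, 0 <= t <= T -> w t = c.2 t].
Proof.
move: c => [mu v] T0 [/= Smu wmu bv sv ce].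
have wf := continuity_eq_weak_form T0 Smu wmu bv sv ce.
have [m [mm Sm mE]] := joint_representative kS T0 Smu wmu.
have mT : measurable `[0, T]%classic by exact: measurable_itv.
pose w t x := \1_(`[0, T]%classic) t *: v t x : 'cV[R]_n.
have i1 t : 0 <= t <= T -> \1_(`[0, T]%classic) t = 1 :> R by move=> tT; rewrite indicE mem_set //= in_itv.
have i0 t : ~~ (0 <= t <= T) -> \1_(`[0, T]%classic) t = 0 :> R by move=> tT; rewrite indicE mem_setE in_itv /= (negbTE tT).
have wE t : 0 <= t <= T -> w t = v t by move=> tT; apply/funext => x; rewrite /w i1 // scale1r.
have mw i : measurable_fun setT (fun p : R * R => w p.1 p.2 i 0).
  have := measurable_strip_cut bv i; congr measurable_fun; apply/funext => p; by rewrite /w mxE.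
exists m, w; split; [| by move=> t tT; rewrite -{2}(clamp_id tT); exact: mE | exact: wE].
split; [exact: mm | exact: mw | exact: Sm | | ].
  move=> r r0; have mI : measurable `[- r, r]%classic by exact: measurable_itv.
  apply: (@le_lt_trans _ _ (\int[lam]_t window w r t)%E).
    apply: ge0_subset_integral => //; first exact: measurable_window.
    by move=> t _; exact: window_ge0.
  apply: le_lt_trans (sv r r0); rewrite [leRHS]integral_mkcond.
  rewrite le_eqVlt; apply/orP; left; apply/eqP; apply: eq_integral => t _.
  rewrite patchE mem_setE in_itv /=; case: ifPn => tT; first by rewrite /window wE.
  rewrite /window integral0_eq // => x _; by rewrite /w i0 // scale0r normr0.
move=> i rho trho s t st.
have [r [C [r0 C0 vr vr' hC]]] := test1_bounds trho.
have [srho _] := trho; have mr := continuous_measurable_fun (smooth1_continuous srho).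
have [srho' _] := smooth1_derive srho; have mr' := continuous_measurable_fun (smooth1_continuous srho').
pose h u := \int[lam]_x (v u x i 0 * derive1 rho x).
have [hi _ _] := flux_iterated bv sv i trho mT (@subset_refl _ _).
have mE' u : \int[lam]_x (m u x i 0 * rho x) = \int[lam]_x (mu 0 x i 0 * rho x) + \int[lam]_(a in `[0, clamp T u]%classic) h a.
  rewrite -(wf i rho trho _ (clamp_itv T0 u)); apply: ae_equal_Rintegral => //.
    exact: (measurable_section u (mm i)).
  exact: (Smu _ (clamp_itv T0 u)).1.
have hE : (fun u => \int[lam]_x (w u x i 0 * derive1 rho x)) = (fun u => \1_(`[0, T]%classic) u * h u).
  apply/funext => u; have [uT|uT] := boolP (0 <= u <= T); first by rewrite i1 // mul1r wE.
  rewrite i0 // mul0r; under eq_Rintegral do rewrite /w i0 // scale0r mxE mul0r.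
  by rewrite /Rintegral integral0.
rewrite hE !mE' -addrA; congr (_ + _).
rewrite (clamp_increment T0 st hi); ring.
Qed.

Lemma Phi_action (mu v : R -> 'cV[R]_n) : (forall x, S (mu x)) ->
  Phi S M mu v = (\int[lam]_x action_density M (mu x) (v x))%E.
Proof. by move=> Sm; apply: eq_integral => x _; rewrite (phi_action_density cS intS mobM). Qed.

Lemma measurable_action_section (m w : R -> 'cV[R]_n) : (forall x, S (m x)) ->
  (forall i, measurable_fun setT (fun x => m x i 0)) -> (forall i, measurable_fun setT (fun x => w x i 0)) ->
  measurable_fun setT (fun x => action_density M (m x) (w x)).
Proof. by move=> Sm mm mw; apply: (@measurable_action_density R n S M). Qed.

Lemma Phi_ae_equal (m m' w : R -> 'cV[R]_n) : Mfun S m -> Mfun S m' ->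
  (forall i, measurable_fun setT (fun x => w x i 0)) -> ae_equal m m' -> Phi S M m w = Phi S M m' w.
Proof.
move=> [mm Sm] [mm' Sm'] mw mE; rewrite (Phi_action _ Sm) (Phi_action _ Sm').
have h1 := measurable_action_section Sm mm mw; have h2 := measurable_action_section Sm' mm' mw.
apply: (@ae_eq_integral _ _ R lam setT _ _ measurableT h1 h2).
by apply: (ae_impl _ mE) => x -> _.
Qed.

Lemma Phi_ge0 m w t : (forall x, S (m t x)) -> (0 <= Phi S M (m t) (w t))%E.
Proof. by move=> Sm; rewrite Phi_action // integral_ge0 // => x _; exact: action_density_ge0. Qed.

Lemma measurable_plane_density m w :
  (forall i, measurable_fun setT (fun p : R * R => m p.1 p.2 i 0)) ->
  (forall i, measurable_fun setT (fun p : R * R => w p.1 p.2 i 0)) -> (forall t x, S (m t x)) ->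
  measurable_fun setT (fun p : R * R => action_density M (m p.1 p.2) (w p.1 p.2)).
Proof.
move=> mm mw Sm.
have H := @measurable_action_density R n S M mobM _ _ setT (fun p : R * R => m p.1 p.2) (fun p : R * R => w p.1 p.2).
by apply: H.
Qed.

Lemma measurable_Phi m w :
  (forall i, measurable_fun setT (fun p : R * R => m p.1 p.2 i 0)) ->
  (forall i, measurable_fun setT (fun p : R * R => w p.1 p.2 i 0)) -> (forall t x, S (m t x)) ->
  measurable_fun setT (fun t => Phi S M (m t) (w t)).
Proof.
move=> mm mw Sm.
have := @measurable_fun_fubini_tonelli_F _ _ _ _ R lam _ (measurable_plane_density mm mw Sm) (fun p => action_density_ge0 _ _ _).
by congr measurable_fun; apply/funext => t; rewrite Phi_action.
Qed.

Lemma measurable_flow_Phi m w : flow S m w -> measurable_fun setT (fun t => Phi S M (m t) (w t)).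
Proof. by move=> [mm mw Sm _ _]; exact: measurable_Phi. Qed.

Lemma curve_flow_Phi T c m w : curves S T c -> flow S m w ->
  (forall t, 0 <= t <= T -> ae_equal (m t) (c.1 t)) -> (forall t, 0 <= t <= T -> w t = c.2 t) ->
  forall t, 0 <= t <= T -> Phi S M (c.1 t) (c.2 t) = Phi S M (m t) (w t).
Proof.
move=> cc fl mE wE t tT; have [mm mw Sm _ _] := fl; have [Smu _ _ _ _] := cc.
rewrite -(wE t tT); apply: esym.
have Sm' : Mfun S (m t) by split; [move=> i; exact: (measurable_section t (mm i)) | exact: Sm].
have mw' i : measurable_fun setT (fun x => w t x i 0) by exact: (measurable_section t (mw i)).
exact: (Phi_ae_equal Sm' (Smu t tT) mw' (mE t tT)).
Qed.

End FlowsAndCurves.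

(** * Time changes *)

Lemma measurable_inv_pos {d : measure_display} {X : measurableType d} {R : realType} (f : X -> R) :
  measurable_fun setT f -> (forall x, 0 < f x) -> measurable_fun setT (fun x => (f x)^-1).
Proof.
move=> mf f0; have -> : (fun x => (f x)^-1) = (fun x => expR (- ln (f x))).
  by apply/funext => x; rewrite expRN lnK // posrE.
apply: measurableT_comp; first exact: measurable_expR.
apply: measurableT_comp => //; apply: measurableT_comp => //; exact: measurable_ln.
Qed.

Section Substitution.
Context {R : realType}.
Local Notation lam := (@lebesgue_measure R).
Variables (f sigma tau : R -> R).
Hypotheses (mf : measurable_fun setT f) (f0 : forall t, 0 < f t).
Hypotheses (ms : measurable_fun setT sigma) (mt : measurable_fun setT tau) (st : cancel sigma tau).
Hypothesis mass : forall a b, a <= b -> (\int[lam]_(t in sigma @^-1` `]a, b]%classic) (f t)%:E = (b - a)%:E)%E.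

(** The image under [sigma] of the measure with density [f]; it agrees with
    Lebesgue measure on intervals, hence everywhere. *)
Let pull (A : set (measurableTypeR R)) : \bar R := (\int[lam]_(t in sigma @^-1` A) (f t)%:E)%E.

Let f0' t : (0 <= (f t)%:E)%E. Proof. by rewrite lee_fin ltW. Qed.
Let mfE : measurable_fun setT (EFin \o f). Proof. exact/measurable_EFinP. Qed.
Let mpre (A : set (measurableTypeR R)) : measurable A -> measurable (sigma @^-1` A).
Proof. by move=> mA; have := ms measurableT mA; rewrite setTI. Qed.

Let pull0 : pull set0 = 0%E.
Proof. by rewrite /pull preimage_set0 integral_set0. Qed.
Let pull_ge0 A : (0 <= pull A)%E.
Proof. by apply: integral_ge0. Qed.
Let pull_additive : semi_sigma_additive pull.
Proof.
move=> F mF tF mUF; rewrite /pull preimage_bigcup.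
apply: (@semi_sigma_additive_nng_induced _ _ R lam _ mfE f0' (fun k => sigma @^-1` F k)).
- by move=> k; exact: mpre.
- apply/trivIsetP => i j _ _ ij; rewrite -preimage_setI.
  by move/trivIsetP : tF => /(_ _ _ I I ij) ->; rewrite preimage_set0.
- by rewrite -preimage_bigcup; exact: mpre.
Qed.

HB.instance Definition _ := isMeasure.Build _ _ _ pull pull0 pull_ge0 pull_additive.

Let pull_lebesgue A : measurable A -> lam A = pull A.
Proof.
apply: lebesgue_measure_unique => X [[a b] /= _ <-].
have [ab|ba] := leP a b.
  rewrite [RHS]mass //; rewrite lebesgue_measure_itv /= lte_fin.
  by case: ltP => // ba; rewrite (le_anti (_ : a <= b <= a)) ?ab // subrr.
by rewrite set_itv_ge ?measure0 // bnd_simp -leNgt ltW.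
Qed.

Import HBNNSimple.

Let substitution_simple (g : {nnsfun (measurableTypeR R) >-> R}) :
  (\int[lam]_u (g u)%:E = \int[lam]_t ((f t)%:E * (g (sigma t))%:E))%E.
Proof.
have mgr r : measurable (g @^-1` [set r]) by exact: measurable_sfunP.
have mi r : measurable_fun setT (\1_(g @^-1` [set r]) : measurableTypeR R -> R) by exact: measurable_indic.
have fin : finite_set (range g) by exact: fimfunP.
have ml r : measurable_fun setT (fun u => (r * \1_(g @^-1` [set r]) u)%:E).
  by apply/measurable_EFinP; apply: measurable_funM => //; exact: mi.
have mr r : measurable_fun setT (fun t => (f t * (r * \1_(g @^-1` [set r]) (sigma t)))%:E).
  apply/measurable_EFinP; apply: measurable_funM => //; apply: measurable_funM => //.
  exact: (measurable_comp measurableT (@subsetT _ _) (mi r) ms).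
transitivity (\int[lam]_u (\sum_(r \in range g) (r * \1_(g @^-1` [set r]) u)%:E))%E.
  by apply: eq_integral => u _; rewrite fsumEFin // -fimfunE.
transitivity (\int[lam]_t (\sum_(r \in range g) (f t * (r * \1_(g @^-1` [set r]) (sigma t)))%:E))%E; last first.
  by apply: eq_integral => t _; rewrite fsumEFin // -mulr_fsumr // -fimfunE.
rewrite ge0_integral_fsum //; last by move=> r u _; rewrite lee_fin; exact: nnfun_muleindic_ge0.
rewrite ge0_integral_fsum //; last first.
  by move=> r t _; rewrite lee_fin; apply: mulr_ge0; [exact: ltW | exact: nnfun_muleindic_ge0].
apply: eq_fsbigr => r _; rewrite integralZl_indic_nnsfun // integral_indic // setIT.
rewrite [X in (_ * X)%E](pull_lebesgue (mgr r)) /pull; have [r0|r0] := ltP r 0.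
  have -> : g @^-1` [set r] = set0 by exact: preimage_nnfun0.
  rewrite preimage_set0 integral_set0 mule0 integral0_eq // => t _.
  by rewrite indicE in_set0 !mulr0.
rewrite [X in (_ * X)%E]integral_mkcond -ge0_integralZl_EFin //.
- apply: eq_integral => t _; rewrite patchE indicE.
  have -> : (t \in sigma @^-1` (g @^-1` [set r])) = (sigma t \in g @^-1` [set r]) by [].
  by case: (_ \in _); rewrite ?mulr1 ?mulr0 ?mule0 // EFinM muleC.
- by move=> t _; rewrite patchE; case: ifP.
- by apply/(measurable_restrictT _ (mpre (mgr r))); exact: measurable_funTS.
Qed.

Let substitution_ge0 (g : R -> \bar R) : measurable_fun setT g -> (forall u, 0 <= g u)%E ->
  (\int[lam]_u g u = \int[lam]_t ((f t)%:E * g (sigma t)))%E.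
Proof.
move=> mg g0; pose a := @nnsfun_approx _ (measurableTypeR R) R setT measurableT g mg.
have ca u : EFin \o a ^~ u @ \oo --> g u by apply: cvg_nnsfun_approx => //.
have l1 : (fun k => \int[lam]_u (a k u)%:E)%E @ \oo --> (\int[lam]_u g u)%E.
  have -> : g = (fun u => limn (EFin \o a ^~ u)) by apply/funext => u; apply/esym/cvg_lim => //; exact: ca.
  apply: cvg_monotone_convergence => //.
  - by move=> k; exact/measurable_EFinP.
  - by move=> k u _; rewrite lee_fin; exact: fun_ge0.
  - by move=> u _ i j ij; rewrite lee_fin; exact/lefP/nd_nnsfun_approx.
have l2 : (fun k => \int[lam]_t ((f t)%:E * (a k (sigma t))%:E))%E @ \oo --> (\int[lam]_t ((f t)%:E * g (sigma t)))%E.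
  have -> : (fun t => (f t)%:E * g (sigma t))%E = (fun t => limn (fun k => (f t)%:E * (a k (sigma t))%:E)%E).
    apply/funext => t; apply/esym/cvg_lim => //; apply: cvgeZl => //; exact: ca.
  apply: cvg_monotone_convergence => //.
  - move=> k; apply: emeasurable_funM => //; apply/measurable_EFinP.
    have mk : measurable_fun setT (a k) by [].
    exact: (measurable_comp measurableT (@subsetT _ _) mk ms).
  - by move=> k t _; rewrite mule_ge0 // lee_fin; exact: fun_ge0.
  - move=> t _ i j ij; apply: lee_wpmul2l => //; rewrite lee_fin.
    have /lefP h := @nd_nnsfun_approx _ (measurableTypeR R) R setT measurableT g mg i j ij; exact: h.
have e : (fun k => \int[lam]_u (a k u)%:E)%E = (fun k => \int[lam]_t ((f t)%:E * (a k (sigma t))%:E))%E.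
  by apply/funext => k; exact: substitution_simple.
by rewrite -(cvg_lim _ l1) // -(cvg_lim _ l2) // e.
Qed.

(** Change of variables for a Borel bijection whose image measure is
    prescribed on intervals; no derivative of the bijection is involved. *)
Lemma substitution (g : R -> \bar R) (I : set R) : measurable I -> measurable_fun setT g -> (forall u, 0 <= g u)%E ->
  (\int[lam]_(u in I) g (tau u) = \int[lam]_(t in sigma @^-1` I) ((f t)%:E * g t))%E.
Proof.
move=> mI mg g0; have mgt : measurable_fun setT (g \o tau) by exact: measurableT_comp.
rewrite integral_mkcond substitution_ge0.
- rewrite [RHS]integral_mkcond; apply: eq_integral => t _; rewrite !patchE.
  have -> : (t \in sigma @^-1` I) = (sigma t \in I) by [].
  by case: ifP => _; rewrite ?mule0 // /= st.
- by apply/(measurable_restrictT _ mI); exact: measurable_funTS.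
by move=> u; rewrite patchE; case: ifP => // _; exact: g0.
Qed.

End Substitution.

Section TimeChange.
Context {R : realType} {n : nat}.
Local Notation lam := (@lebesgue_measure R).
Variables (S : set 'cV[R]_n) (M : 'cV[R]_n -> 'M[R]_n).
Hypotheses (cS : convex_set S) (kS : compact S) (intS : S° !=set0) (mobM : mobility S M).
Variables (m w : R -> R -> 'cV[R]_n).
Hypothesis fl : flow S m w.

Section GeneralTimeChange.
Variables (f tau : R -> R) (dec : bool).
Hypotheses (mf : measurable_fun setT f) (f0 : forall t, 0 < f t) (mt : measurable_fun setT tau).

Let I a b : set R := if dec then `[tau b, tau a]%classic else `[tau a, tau b]%classic.
Hypothesis mono : forall a b, a <= b -> if dec then tau b <= tau a else tau a <= tau b.
(** [f] is the derivative of the inverse of [tau], up to sign; it enters only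
    through this change of variables. *)
Hypothesis subst : forall (g : R -> \bar R) a b, a <= b -> measurable_fun setT g -> (forall t, 0 <= g t)%E ->
  (\int[lam]_(u in `[a, b]%classic) g (tau u) = \int[lam]_(t in I a b) ((f t)%:E * g t))%E.

Let sgn : R := if dec then -1 else 1.
Let sgn2 : sgn ^+ 2 = 1. Proof. by rewrite /sgn; case: dec; rewrite ?sqrrN expr1n. Qed.
Let nsgn : `|sgn| = 1. Proof. by rewrite /sgn; case: dec; rewrite ?normrN normr1. Qed.

Let fi t := (f t)^-1.
Let fi0 t : 0 < fi t. Proof. by rewrite invr_gt0. Qed.
Let mfi : measurable_fun setT fi. Proof. exact: measurable_inv_pos. Qed.
Let ffi t : f t * fi t = 1. Proof. by rewrite /fi divff // gt_eqF. Qed.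

Let mI a b : measurable (I a b). Proof. by rewrite /I; case: dec; exact: measurable_itv. Qed.

(** The flux is multiplied by the derivative of [tau]. *)
Let w' u x : 'cV[R]_n := (sgn * fi (tau u)) *: w (tau u) x.

Let mplane (F : R * R -> R) : measurable_fun setT F -> measurable_fun setT (fun p : R * R => F (tau p.1, p.2)).
Proof.
move=> mF.
have m1 : measurable_fun setT (fst : R * R -> R) by exact: measurable_fst.
have m2 : measurable_fun setT (snd : R * R -> R) by exact: measurable_snd.
have mp : measurable_fun setT (fun p : R * R => (tau p.1, p.2)).
  apply/measurable_fun_pairP; split; last exact: m2.
  exact: (measurable_comp measurableT (@subsetT _ _) mt m1).
exact: (measurable_comp measurableT (@subsetT _ _) mF mp).
Qed.

Let window_time_change r u : window w' r u = ((fi (tau u))%:E * window w r (tau u))%E.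
Proof.
have [_ mw _ _ _] := fl.
rewrite /window -ge0_integralZl_EFin //.
- by apply: eq_integral => x _; rewrite /w' normrZ normrM nsgn mul1r ger0_norm ?ltW.
- apply/measurable_EFinP; apply: measurable_funTS.
  exact: (measurable_section (tau u) (measurable_norm_plane mw)).
- exact: ltW.
Qed.

(** The substitution for real functions, through positive and negative parts. *)
Let Rsubst (g : R -> R) a b : a <= b -> measurable_fun setT g ->
  \int[lam]_(u in `[a, b]%classic) (fi (tau u) * g (tau u)) = \int[lam]_(t in I a b) g t.
Proof.
move=> ab mg; rewrite /Rintegral; congr fine.
have mgE : measurable_fun setT (EFin \o g) by exact/measurable_EFinP.
have mfiE : measurable_fun setT (EFin \o fi) by exact/measurable_EFinP.
have key (h : R -> \bar R) : measurable_fun setT h -> (forall t, 0 <= h t)%E ->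
    (\int[lam]_(u in `[a, b]%classic) ((fi (tau u))%:E * h (tau u)) = \int[lam]_(t in I a b) h t)%E.
  move=> mh h0; rewrite (subst (g := fun t => ((fi t)%:E * h t)%E)) //.
  - by apply: eq_integral => t _; rewrite muleA -EFinM ffi mul1e.
  - exact: emeasurable_funM.
  - by move=> t; rewrite mule_ge0 // lee_fin ltW.
have fpos (x : R) (y : \bar R) : (0 <= x)%R -> (maxe (x%:E * y) 0 = x%:E * maxe y 0)%E.
  by move=> x0; rewrite maxe_pMr // ?mule0 // lee_fin.
rewrite [LHS]integralE [RHS]integralE; congr (_ - _)%E.
  rewrite -(key _ (measurable_funepos mgE) (funepos_ge0 _)).
  by apply: eq_integral => u _; rewrite !funeposE /= EFinM fpos // ltW.
rewrite -(key _ (measurable_funeneg mgE) (funeneg_ge0 _)).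
by apply: eq_integral => u _; rewrite !funenegE -fpos ?ltW // muleN.
Qed.

Lemma flow_time_change : flow S (fun u => m (tau u)) w'.
Proof.
have [mm mw Sm lw wf] := fl; split.
- by move=> i; exact: (mplane (mm i)).
- move=> i.
  have -> : (fun p : R * R => w' p.1 p.2 i 0) = (fun p : R * R => (sgn * fi (tau p.1)) * w (tau p.1) p.2 i 0).
    by apply/funext => p; rewrite /w' mxE.
  apply: measurable_funM; last exact: (mplane (mw i)).
  apply: measurable_funM => //.
  have m1 : measurable_fun setT (fst : R * R -> R) by exact: measurable_fst.
  have mtf : measurable_fun setT (fi \o tau) by exact: measurableT_comp.
  exact: (measurable_comp measurableT (@subsetT _ _) mtf m1).
- by move=> u x; exact: Sm.
- move=> r r0; have rr : - r <= r by lra.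
  have -> : window w' r = (fun u => ((fi (tau u))%:E * window w r (tau u))%E).
    by apply/funext => u; exact: window_time_change.
  have mfiE : measurable_fun setT (EFin \o fi) by exact/measurable_EFinP.
  rewrite (subst (g := fun t => ((fi t)%:E * window w r t)%E)) //.
  + have -> : (fun t => (f t)%:E * ((fi t)%:E * window w r t))%E = window w r.
      by apply/funext => t; rewrite muleA -EFinM ffi mul1e.
    by rewrite /I; case: dec; exact: (flow_window_lty r _ _ fl).
  + by apply: emeasurable_funM => //; exact: measurable_window.
  + by move=> t; rewrite mule_ge0 ?window_ge0 // lee_fin ltW.
move=> i rho trho a b ab.
have mh := measurable_flux fl i trho.
have mk := measurable_flux_kernel fl i trho.
pose h u := \int[lam]_x (w u x i 0 * derive1 rho x).
have -> : \int[lam]_(u in `[a, b]%classic) \int[lam]_x (w' u x i 0 * derive1 rho x) =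
    sgn * \int[lam]_(t in I a b) h t.
  have mhI : measurable_fun (I a b) h by apply: measurable_funTS; exact: mh.
  rewrite -(RintegralZl_measurable lam sgn (mI a b) mhI).
  rewrite -(Rsubst (g := fun t => sgn * h t)) //; last by apply: measurable_funM => //; exact: mh.
  apply: eq_Rintegral => u _; rewrite mulrA [_ * sgn]mulrC /h.
  have mk' : measurable_fun setT (fun x => w (tau u) x i 0 * derive1 rho x) by exact: (measurable_section (tau u) mk).
  rewrite -(RintegralZl_measurable lam _ measurableT mk').
  by apply: eq_Rintegral => x _; rewrite /w' mxE mulrA.
have := mono ab; rewrite /I /sgn; case: dec => tt; have e := wf i rho trho _ _ tt.
  rewrite mulN1r; apply/esym; exact: (canLR (addrK _) e).
by rewrite mul1r; exact: e.
Qed.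

(** [Phi] is quadratic in the flux; one of the two factors [1 / f] is absorbed by
    the change of variables. *)
Lemma Phi_time_change a b : a <= b ->
  (\int[lam]_(u in `[a, b]%classic) Phi S M (m (tau u)) (w' u) =
   \int[lam]_(t in I a b) ((fi t)%:E * Phi S M (m t) (w t)))%E.
Proof.
move=> ab; have [mm mw Sm _ _] := fl.
have mP := measurable_flow_Phi cS intS mobM fl.
have e u : Phi S M (m (tau u)) (w' u) = ((fi (tau u) ^+ 2)%:E * Phi S M (m (tau u)) (w (tau u)))%E.
  rewrite !(Phi_action cS intS mobM) //; try by move=> x; exact: Sm.
  rewrite -ge0_integralZl_EFin //.
  - apply: eq_integral => x _; rewrite /w' action_densityZ; last first.
      apply: mulf_neq0; last by rewrite gt_eqF.
      by rewrite /sgn; case: dec; rewrite ?oppr_eq0 oner_neq0.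
    by rewrite exprMn sgn2 mul1r.
  - by move=> x _; exact: action_density_ge0.
  - apply: (measurable_action_section mobM); first by move=> x; exact: Sm.
      by move=> i; exact: (measurable_section (tau u) (mm i)).
    by move=> i; exact: (measurable_section (tau u) (mw i)).
  - exact: sqr_ge0.
transitivity (\int[lam]_(u in `[a, b]%classic) ((fi (tau u) ^+ 2)%:E * Phi S M (m (tau u)) (w (tau u))))%E.
  by apply: eq_integral => u _; exact: e.
rewrite (subst (g := fun t => ((fi t ^+ 2)%:E * Phi S M (m t) (w t))%E)) //.
- by apply: eq_integral => t _; rewrite muleA -EFinM expr2 mulrA ffi mul1r.
- by apply: emeasurable_funM => //; apply/measurable_EFinP; exact: measurable_funX.
- by move=> t; rewrite mule_ge0 ?lee_fin ?sqr_ge0 // (Phi_ge0 cS intS mobM).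
Qed.

End GeneralTimeChange.
End TimeChange.

(** * Operations on flows *)

Section FlowOperations.
Context {R : realType} {n : nat}.
Local Notation lam := (@lebesgue_measure R).
Variables (S : set 'cV[R]_n) (M : 'cV[R]_n -> 'M[R]_n).
Hypotheses (cS : convex_set S) (kS : compact S) (intS : S° !=set0) (mobM : mobility S M).
Implicit Types (m w : R -> R -> 'cV[R]_n).

Lemma flow_shift m w s : flow S m w ->
  flow S (fun u => m (u + s)) (fun u => w (u + s)) /\
  forall a b, a <= b ->
    (\int[lam]_(u in `[a, b]%classic) Phi S M (m (u + s)%R) (w (u + s)%R) =
     \int[lam]_(t in `[(a + s)%R, (b + s)%R]%classic) Phi S M (m t) (w t))%E.
Proof.
move=> fl; pose tau u : R := u + s; pose sigma t : R := t - s; pose f (t : R) : R := 1.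
have mt : measurable_fun setT tau by apply: measurable_funD.
have ms : measurable_fun setT sigma by apply: measurable_funB.
have st : cancel sigma tau by move=> t; rewrite /tau /sigma subrK.
have f0 t : 0 < f t by [].
have mass a b : a <= b -> (\int[lam]_(t in sigma @^-1` `]a, b]%classic) (f t)%:E = (b - a)%:E)%E.
  move=> ab; have -> : sigma @^-1` `]a, b]%classic = `](a + s), (b + s)]%classic.
    by apply/seteqP; split => t; rewrite /sigma /= !in_itv /= ltrBrDr lerBlDr.
  rewrite -[LHS]/(\int[lam]_(t in _) (cst 1%E t))%E integral_cst // mul1e [LHS]lebesgue_measure_itv /= lte_fin ltrD2r.
  case: ltP => h; last by rewrite (le_anti (_ : a <= b <= a)) ?ab // subrr.
  by rewrite -EFinB; congr EFin; ring.
have pre a b : sigma @^-1` `[a, b]%classic = `[tau a, tau b]%classic.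
  by apply/seteqP; split => t; rewrite /sigma /tau /= !in_itv /= lerBrDr lerBlDr.
have sub (g : R -> \bar R) a b : a <= b -> measurable_fun setT g -> (forall t, 0 <= g t)%E ->
    (\int[lam]_(u in `[a, b]%classic) g (tau u) = \int[lam]_(t in `[tau a, tau b]%classic) ((f t)%:E * g t))%E.
  move=> ab mg g0; rewrite -pre.
  by apply: (@substitution R f sigma tau (measurable_cst _) f0 ms mt st mass g _ _ mg g0); exact: measurable_itv.
have mono a b : a <= b -> tau a <= tau b by rewrite /tau lerD2r.
have wE : (fun u x => (1 * (f (tau u))^-1) *: w (tau u) x) = (fun u => w (u + s)).
  by apply/funext => u; apply/funext => x; rewrite /f invr1 mulr1 scale1r.
have F := @flow_time_change R n S m w fl f tau false (measurable_cst _) f0 mt mono sub.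
have P := @Phi_time_change R n S M cS intS mobM m w fl f tau false (measurable_cst _) f0 sub.
rewrite wE in F; split; first exact: F.
move=> a b ab.
transitivity (\int[lam]_(u in `[a, b]%classic) Phi S M (m (tau u)) ((fun u x => (1 * (f (tau u))^-1) *: w (tau u) x) u))%E.
  apply: eq_integral => u _; congr (Phi S M _ _); apply/funext => x.
  by rewrite /f invr1 mulr1 scale1r.
by rewrite (P a b ab); apply: eq_integral => t _; rewrite invr1 mul1e.
Qed.

Lemma flow_reverse m w : flow S m w ->
  flow S (fun u => m (- u)) (fun u x => - w (- u) x) /\
  forall a b, a <= b ->
    (\int[lam]_(u in `[a, b]%classic) Phi S M (m (- u)%R) (fun x => (- w (- u)%R x)%R) =
     \int[lam]_(t in `[(- b)%R, (- a)%R]%classic) Phi S M (m t) (w t))%E.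
Proof.
move=> fl; pose tau (u : R) : R := - u; pose f (t : R) : R := 1.
have mt : measurable_fun setT tau by apply: measurableT_comp.
have st : cancel tau tau by move=> t; rewrite /tau opprK.
have f0 t : 0 < f t by [].
have mass a b : a <= b -> (\int[lam]_(t in tau @^-1` `]a, b]%classic) (f t)%:E = (b - a)%:E)%E.
  move=> ab; have -> : tau @^-1` `]a, b]%classic = `[(- b), (- a)[%classic.
    by apply/seteqP; split => t; rewrite /tau /= !in_itv /= => /andP[h1 h2]; apply/andP; split; lra.
  rewrite -[LHS]/(\int[lam]_(t in _) (cst 1%E t))%E integral_cst // mul1e [LHS]lebesgue_measure_itv /= lte_fin ltrN2.
  case: ltP => h; last by rewrite (le_anti (_ : a <= b <= a)) ?ab // subrr.
  by rewrite -EFinB; congr EFin; ring.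
have pre a b : tau @^-1` `[a, b]%classic = `[tau b, tau a]%classic.
  by apply/seteqP; split => t; rewrite /tau /= !in_itv /= => /andP[h1 h2]; apply/andP; split; lra.
have sub (g : R -> \bar R) a b : a <= b -> measurable_fun setT g -> (forall t, 0 <= g t)%E ->
    (\int[lam]_(u in `[a, b]%classic) g (tau u) = \int[lam]_(t in `[tau b, tau a]%classic) ((f t)%:E * g t))%E.
  move=> ab mg g0; rewrite -pre.
  by apply: (@substitution R f tau tau (measurable_cst _) f0 mt mt st mass g _ _ mg g0); exact: measurable_itv.
have mono a b : a <= b -> tau b <= tau a by rewrite /tau lerN2.
have wE : (fun u x => (-1 * (f (tau u))^-1) *: w (tau u) x) = (fun u x => - w (- u) x).
  by apply/funext => u; apply/funext => x; rewrite /f invr1 mulr1 scaleN1r.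
have F := @flow_time_change R n S m w fl f tau true (measurable_cst _) f0 mt mono sub.
have P := @Phi_time_change R n S M cS intS mobM m w fl f tau true (measurable_cst _) f0 sub.
rewrite wE in F; split; first exact: F.
move=> a b ab.
transitivity (\int[lam]_(u in `[a, b]%classic) Phi S M (m (tau u)) ((fun u x => (-1 * (f (tau u))^-1) *: w (tau u) x) u))%E.
  apply: eq_integral => u _; congr (Phi S M _ _); apply/funext => x.
  by rewrite /f invr1 mulr1 scaleN1r.
by rewrite (P a b ab); apply: eq_integral => t _; rewrite invr1 mul1e.
Qed.

(** Reparametrization by the speed [kappa + g]: time [t] becomes
    [kappa * t + \int_0^t g], which is a homeomorphism since [0 < kappa]. *)
Lemma flow_reparametrize m w (T kappa : R) (g : R -> R) : flow S m w -> 0 < T -> 0 < kappa ->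
  measurable_fun setT g -> (forall t, 0 <= g t) ->
  lam.-integrable `[0, T]%classic (EFin \o g) ->
  let T' := kappa * T + \int[lam]_(t in `[0, T]%classic) g t in
  exists m' w', [/\ flow S m' w', m' 0 = m 0, m' T' = m T &
    (\int[lam]_(u in `[0%R, T']%classic) Phi S M (m' u) (w' u) =
     \int[lam]_(t in `[0%R, T]%classic) (((kappa + g t)^-1)%R%:E * Phi S M (m t) (w t)))%E].
Proof.
move=> fl T0 k0 mg g0 gi T'.
have mT : measurable `[0, T]%classic by exact: measurable_itv.
pose J t := \int[lam]_(s in `[0, t]%classic) g s.
pose G t := J (clamp T t).
have cJ : {within `[0, T]%classic, continuous J} by exact: (parameterized_integral_continuous (ltW T0) gi).
have cG : continuous G by exact: (clamp_within T0 cJ).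
pose g1 t := \1_(`[0, T]%classic) t * g t.
have g10 t : 0 <= g1 t by rewrite mulr_ge0 // indicE.
have mg1 : measurable_fun setT g1 by apply: measurable_funM => //; exact: measurable_indic.
have g1i : lam.-integrable setT (EFin \o g1) by exact: (integrable_restrictP lam g mT).1.
have g1i' (D : set R) : measurable D -> lam.-integrable D (EFin \o g1) by move=> mD; apply: integrableS g1i.
have inc a b : a <= b -> G b - G a = \int[lam]_(t in `[a, b]%classic) g1 t.
  by move=> ab; rewrite (clamp_increment T0 ab gi).
have Gmono a b : a <= b -> G a <= G b.
  by move=> ab; rewrite -subr_ge0 (inc _ _ ab); apply: Rintegral_ge0 => t _; exact: g10.
have GB t : 0 <= G t <= G T.
  have G0 : G 0 = 0 by rewrite /G clamp_id ?lexx ?ltW // /J set_itv1 Rintegral_set1.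
  have [t0 tT] := andP (clamp_itv T0 t).
  have e : G t = G (clamp T t) by rewrite /G [in RHS]clamp_id // t0.
  by rewrite e -{1}G0 !Gmono.
have G0 : G 0 = 0 by rewrite /G clamp_id ?lexx ?ltW // /J set_itv1 Rintegral_set1.
pose sigma t := kappa * t + G t.
have csig : continuous sigma.
  by move=> t; apply: cvgD; [apply: cvgMl_tmp; exact: cvg_id | exact: cG].
have sig_ge a b : a <= b -> kappa * (b - a) <= sigma b - sigma a.
  by move=> ab; have := Gmono a b ab; rewrite /sigma mulrBr; lra.
(* [sigma] is continuous and strictly increasing, hence a bijection, with
   inverse [tau] *)
have sur u : exists t, sigma t = u.
  pose A := (`|u| + G T) / kappa.
  have GT0 : 0 <= G T by have /andP[] := GB T.
  have A0 : 0 <= A by rewrite divr_ge0 ?addr_ge0 // ltW.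
  have kA : kappa * A = `|u| + G T by rewrite /A mulrCA divff ?mulr1 // gt_eqF.
  have AA : - A <= A by lra.
  have cw : {within `[(- A), A]%classic, continuous sigma} by exact: continuous_subspaceT.
  have hA : sigma (- A) <= u by rewrite /sigma mulrN kA; have /andP[] := GB (- A); have := ler_norm (- u); rewrite normrN; lra.
  have hA' : u <= sigma A by rewrite /sigma kA; have /andP[] := GB A; have := ler_norm u; lra.
  have [] := @IVT R sigma (- A) A u AA cw.
    by rewrite ge_min hA /= le_max hA' orbT.
  by move=> c _ <-; exists c.
pose tau u := projT1 (cid (sur u)).
have ts : cancel tau sigma by move=> u; rewrite /tau; case: cid.
have sinj a b : sigma a = sigma b -> a = b.
  move=> e; have [ab|/ltW ab] := leP a b; have := sig_ge _ _ ab; rewrite e subrr pmulr_rle0 // subr_le0 => ba.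
    by apply/eqP; rewrite eq_le ab.
  by apply/eqP; rewrite eq_le ba.
have st : cancel sigma tau by move=> t; apply: sinj; exact: ts.
have tmono a b : a <= b -> tau a <= tau b.
  move=> ab; rewrite leNgt; apply/negP => /[dup] lt /ltW /sig_ge; rewrite !ts => h.
  have : 0 < kappa * (tau a - tau b) by rewrite mulr_gt0 // subr_gt0.
  lra.
have smono a b : a <= b -> sigma a <= sigma b.
  by move=> ab; rewrite -subr_ge0; apply: le_trans (sig_ge _ _ ab); rewrite mulr_ge0 ?subr_ge0 // ltW.
have le_st t u : (sigma t <= u) = (t <= tau u).
  by apply/idP/idP => [/tmono|/smono]; rewrite ?st ?ts.
have le_ts t u : (u <= sigma t) = (tau u <= t).
  by apply/idP/idP => [/tmono|/smono]; rewrite ?st ?ts.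
have mtau : measurable_fun setT tau.
  by apply: nondecreasing_measurable => //; move=> a b _ _; exact: tmono.
have msig : measurable_fun setT sigma by exact: continuous_measurable_fun.
pose f t := kappa + g1 t.
have f0 t : 0 < f t by rewrite ltr_wpDr.
have mf : measurable_fun setT f by apply: measurable_funD.
have mass a b : a <= b -> (\int[lam]_(t in sigma @^-1` `]a, b]%classic) (f t)%:E = (b - a)%:E)%E.
  move=> ab; have -> : sigma @^-1` `]a, b]%classic = `](tau a), (tau b)]%classic.
    by apply/seteqP; split => t; rewrite /= !in_itv /= le_st !ltNge le_st.
  have tab := tmono _ _ ab.
  have LI : lam `[tau a, tau b]%classic = (tau b - tau a)%:E by exact: lebesgue_itv_cc.
  have i1 : lam.-integrable `[tau a, tau b]%classic (EFin \o cst kappa).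
    by apply: continuous_itv_integrable; apply: continuous_subspaceT; exact: cst_continuous.
  have i2 : lam.-integrable `[tau a, tau b]%classic (EFin \o f).
    have H := integrableD (mu := lam) (measurable_itv `[tau a, tau b]) i1 (g1i' _ (measurable_itv _)).
    exact: H.
  have i3 : lam.-integrable `]tau a, tau b]%classic (EFin \o f).
    by apply: integrableS i2 => // t /=; rewrite !in_itv /= => /andP[/ltW -> ->].
  rewrite -[LHS]fineK; last exact: (integrable_fin_num _ i3).
  congr EFin; rewrite -[LHS]/(\int[lam]_(t in `]tau a, tau b]%classic) f t).
  rewrite (Rintegral_itv_obnd_cbnd (r := tau a) (b := BRight (tau b)) i3).
  rewrite (RintegralD (mu := lam) _ i1) //; last exact: g1i'.
  rewrite Rintegral_cst // [X in fine X]LI /= -inc //.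
  transitivity (sigma (tau b) - sigma (tau a)); last by rewrite !ts.
  by rewrite /sigma mulrBr opprD addrACA.
have pre a b : sigma @^-1` `[a, b]%classic = `[tau a, tau b]%classic.
  by apply/seteqP; split => t; rewrite /= !in_itv /= le_st le_ts.
have sub (h : R -> \bar R) a b : a <= b -> measurable_fun setT h -> (forall t, 0 <= h t)%E ->
    (\int[lam]_(u in `[a, b]%classic) h (tau u) = \int[lam]_(t in `[tau a, tau b]%classic) ((f t)%:E * h t))%E.
  move=> ab mh h0; rewrite -pre.
  by apply: (@substitution R f sigma tau mf f0 msig mtau st mass h _ _ mh h0); exact: measurable_itv.
have F := @flow_time_change R n S m w fl f tau false mf f0 mtau tmono sub.
have P := @Phi_time_change R n S M cS intS mobM m w fl f tau false mf f0 sub.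
have s0 : sigma 0 = 0 by rewrite /sigma mulr0 G0 addr0.
have sT : sigma T = T' by rewrite /sigma /T' /G clamp_id // lexx ltW.
have t0 : tau 0 = 0 by rewrite -[in LHS]s0 st.
have tT : tau T' = T by rewrite -sT st.
have T'0 : 0 <= T' by rewrite -s0 -sT; apply: smono; exact: ltW.
exists (fun u => m (tau u)), (fun u x => (1 * (f (tau u))^-1) *: w (tau u) x); split => //.
- by rewrite t0.
- by rewrite tT.
rewrite P // t0 tT; apply: eq_integral => t; rewrite inE /= => tI.
by rewrite /f /g1 indicE mem_set // mul1r.
Qed.

(** Written with indicators, so that joint measurability is that of sums of
    products. *)
Definition splice (a : R) (u v : R -> R -> 'cV[R]_n) : R -> R -> 'cV[R]_n :=
  fun t x => \1_[set s | s < a] t *: u t x + (1 - \1_[set s | s < a] t) *: v t x.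

Lemma splice_lt a u v t : t < a -> splice a u v t = u t.
Proof.
by move=> ta; apply/funext => x; rewrite /splice indicE mem_set //= scale1r subrr scale0r addr0.
Qed.

Lemma splice_ge a u v t : a <= t -> splice a u v t = v t.
Proof.
move=> ta; apply/funext => x; rewrite /splice indicE memNset /= ?scale0r ?subr0 ?scale1r ?add0r //.
by apply/negP; rewrite -leNgt.
Qed.

Let measurable_splice a (u v : R -> R -> 'cV[R]_n) i :
  measurable_fun setT (fun p : R * R => u p.1 p.2 i 0) ->
  measurable_fun setT (fun p : R * R => v p.1 p.2 i 0) ->
  measurable_fun setT (fun p : R * R => splice a u v p.1 p.2 i 0).
Proof.
move=> mu mv.
have mA : measurable [set s : R | s < a] by rewrite -set_itvNyo; exact: measurable_itv.
have mi := measurable_time_indic mA.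
have -> : (fun p : R * R => splice a u v p.1 p.2 i 0) = (fun p : R * R =>
   \1_[set s | s < a] p.1 * u p.1 p.2 i 0 + (1 - \1_[set s | s < a] p.1) * v p.1 p.2 i 0).
  by apply/funext => p; rewrite /splice !mxE.
by apply: measurable_funD; apply: measurable_funM => //; exact: measurable_funB.
Qed.

(** Both flows represent the same function at time [a], so their weak forms add
    up. *)
Lemma flow_splice a m1 w1 m2 w2 : flow S m1 w1 -> flow S m2 w2 -> ae_equal (m1 a) (m2 a) ->
  flow S (splice a m1 m2) (splice a w1 w2).
Proof.
move=> f1 f2 ea; have [mm1 mw1 Sm1 lw1 wf1] := f1; have [mm2 mw2 Sm2 lw2 wf2] := f2.
have mw i : measurable_fun setT (fun p : R * R => splice a w1 w2 p.1 p.2 i 0) by exact: measurable_splice.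
split; [by move=> i; exact: measurable_splice | exact: mw | | | ].
- move=> t x; have [ta|ta] := ltP t a; first by rewrite splice_lt.
  by rewrite splice_ge.
- move=> r r0; have mI : measurable `[- r, r]%classic by exact: measurable_itv.
  have mW1 : measurable_fun `[- r, r]%classic (window w1 r) by apply: measurable_funTS; exact: measurable_window.
  have mW2 : measurable_fun `[- r, r]%classic (window w2 r) by apply: measurable_funTS; exact: measurable_window.
  apply: (@le_lt_trans _ _ (\int[lam]_(t in `[(- r)%R, r]%classic) (window w1 r t + window w2 r t))%E).
    apply: ge0_le_integral => //.
    - by move=> t _; exact: window_ge0.
    - by apply: measurable_funTS; exact: measurable_window.
    - exact: emeasurable_funD.
    move=> t _; rewrite /window; have [ta|ta] := ltP t a.
      by rewrite splice_lt // leeDl // window_ge0.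
    by rewrite splice_ge // leeDr // window_ge0.
  rewrite ge0_integralD //; [|by move=> t _; exact: window_ge0|by move=> t _; exact: window_ge0].
  by apply: lte_add_pinfty; [exact: lw1 | exact: lw2].
move=> i rho trho s t st.
have [srho _] := trho; have mr := continuous_measurable_fun (smooth1_continuous srho).
pose h1 u := \int[lam]_x (w1 u x i 0 * derive1 rho x).
pose h2 u := \int[lam]_x (w2 u x i 0 * derive1 rho x).
pose h u := \int[lam]_x (splice a w1 w2 u x i 0 * derive1 rho x).
have hl u : u < a -> h u = h1 u by move=> ua; rewrite /h splice_lt.
have hr u : a <= u -> h u = h2 u by move=> ua; rewrite /h splice_ge.
have i1 c d := flow_flux_integrable f1 i trho c d.
have i2 c d := flow_flux_integrable f2 i trho c d.
have ilt c d : d <= a -> lam.-integrable `[c, d[%classic (EFin \o h).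
  move=> da; apply: (@eq_integrable _ _ _ lam _ _ (EFin \o h1)) => //.
    move=> u; rewrite inE /= in_itv /= => /andP[_ ud]; rewrite hl //; exact: lt_le_trans da.
  by apply: integrableS (i1 c d) => // u /=; rewrite !in_itv /= => /andP[-> /ltW].
have elt c d : d <= a -> \int[lam]_(u in `[c, d]%classic) h u = \int[lam]_(u in `[c, d]%classic) h1 u.
  move=> da; rewrite -[LHS](Rintegral_itv_bndo_bndc (a := BLeft c) (ilt c d da)).
  rewrite -[RHS](Rintegral_itv_bndo_bndc (a := BLeft c)); last first.
    by apply: integrableS (i1 c d) => // u /=; rewrite !in_itv /= => /andP[-> /ltW].
  apply: eq_Rintegral => u; rewrite inE /= in_itv /= => /andP[_ ud]; rewrite hl //; exact: lt_le_trans da.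
have ege c d : a <= c -> \int[lam]_(u in `[c, d]%classic) h u = \int[lam]_(u in `[c, d]%classic) h2 u.
  move=> ac; apply: eq_Rintegral => u; rewrite inE /= in_itv /= => /andP[cu _]; rewrite hr //; exact: le_trans ac cu.
have [ta|ta] := ltP t a.
  by rewrite !splice_lt ?(le_lt_trans st) // (wf1 i rho trho _ _ st) (elt _ _ (ltW ta)).
have [sa|sa] := ltP s a; last by rewrite !splice_ge // (wf2 i rho trho _ _ st) (ege _ _ sa).
rewrite splice_ge // splice_lt //.
have hi : lam.-integrable `[s, t]%classic (EFin \o h).
  apply/integrableP; split.
    apply/measurable_EFinP; apply: measurable_funTS.
    have [srho' _] := smooth1_derive srho.
    have mr' := continuous_measurable_fun (smooth1_continuous srho').
    have msnd : measurable_fun setT (snd : R * R -> R) by exact: measurable_snd.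
    apply: (@measurable_Rintegral_section R (fun p => splice a w1 w2 p.1 p.2 i 0 * derive1 rho p.2)).
    by apply: measurable_funM => //; exact: (measurable_comp measurableT (@subsetT _ _) mr' msnd).
  have /integrableP[mh1 l1] := i1 s t; have /integrableP[mh2 l2] := i2 s t.
  apply: (@le_lt_trans _ _ (\int[lam]_(u in `[s, t]%classic) (`|(h1 u)%:E| + `|(h2 u)%:E|))%E).
    apply: ge0_le_integral; [exact: measurable_itv | by move=> u _; exact: abse_ge0 | | | ].
    - apply: measurableT_comp => //; apply/measurable_EFinP; apply: measurable_funTS.
      have [srho' _] := smooth1_derive srho.
      have mr' := continuous_measurable_fun (smooth1_continuous srho').
      have msnd : measurable_fun setT (snd : R * R -> R) by exact: measurable_snd.
      apply: (@measurable_Rintegral_section R (fun p => splice a w1 w2 p.1 p.2 i 0 * derive1 rho p.2)).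
      by apply: measurable_funM => //; exact: (measurable_comp measurableT (@subsetT _ _) mr' msnd).
    - by apply: emeasurable_funD; exact: measurableT_comp.
    move=> u _ /=; have [ua|ua] := ltP u a; first by rewrite (hl u ua) leeDl.
    by rewrite (hr u ua) leeDr.
  rewrite ge0_integralD; [exact: lte_add_pinfty | exact: measurable_itv | by move=> u _; exact: abse_ge0 |
    exact: measurableT_comp | by move=> u _; exact: abse_ge0 | exact: measurableT_comp].
rewrite (wf2 i rho trho _ _ ta) -/(h) (Rintegral_itv_cat (ltW sa) ta hi) (elt _ _ (lexx a)) (ege _ _ (lexx a)).
rewrite addrA -(wf1 i rho trho _ _ (ltW sa)); congr (_ + _); apply/esym.
apply: ae_equal_Rintegral => //.
  exact: (measurable_section a (mm1 i)).
exact: (measurable_section a (mm2 i)).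
Qed.

Lemma flow_constant (mu : R -> 'cV[R]_n) : Mfun S mu ->
  flow S (fun=> mu) (fun _ _ => 0) /\ Phi S M mu (fun=> 0) = 0%E.
Proof.
move=> [mm Sm]; split; last first.
  by rewrite (Phi_action cS intS mobM) // integral0_eq // => x _; by apply: (action_density0 (S := S)).
split; [ | | by [] | | ].
- move=> i; have ms : measurable_fun setT (snd : R * R -> R) by exact: measurable_snd.
  exact: (measurable_comp measurableT (@subsetT _ _) (mm i) ms).
- by move=> i; under eq_fun do rewrite mxE; exact: measurable_cst.
- move=> r r0; rewrite integral0_eq ?ltry // => t _.
  by rewrite /window integral0_eq // => x _; rewrite normr0.
move=> i rho _ s t _; rewrite -[LHS]addr0; congr (_ + _); apply/esym.
transitivity (\int[lam]_(u in `[s, t]%classic) (cst (0 : R)) u); last by rewrite /Rintegral integral0.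
apply: eq_Rintegral => u _; transitivity (\int[lam]_x (cst (0 : R)) x); last by rewrite /Rintegral integral0.
by apply: eq_Rintegral => x _; rewrite mxE mul0r.
Qed.

End FlowOperations.

(** * Representation of weak limits *)

Section GaussWeight.
Context {R : realType}.
Local Notation lam := (@lebesgue_measure R).
Local Notation gamma := (@gauss_fun R).

Lemma gauss_fun_gt0 (x : R) : 0 < gamma x. Proof. exact: expR_gt0. Qed.

Lemma gauss_sqr_integrable : lam.-integrable setT (EFin \o (fun x => gamma x ^+ 2)).
Proof.
apply: (integrable_le_real (mu := lam) _ _ integrableT_gauss).
  by apply: measurable_funX; exact: measurable_gauss_fun.
move=> x; rewrite ger0_norm ?sqr_ge0 // expr2 -[leRHS]mulr1.
by apply: ler_wpM2l; [exact: gauss_fun_ge0 | exact: gauss_fun_le1].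
Qed.

End GaussWeight.

Section WeakLimits.
Context {R : realType} {n : nat}.
Local Notation lam := (@lebesgue_measure R).
Local Notation gamma := (@gauss_fun R).
Variables (S : set 'cV[R]_n).
Hypotheses (cS : convex_set S) (kS : compact S).

Let closedS : closed S. Proof. by apply: compact_closed => //; exact: norm_hausdorff. Qed.

Lemma Mfun_midpoint (f g : R -> 'cV[R]_n) : Mfun S f -> Mfun S g ->
  Mfun S (fun x => 2^-1 *: (f x + g x)).
Proof.
move=> [mf Sf] [mg Sg]; split => [i|x].
  have -> : (fun x => (2^-1 *: (f x + g x)) i 0) = (fun x => 2^-1 * (f x i 0 + g x i 0)).
    by apply/funext => x; rewrite !mxE.
  by apply: measurable_funM => //; exact: measurable_funD.
have := @convex_setE R n S (f x) (g x) 2^-1 cS (Sf x) (Sg x).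
have -> : 1 - 2^-1 = 2^-1 :> R by field.
rewrite -scalerDr; apply; apply/andP; split; lra.
Qed.

Lemma bounded_pairing_cvg (u : nat -> R -> 'cV[R]_n) (v : R -> 'cV[R]_n) i (rho : R -> R) :
  (forall k, Mfun S (u k)) -> Mfun S v -> test1 rho ->
  {ae lam, forall x, (fun k => u k x i 0) @ \oo --> v x i 0} ->
  (fun k => \int[lam]_x (u k x i 0 * rho x)) @ \oo --> \int[lam]_x (v x i 0 * rho x).
Proof.
move=> Su Sv trho cu; have [B B0 hB] := compact_coord_bounded kS.
have [r [C [r0 C0 vr _ hC]]] := test1_bounds trho.
have [srho _] := trho; have mr := continuous_measurable_fun (smooth1_continuous srho).
have ri : lam.-integrable setT (EFin \o (fun x => B * `|rho x|)).
  apply: (bounded_support_integrable (C := B * C) r0 _ _ _).1.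
  - by apply: measurable_funM => //; exact: measurableT_comp.
  - by move=> x; rewrite normrM normr_id ger0_norm ?(ltW B0) //; apply: ler_wpM2l; [exact: ltW | have [] := hC x].
  - by move=> x rx; rewrite vr // normr0 mulr0.
apply: (@Rdominated _ _ R lam setT (fun k x => u k x i 0 * rho x) (fun x => v x i 0 * rho x) (fun x => B * `|rho x|)
  measurableT _ _ _ ri _).2.
- by move=> k; apply: measurable_funM => //; exact: (Su k).1.
- by apply: measurable_funM => //; exact: Sv.1.
- by apply: (ae_impl _ cu) => x cx _; apply: cvgM => //; exact: cvg_cst.
apply: aeW => x k _; rewrite normrM; apply: ler_wpM2r => //; exact: hB ((Su k).2 x).
Qed.

(** A weak limit of functions with values in the convex set S is represented
    by such a function: midpoints of the tails converge almost everywhere. *)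
Lemma weak_limit_representable (u : nat -> R -> 'cV[R]_n) (L : 'I_n -> (R -> R) -> R) :
  (forall k, Mfun S (u k)) ->
  (forall i rho, test1 rho -> (fun k => \int[lam]_x (u k x i 0 * rho x)) @ \oo --> L i rho) ->
  exists2 h, Mfun S h & forall i rho, test1 rho -> \int[lam]_x (h x i 0 * rho x) = L i rho.
Proof.
move=> Su uL; have [B B0 hB] := compact_coord_bounded kS.
(* the conditions in [P N] are convex in [h], hold for [u N], and force the
   pairings to converge to [L]; the weight [gamma] makes bounded functions
   square-integrable *)
pose P N (h : R -> 'cV[R]_n) := Mfun S h /\ forall i rho e, test1 rho ->
   (forall j, (N <= j)%N -> `|\int[lam]_x (u j x i 0 * rho x) - L i rho| <= e) ->
   `|\int[lam]_x (h x i 0 * rho x) - L i rho| <= e.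
pose enc (h : R -> 'cV[R]_n) : 'I_n -> R -> R := fun i x => gamma x * h x i 0.
pose K N : set ('I_n -> R -> R) := [set F | exists2 h, P N h & F = enc h].
have ti h i rho : Mfun S h -> test1 rho -> lam.-integrable setT (EFin \o (fun x => h x i 0 * rho x)).
  move=> Sh trho; have [r [C [r0 C0 vr _ hC]]] := test1_bounds trho.
  by have [] := Mfun_test_integrable i Sh (smooth1_continuous trho.1) r0 vr hB.
pose Q := n%:R * B ^+ 2 * \int[lam]_x (gamma x ^+ 2).
have Km N F : K N F -> forall i, measurable_fun setT (F i).
  by move=> [h [[mh _] _] ->] i; apply: measurable_funM; [exact: measurable_gauss_fun | exact: mh].
have gQ : lam.-integrable setT (EFin \o (fun x => n%:R * B ^+ 2 * gamma x ^+ 2)).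
  exact: (integrableZl measurableT _ gauss_sqr_integrable).
have KB N F : K N F -> (\int[lam]_x (\sum_i F i x ^+ 2)%:E <= Q%:E)%E.
  move=> KF; have mF := Km _ _ KF; move: KF => [h [[_ Sh] _] FE].
  have -> : Q%:E = (\int[lam]_x (n%:R * B ^+ 2 * gamma x ^+ 2)%:E)%E.
    rewrite /Q -RintegralZl //; last exact: gauss_sqr_integrable.
    by rewrite /Rintegral fineK //; exact: (integrable_fin_num _ gQ).
  apply: ge0_le_integral => //.
  - by move=> x _; rewrite lee_fin; apply: sumr_ge0 => i _; exact: sqr_ge0.
  - by apply/measurable_EFinP; apply: measurable_sum => i; apply: measurable_funX; exact: mF.
  - exact: (measurable_int _ gQ).
  move=> x _; rewrite lee_fin FE /enc.
  apply: (@le_trans _ _ (\sum_(i < n) (B ^+ 2 * gamma x ^+ 2))).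
    apply: ler_sum => i _; rewrite exprMn mulrC; apply: ler_wpM2r; first exact: sqr_ge0.
    by rewrite -[_ ^+ 2]real_normK ?num_real // lerXn2r ?nnegrE ?(ltW B0) // hB.
  rewrite sumr_const card_ord -[leLHS]mulr_natl le_eqVlt; apply/orP; left; apply/eqP; ring.
have Kd N : K N.+1 `<=` K N.
  move=> F [h [Sh hP] ->]; exists h => //; split => // i rho e trho hj.
  by apply: hP => // j Nj; apply: hj; exact: ltnW.
have K0 N : K N !=set0.
  by exists (enc (u N)), (u N) => //; split => // i rho e trho; apply.
have Kmid N f g : K N f -> K N g -> K N (fun i x => 2^-1 * (f i x + g i x)).
  move=> [h1 [S1 P1] ->] [h2 [S2 P2] ->]; exists (fun x => 2^-1 *: (h1 x + h2 x)); last first.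
    by apply/funext => i; apply/funext => x; rewrite /enc !mxE; ring.
  split; first exact: Mfun_midpoint.
  move=> i rho e trho hj; have := P1 i rho e trho hj; have := P2 i rho e trho hj.
  have -> : \int[lam]_x ((2^-1 *: (h1 x + h2 x)) i 0 * rho x) =
     2^-1 * (\int[lam]_x (h1 x i 0 * rho x) + \int[lam]_x (h2 x i 0 * rho x)).
    rewrite -RintegralD //; [|exact: ti|exact: ti].
    rewrite -RintegralZl //; last first.
      have H := integrableD (mu := lam) measurableT (ti _ i rho S1 trho) (ti _ i rho S2 trho); exact: H.
    by apply: eq_Rintegral => x _; rewrite !mxE; ring.
  move: (Rintegral _ _ _) (Rintegral _ _ _) (L i rho) => a b l.
  by rewrite !ler_norml => /andP[? ?] /andP[? ?]; apply/andP; split; lra.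
have [f [D [Kf _ _ _ cf]]] := @nested_midpoint_sets _ _ R _ lam K Q Km KB Kd K0 Kmid.
have [h hP] : exists h : nat -> R -> 'cV[R]_n, forall k, P k (h k) /\ f k = enc (h k).
  have hh k : exists h, P k h /\ f k = enc h by have [h Ph fE] := Kf k; exists h.
  by exists (fun k => projT1 (cid (hh k))) => k; case: cid.
have [v [mv Sv cv]] := @limit_selection_closed _ _ R n S (u 0%N 0) h closedS ((Su 0%N).2 0)
  (fun k => (hP k).1.1.1) (fun k => (hP k).1.1.2).
have Mv : Mfun S v by [].
exists v => // i rho trho.
have c1 : (fun k => \int[lam]_x (h k x i 0 * rho x)) @ \oo --> \int[lam]_x (v x i 0 * rho x).
  apply: bounded_pairing_cvg => //; first by move=> k; exact: (hP k).1.1.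
  apply: (ae_impl _ cf) => x cx; apply: cv => j.
  have [_ /cvg_ex[a ha]] := cx j; apply/cvg_ex; exists ((gamma x)^-1 * a).
  have -> : (fun k => h k x j 0) = (fun k => (gamma x)^-1 * f k j x).
    by apply/funext => k; rewrite (hP k).2 /enc mulKf // gt_eqF // gauss_fun_gt0.
  by apply: cvgMl_tmp; exact: ha.
have c2 : (fun k => \int[lam]_x (h k x i 0 * rho x)) @ \oo --> L i rho.
  apply/cvgrPdist_le => e e0; have /cvgrPdist_le/(_ _ e0) [N _ hN] := uL i rho trho.
  exists N => // k /= Nk; rewrite distrC; apply: (hP k).1.2 => // j kj.
  by rewrite distrC; apply: hN => /=; exact: leq_trans kj.
exact: (cvg_unique _ c1 c2).
Qed.

End WeakLimits.

Section PlaneNullSets.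
Context {R : realType}.
Local Notation lam := (@lebesgue_measure R).
Local Notation lam2 := (lam \x lam)%E.

Lemma ae_sections (P : R * R -> Prop) : {ae lam2, forall p, P p} ->
  {ae lam, forall t, {ae lam, forall x, P (t, x)}}.
Proof.
move=> [N [mN N0 PN]].
have mx : measurable_fun setT (lam \o xsection N) by exact: measurable_fun_xsection.
have i0 : (\int[lam]_t `|(lam \o xsection N) t| = 0)%E.
  rewrite -[RHS]N0; apply: eq_integral => t _; by rewrite gee0_abs.
have := (@ae_eq_integral_abs _ _ R lam setT measurableT _ mx).1 i0.
apply: ae_impl => t /(_ I) /= z; exists (xsection N t); split => //.
  exact: measurable_xsection.
by move=> x nP; rewrite xsectionE /=; apply: PN.
Qed.

End PlaneNullSets.

(** * Competitors and their energy *)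

Section Minimizer.
Context {R : realType} {n : nat}.
Local Notation lam := (@lebesgue_measure R).
Local Notation lam2 := (lam \x lam)%E.
Local Notation gamma := (@gauss_fun R).
Variables (S : set 'cV[R]_n) (M : 'cV[R]_n -> 'M[R]_n).
Hypotheses (cS : convex_set S) (kS : compact S) (intS : S° !=set0) (mobM : mobility S M).
Implicit Types (m w : R -> R -> 'cV[R]_n).

Local Notation unit_time := (\1_(`[0%R, 1%R]%classic) : R -> R).

Definition borel_plane (u : R -> R -> 'cV[R]_n) := forall i, measurable_fun setT (fun p : R * R => u p.1 p.2 i 0).

Definition plane_energy m w : \bar R :=
  (\int[lam2]_p ((unit_time p.1)%:E * action_density M (m p.1 p.2) (w p.1 p.2)))%E.

Lemma measurable_cut_density m w : borel_plane m -> borel_plane w -> (forall t x, S (m t x)) ->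
  measurable_fun setT (fun p : R * R => (unit_time p.1)%:E * action_density M (m p.1 p.2) (w p.1 p.2))%E.
Proof.
move=> mm mw Sm; apply: emeasurable_funM; last exact: (measurable_plane_density mobM mm mw Sm).
by apply/measurable_EFinP; apply: measurable_time_indic; exact: measurable_itv.
Qed.

Lemma plane_energyE m w : borel_plane m -> borel_plane w -> (forall t x, S (m t x)) ->
  plane_energy m w = (\int[lam]_(t in `[0%R, 1%R]%classic) Phi S M (m t) (w t))%E.
Proof.
move=> mm mw Sm; rewrite /plane_energy.
have mf := measurable_cut_density mm mw Sm.
have f0 (p : R * R) : (0 <= (unit_time p.1)%:E * action_density M (m p.1 p.2) (w p.1 p.2))%E.
  by rewrite mule_ge0 ?action_density_ge0 // lee_fin indicE.
rewrite [LHS](@fubini_tonelli1 _ _ _ _ R lam lam _ mf f0) [RHS]integral_mkcond; apply: eq_integral => t _.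
rewrite /fubini_F /= patchE (Phi_action cS intS mobM) //.
rewrite indicE; case: (t \in _); first by apply: eq_integral => x _; rewrite mul1e.
by rewrite integral0_eq // => x _; rewrite mul0e.
Qed.

(** Competitors on [0, 1], with the flux integrated over the plane: in this
    form the constraint is linear in [(m, w)] without any condition on single
    time slices. *)
Definition competitor (mu0 mu1 : R -> 'cV[R]_n) m w : Prop :=
  [/\ borel_plane m, borel_plane w, forall t x, S (m t x), strip_integrable 1 w &
    forall i rho, test1 rho ->
      (forall t, 0 <= t <= 1 -> \int[lam]_x (m t x i 0 * rho x) =
         \int[lam]_x (mu0 x i 0 * rho x) +
         \int[lam2]_p (\1_(`[0, t]%classic) p.1 * (w p.1 p.2 i 0 * derive1 rho p.2))) /\
      \int[lam]_x (m 1 x i 0 * rho x) = \int[lam]_x (mu1 x i 0 * rho x)].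

Let borel_family_plane w T : borel_plane w -> borel_family T w.
Proof. by move=> mw i; apply: measurable_funTS; exact: mw. Qed.

Let sub01 t : 0 <= t <= 1 -> `[0, t]%classic `<=` `[0, 1 : R]%classic.
Proof. by move=> /andP[_ t1] s /=; rewrite !in_itv /= => /andP[-> /le_trans]; exact. Qed.

Lemma flow_competitor mu0 mu1 m w : flow S m w -> Mfun S mu0 -> Mfun S mu1 ->
  ae_equal (m 0) mu0 -> ae_equal (m 1) mu1 -> competitor mu0 mu1 m w.
Proof.
move=> fl [m0 _] [m1 _] e0 e1; have [mm mw Sm lw wf] := fl.
have [_ _ bw sw _] : curves S 1 (m, w) by exact: flow_curve.
have ms t i : measurable_fun setT (fun x => m t x i 0) by exact: (measurable_section t (mm i)).
split; [exact: mm | exact: mw | exact: Sm | exact: sw | ] => i rho trho.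
have mr := continuous_measurable_fun (smooth1_continuous trho.1).
split; last exact: ae_equal_Rintegral.
move=> t t1; have [_ _ <-] := flux_iterated bw sw i trho (measurable_itv _) (sub01 t1).
case/andP: t1 => t0 _; rewrite (wf i rho trho _ _ t0); congr (_ + _).
exact: ae_equal_Rintegral.
Qed.

Let plane_strip w r : borel_plane w -> strip_integrable 1 w -> 0 < r ->
  lam2.-integrable setT (EFin \o (fun p : R * R => unit_time p.1 * (\1_(`[- r, r]%classic) p.2 * `|w p.1 p.2|))).
Proof. move=> mw sw r0; exact: ((strip_integrableP (@borel_family_plane _ 1 mw)).1 sw r r0). Qed.

(** The constraint is affine in [(m, w)] and the action density is convex. *)
Lemma competitor_midpoint mu0 mu1 m w m' w' : competitor mu0 mu1 m w -> competitor mu0 mu1 m' w' ->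
  competitor mu0 mu1 (fun t x => 2^-1 *: (m t x + m' t x)) (fun t x => 2^-1 *: (w t x + w' t x)) /\
  (plane_energy (fun t x => 2^-1 *: (m t x + m' t x)) (fun t x => 2^-1 *: (w t x + w' t x)) <=
     (2^-1)%:E * plane_energy m w + (2^-1)%:E * plane_energy m' w')%E.
Proof.
move=> [mm mw Sm sw ww] [mm' mw' Sm' sw' ww'].
have midm (u v : R -> R -> 'cV[R]_n) : borel_plane u -> borel_plane v -> borel_plane (fun t x => 2^-1 *: (u t x + v t x)).
  move=> mu mv i.
  have -> : (fun p : R * R => (2^-1 *: (u p.1 p.2 + v p.1 p.2)) i 0) = (fun p => 2^-1 * (u p.1 p.2 i 0 + v p.1 p.2 i 0)).
    by apply/funext => p; rewrite !mxE.
  by apply: measurable_funM => //; apply: measurable_funD; [exact: mu | exact: mv].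
have h12 : 1 - 2^-1 = 2^-1 :> R by field.
have hI : ((0 : R) <= 2^-1) && ((2^-1 : R) <= 1) by apply/andP; split; lra.
have Smid t x : S (2^-1 *: (m t x + m' t x)).
  have := @convex_setE R n S (m t x) (m' t x) 2^-1 cS (Sm t x) (Sm' t x) hI.
  by rewrite h12 -scalerDr.
have bm := midm _ _ mm mm'; have bw := midm _ _ mw mw'.
have swm : strip_integrable 1 (fun t x => 2^-1 *: (w t x + w' t x)).
  apply/(strip_integrableP (@borel_family_plane _ 1 bw)) => r r0.
  have i1 := plane_strip mw sw r0; have i2 := plane_strip mw' sw' r0.
  have mI : measurable `[- r, r]%classic by exact: measurable_itv.
  have mi : measurable_fun setT (\1_(`[- r, r]%classic) : R -> R) by exact: measurable_indic.
  have msnd : measurable_fun setT (snd : R * R -> R) by exact: measurable_snd.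
  apply: (integrable_le_real (mu := lam2) _ _ (integrableD (mu := lam2) measurableT i1 i2)).
    apply: measurable_funM; first by apply: measurable_time_indic; exact: measurable_itv.
    apply: measurable_funM; first exact: (measurable_comp measurableT (@subsetT _ _) mi msnd).
    exact: (measurable_norm_plane bw).
  move=> p /=; have ui : 0 <= unit_time p.1 by rewrite indicE.
  have ri : 0 <= (\1_(`[- r, r]%classic) p.2 : R) by rewrite indicE.
  rewrite -mulrDr normrM (ger0_norm ui); apply: ler_wpM2l => //.
  rewrite -mulrDr normrM (ger0_norm ri) normr_id; apply: ler_wpM2l => //.
  rewrite normrZ ger0_norm; last lra.
  have := ler_normD (w p.1 p.2) (w' p.1 p.2); have := normr_ge0 (w p.1 p.2 + w' p.1 p.2); lra.
split.
  split => // i rho trho.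
  have [r [C [r0 C0 vr _ hC]]] := test1_bounds trho.
  have [B B0 hB] := compact_coord_bounded kS.
  have [h1 e1] := ww i rho trho; have [h2 e2] := ww' i rho trho.
  have ti (u : R -> R -> 'cV[R]_n) t : borel_plane u -> (forall t x, S (u t x)) -> lam.-integrable setT (EFin \o (fun x => u t x i 0 * rho x)).
    move=> mu Su; have Mu : Mfun S (u t) by split => // j; exact: (measurable_section t (mu j)).
    by have [] := Mfun_test_integrable i Mu (smooth1_continuous trho.1) r0 vr hB.
  have mid t : \int[lam]_x ((2^-1 *: (m t x + m' t x)) i 0 * rho x) =
     2^-1 * (\int[lam]_x (m t x i 0 * rho x) + \int[lam]_x (m' t x i 0 * rho x)).
    have j1 := ti m t mm Sm; have j2 := ti m' t mm' Sm'.
    rewrite -RintegralD // -RintegralZl //; last first.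
      have H := integrableD (mu := lam) measurableT j1 j2; exact: H.
    by apply: eq_Rintegral => x _; rewrite !mxE; ring.
  split; last by rewrite mid e1 e2; lra.
  move=> t t1; rewrite mid h1 // h2 //.
  have [_ j1 _] := flux_iterated (@borel_family_plane _ 1 mw) sw i trho (measurable_itv `[0, t]) (sub01 t1).
  have [_ j2 _] := flux_iterated (@borel_family_plane _ 1 mw') sw' i trho (measurable_itv `[0, t]) (sub01 t1).
  have -> : \int[lam2]_p (\1_(`[0, t]%classic) p.1 * ((2^-1 *: (w p.1 p.2 + w' p.1 p.2)) i 0 * derive1 rho p.2)) =
     2^-1 * (\int[lam2]_p (\1_(`[0, t]%classic) p.1 * (w p.1 p.2 i 0 * derive1 rho p.2)) +
             \int[lam2]_p (\1_(`[0, t]%classic) p.1 * (w' p.1 p.2 i 0 * derive1 rho p.2))).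
    rewrite -(RintegralD (mu := lam2) measurableT j1 j2) -RintegralZl //; last first.
      have H := integrableD (mu := lam2) measurableT j1 j2; exact: H.
    by apply: eq_Rintegral => p _; rewrite !mxE; ring.
  lra.
rewrite /plane_energy.
have d0 (m1 w1 : R -> R -> 'cV[R]_n) (p : R * R) : (0 <= (unit_time p.1)%:E * action_density M (m1 p.1 p.2) (w1 p.1 p.2))%E.
  by rewrite mule_ge0 ?action_density_ge0 // lee_fin indicE.
have md1 := measurable_cut_density mm mw Sm; have md2 := measurable_cut_density mm' mw' Sm'.
have h0 : 0 <= 2^-1 :> R by lra.
pose f1 (p : R * R) := ((unit_time p.1)%:E * action_density M (m p.1 p.2) (w p.1 p.2))%E.
pose f2 (p : R * R) := ((unit_time p.1)%:E * action_density M (m' p.1 p.2) (w' p.1 p.2))%E.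
have ee1 : (\int[lam2]_p ((2^-1)%:E * f1 p) = (2^-1)%:E * \int[lam2]_p f1 p)%E.
  exact: (ge0_integralZl_EFin lam2 measurableT (fun p _ => d0 m w p) md1 h0).
have ee2 : (\int[lam2]_p ((2^-1)%:E * f2 p) = (2^-1)%:E * \int[lam2]_p f2 p)%E.
  exact: (ge0_integralZl_EFin lam2 measurableT (fun p _ => d0 m' w' p) md2 h0).
apply: (@le_trans _ _ (\int[lam2]_p ((2^-1)%:E * f1 p) + \int[lam2]_p ((2^-1)%:E * f2 p))%E); last by rewrite ee1 ee2.
rewrite -ge0_integralD //; last 4 first.
- by move=> p _; apply: mule_ge0; [rewrite lee_fin | exact: d0].
- exact: measurable_funeM.
- by move=> p _; apply: mule_ge0; [rewrite lee_fin | exact: d0].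
- exact: measurable_funeM.
apply: ge0_le_integral.
- exact: measurableT.
- by move=> p _; exact: (d0 (fun t x => 2^-1 *: (m t x + m' t x)) (fun t x => 2^-1 *: (w t x + w' t x)) p).
- exact: (measurable_cut_density bm bw Smid).
- by apply: emeasurable_funD; exact: measurable_funeM.
move=> p _; rewrite !scalerDr.
have := action_density_convex cS intS mobM (w p.1 p.2) (w' p.1 p.2) (Sm p.1 p.2) (Sm' p.1 p.2) hI.
rewrite h12 => cv.
have u0 : (0 <= (unit_time p.1)%:E)%E by rewrite lee_fin indicE.
apply: le_trans (lee_wpmul2l u0 cv) _.
rewrite ge0_muleDr ?mule_ge0 ?action_density_ge0 ?lee_fin //.
by rewrite muleCA [X in (_ + X <= _)%E]muleCA.
Qed.

Lemma limn_einf_le (u : nat -> \bar R) (c : \bar R) : (forall k, (u k <= c)%E) -> (limn_einf u <= c)%E.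
Proof.
move=> h; rewrite limn_einf_lim; apply: lime_le; first exact: is_cvg_einfs.
by apply: nearW => k; apply: ge_ereal_inf; exists (u k); [exists k => /= | exact: h].
Qed.

(** Lower semicontinuity: pointwise by [action_density_lsc], then Fatou. *)
Lemma plane_energy_lsc (mk wk : nat -> R -> R -> 'cV[R]_n) m w (c : \bar R) :
  (forall k, borel_plane (mk k)) -> (forall k, borel_plane (wk k)) -> (forall k t x, S (mk k t x)) ->
  borel_plane m -> borel_plane w -> (forall t x, S (m t x)) ->
  {ae lam2, forall p : R * R, 0 <= p.1 <= 1 -> forall i, (fun k => mk k p.1 p.2 i 0) @ \oo --> m p.1 p.2 i 0 /\
      (fun k => wk k p.1 p.2 i 0) @ \oo --> w p.1 p.2 i 0} ->
  (forall k, (plane_energy (mk k) (wk k) <= c)%E) -> (plane_energy m w <= c)%E.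
Proof.
move=> bmk bwk Smk bm bw Sm cv hc.
pose F k (p : R * R) := ((unit_time p.1)%:E * action_density M (mk k p.1 p.2) (wk k p.1 p.2))%E.
have F0 k p : (0 <= F k p)%E by rewrite mule_ge0 ?action_density_ge0 // lee_fin indicE.
have mF k : measurable_fun setT (F k) by exact: measurable_cut_density.
apply: (@le_trans _ _ (\int[lam2]_p limn_einf (F ^~ p))%E); last first.
  have fF := @fatou _ _ R lam2 setT measurableT F mF (fun k p _ => F0 k p).
  by apply: le_trans fF _; apply: limn_einf_le => k; exact: hc.
have mL : measurable_fun setT (fun p => limn_einf (F ^~ p)).
  have -> : (fun p => limn_einf (F ^~ p)) = (fun p => - limn_esup (fun k => - F k p))%E.
    by apply/funext => p; rewrite -[RHS]oppeK; congr (- _)%E; rewrite -limn_esupN; congr limn_esup; apply/funext => k; rewrite /= oppeK.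
  by apply: measurableT_comp => //; apply: measurable_fun_limn_esup => k; exact: measurableT_comp.
rewrite /plane_energy; apply: (@ae_ge0_le_integral _ _ R lam2 setT measurableT).
- by move=> p _; rewrite mule_ge0 ?action_density_ge0 // lee_fin indicE.
- exact: measurable_cut_density.
- move=> p _; rewrite limn_einf_lim; apply: lime_ge; first exact: is_cvg_einfs.
  by apply: nearW => k; apply: le_ereal_inf_tmp => _ [j _ <-].
- exact: mL.
apply: (ae_impl _ cv) => p hp _.
have [pT|pT] := boolP (0 <= p.1 <= 1); last first.
  have u0 : unit_time p.1 = 0 by rewrite indicE mem_setE in_itv /= (negbTE pT).
  rewrite u0 mul0e limn_einf_lim; apply: lime_ge; first exact: is_cvg_einfs.
  by apply: nearW => k; apply: le_ereal_inf_tmp => _ [j _ <-].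
have u1 : unit_time p.1 = 1 by rewrite indicE mem_setE in_itv /= pT.
rewrite u1 mul1e.
have -> : (fun k => F k p) = (fun k => action_density M (mk k p.1 p.2) (wk k p.1 p.2)).
  by apply/funext => k; rewrite /F u1 mul1e.
apply: (action_density_lsc mobM) => //.
- by apply: cvg_cV => i; have [] := hp pT i.
- by apply: cvg_cV => i; have [] := hp pT i.
Qed.

End Minimizer.

(** * Existence of a minimizer *)

Section Existence.
Context {R : realType} {n : nat}.
Local Notation lam := (@lebesgue_measure R).
Local Notation lam2 := (lam \x lam)%E.
Local Notation gamma := (@gauss_fun R).
Variables (S : set 'cV[R]_n) (M : 'cV[R]_n -> 'M[R]_n).
Hypotheses (cS : convex_set S) (kS : compact S) (intS : S° !=set0) (mobM : mobility S M).
Implicit Types (m w : R -> R -> 'cV[R]_n).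
Variables (mu0 mu1 : R -> 'cV[R]_n).
Hypotheses (Smu0 : Mfun S mu0) (Smu1 : Mfun S mu1).
Local Notation unit_time := (\1_(`[0%R, 1%R]%classic) : R -> R).

Let closedS : closed S. Proof. by apply: compact_closed => //; exact: norm_hausdorff. Qed.

Let unit0 (t : R) : 0 <= unit_time t. Proof. by rewrite indicE. Qed.
Let unit1 (t : R) : 0 <= t <= 1 -> unit_time t = 1. Proof. by move=> t1; rewrite indicE mem_set //= in_itv. Qed.
Let unitN (t : R) : ~~ (0 <= t <= 1) -> unit_time t = 0.
Proof. by move=> t1; rewrite indicE mem_setE in_itv /= (negbTE t1). Qed.

(** Bounded energy bounds this encoding in L2: the weight [gamma] makes the
    bounded [m] square-integrable, and [action_density_coercive] controls [w]. *)
Let enc m w (i : 'I_n + 'I_n) (p : R * R) : R :=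
  match i with
  | inl i => unit_time p.1 * (gamma p.2 * m p.1 p.2 i 0)
  | inr i => unit_time p.1 * w p.1 p.2 i 0
  end.

Let munit : measurable_fun setT (fun p : R * R => unit_time p.1).
Proof. by apply: measurable_time_indic; exact: measurable_itv. Qed.

Let mgamma : measurable_fun setT (fun p : R * R => gamma p.2).
Proof.
have ms : measurable_fun setT (snd : R * R -> R) by exact: measurable_snd.
exact: (measurable_comp measurableT (@subsetT _ _) measurable_gauss_fun ms).
Qed.

Let measurable_enc m w : borel_plane m -> borel_plane w -> forall i, measurable_fun setT (enc m w i).
Proof.
move=> mm mw [i|i]; apply: measurable_funM => //.
by apply: measurable_funM => //; exact: mm.
Qed.

Let weight_integrable : lam2.-integrable setT (EFin \o (fun p : R * R => unit_time p.1 * gamma p.2 ^+ 2)).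
Proof.
have i1 := integrable_indic_itv (0 : R) 1 true false.
exact: (@tensor_integrable _ _ _ _ R lam lam _ _ i1 gauss_sqr_integrable).
Qed.

Let enc_bound : exists Q L : R, 0 <= L /\ forall m w, borel_plane m -> borel_plane w -> (forall t x, S (m t x)) ->
  (\int[lam2]_p (\sum_i enc m w i p ^+ 2)%:E <= Q%:E + L%:E * plane_energy M m w)%E.
Proof.
have [B B0 hB] := compact_coord_bounded kS.
have [L L0 hL] := action_density_coercive kS mobM.
have wi := integrableZl (mu := lam2) measurableT (n%:R * B ^+ 2) weight_integrable.
exists (fine (\int[lam2]_p ((n%:R * B ^+ 2)%:E * (unit_time p.1 * gamma p.2 ^+ 2)%:E)))%E, L.
split; first exact: ltW.
move=> m w mm mw Sm; rewrite fineK; last exact: (integrable_fin_num _ wi).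
have md := measurable_cut_density mobM mm mw Sm.
have d0 (p : R * R) : (0 <= (unit_time p.1)%:E * action_density M (m p.1 p.2) (w p.1 p.2))%E.
  by rewrite mule_ge0 ?action_density_ge0 // lee_fin.
have w0 (p : R * R) : (0 <= (n%:R * B ^+ 2)%:E * (unit_time p.1 * gamma p.2 ^+ 2)%:E)%E.
  by rewrite mule_ge0 // lee_fin mulr_ge0 ?sqr_ge0.
rewrite /plane_energy -(ge0_integralZl_EFin lam2 measurableT (fun p _ => d0 p) md (ltW L0)).
rewrite -ge0_integralD //; last 3 first.
- exact: (measurable_int _ wi).
- by move=> p _; rewrite mule_ge0 // lee_fin ltW.
- exact: measurable_funeM.
apply: ge0_le_integral.
- exact: measurableT.
- by move=> p _; rewrite lee_fin; apply: sumr_ge0 => i _; exact: sqr_ge0.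
- apply/measurable_EFinP; apply: measurable_sum => i; apply: measurable_funX; exact: measurable_enc.
- by apply: emeasurable_funD; [exact: (measurable_int _ wi) | exact: measurable_funeM].
move=> p _; rewrite big_sumType /= EFinD; apply: leeD.
  rewrite -EFinM lee_fin; apply: (@le_trans _ _ (\sum_(i < n) (B ^+ 2 * (unit_time p.1 * gamma p.2 ^+ 2)))).
    apply: ler_sum => i _.
    have -> : (unit_time p.1 * (gamma p.2 * m p.1 p.2 i 0)) ^+ 2 =
       m p.1 p.2 i 0 ^+ 2 * (unit_time p.1 * gamma p.2 ^+ 2).
      by have [t1|t1] := boolP (0 <= p.1 <= 1); [rewrite unit1 //; ring | rewrite unitN //; ring].
    apply: ler_wpM2r; first by rewrite mulr_ge0 ?sqr_ge0.
    by rewrite -[_ ^+ 2]real_normK ?num_real // lerXn2r ?nnegrE ?(ltW B0) // hB.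
  rewrite sumr_const card_ord -[leLHS]mulr_natl le_eqVlt; apply/orP; left; apply/eqP; ring.
have -> : (\sum_(i < n) (unit_time p.1 * w p.1 p.2 i 0) ^+ 2)%:E = ((unit_time p.1)%:E * (\sum_i w p.1 p.2 i 0 ^+ 2)%:E)%E.
  rewrite -EFinM mulr_sumr; congr EFin; apply: eq_bigr => i _.
  by have [t1|t1] := boolP (0 <= p.1 <= 1); [rewrite unit1 //; ring | rewrite unitN //; ring].
rewrite muleCA; apply: lee_wpmul2l; first by rewrite lee_fin.
exact: hL.
Qed.

Section Limit.
Variable W : R.
Hypothesis almost : forall e, 0 < e -> exists m w, [/\ competitor S mu0 mu1 m w & (plane_energy M m w <= (W + e)%:E)%E].

Let K (k : nat) : set ('I_n + 'I_n -> R * R -> R) :=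
  [set F | exists m w, [/\ competitor S mu0 mu1 m w, (plane_energy M m w <= (W + k.+1%:R^-1)%:E)%E & F = enc m w]].

(** [nested_midpoint_sets] for the encodings of almost minimal competitors. *)
Let minimizing_sequence : exists (mk wk : nat -> R -> R -> 'cV[R]_n) (D : R * R -> R),
  [/\ forall k, competitor S mu0 mu1 (mk k) (wk k) /\ (plane_energy M (mk k) (wk k) <= (W + k.+1%:R^-1)%:E)%E,
      measurable_fun setT D, forall p, 0 <= D p, (\int[lam2]_p (D p ^+ 2)%:E < +oo)%E &
      {ae lam2, forall p, forall i, (forall k, `|enc (mk k) (wk k) i p| <= D p) /\ cvgn (fun k => enc (mk k) (wk k) i p)}].
Proof.
have [Q [L [L0 hQ]]] := enc_bound.
have Km k F : K k F -> forall i, measurable_fun setT (F i).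
  by move=> [m [w [[mm mw _ _ _] _ ->]]]; exact: measurable_enc.
have KB k F : K k F -> (\int[lam2]_p (\sum_i F i p ^+ 2)%:E <= (Q + L * (W + 1))%:E)%E.
  move=> [m [w [[mm mw Sm _ _] hE ->]]]; apply: le_trans (hQ m w mm mw Sm) _.
  rewrite EFinD EFinM; apply: leeD => //; apply: lee_wpmul2l; first by rewrite lee_fin.
  apply: le_trans hE _; rewrite lee_fin lerD2l invf_le1 // ler1n //.
have Kd k : K k.+1 `<=` K k.
  move=> F [m [w [cc hE ->]]]; exists m, w; split => //; apply: le_trans hE _.
  by rewrite lee_fin lerD2l lef_pV2 ?posrE // ler_nat.
have K0 k : K k !=set0.
  have k0 : 0 < k.+1%:R^-1 :> R by rewrite invr_gt0.
  by have [m [w [cc hE]]] := almost k0; exists (enc m w), m, w.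
have Kmid k f g : K k f -> K k g -> K k (fun i x => 2^-1 * (f i x + g i x)).
  move=> [m [w [cc hE ->]]] [m' [w' [cc' hE' ->]]].
  have [c2 e2] := competitor_midpoint cS kS intS mobM cc cc'.
  exists (fun t x => 2^-1 *: (m t x + m' t x)), (fun t x => 2^-1 *: (w t x + w' t x)); split; [exact: c2 | | ].
    apply: le_trans e2 _.
    have h0 : (0 <= (2^-1 : R)%:E)%E by rewrite lee_fin; lra.
    apply: le_trans (leeD (lee_wpmul2l h0 hE) (lee_wpmul2l h0 hE')) _.
    rewrite -!EFinM -EFinD lee_fin le_eqVlt; apply/orP; left; apply/eqP.
    move: (W + _) => z; lra.
  by apply/funext => -[i|i]; apply/funext => p; rewrite /enc !mxE; ring.
have [f [D [Kf mD D0 Di cf]]] := @nested_midpoint_sets _ _ R _ lam2 K (Q + L * (W + 1)) Km KB Kd K0 Kmid.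
have hh k : exists mw : (R -> R -> 'cV[R]_n) * (R -> R -> 'cV[R]_n),
   [/\ competitor S mu0 mu1 mw.1 mw.2, (plane_energy M mw.1 mw.2 <= (W + k.+1%:R^-1)%:E)%E & f k = enc mw.1 mw.2].
  by have [m [w h]] := Kf k; exists (m, w).
pose z k := projT1 (cid (hh k)).
have zP k : [/\ competitor S mu0 mu1 (z k).1 (z k).2, (plane_energy M (z k).1 (z k).2 <= (W + k.+1%:R^-1)%:E)%E & f k = enc (z k).1 (z k).2].
  by rewrite /z; case: cid.
exists (fun k => (z k).1), (fun k => (z k).2), D; split => //.
  by move=> k; have [? ? _] := zP k.
apply: (ae_impl _ cf) => p hp i; have [h1 h2] := hp i.
have fE : (fun k => enc (z k).1 (z k).2 i p) = (fun k => f k i p) by apply/funext => k; have [_ _ ->] := zP k.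
split; last by rewrite fE.
by move=> k; have [_ _ <-] := zP k.
Qed.

(** The limit of a minimizing sequence. Its time slices are corrected at the
    exceptional times, where they need not represent the weak limits. *)
Lemma minimizer_of_almost : exists c, curves_between S 1 mu0 mu1 c /\ (energy S M 1 c <= W%:E)%E.
Proof.
have [mk [wk [D [hk mD D0 Di cv]]]] := minimizing_sequence.
have cc k := (hk k).1.
have bm k : borel_plane (mk k) by have [] := cc k.
have bw k : borel_plane (wk k) by have [] := cc k.
have Sm k t x : S (mk k t x) by have [_ _ h _ _] := cc k; exact: h.
pose z0 := mu0 0; have Sz0 : S z0 := Smu0.2 0.
pose u1 k (p : R * R) := mk k p.1 p.2.
pose u2 k (p : R * R) : 'cV[R]_n := unit_time p.1 *: wk k p.1 p.2.
have [v1 [mv1 Sv1 cv1]] := @limit_selection_closed _ _ R n S z0 u1 closedS Sz0 bm (fun k p => Sm k p.1 p.2).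
have mu2 k i : measurable_fun setT (fun p => u2 k p i 0).
  have -> : (fun p => u2 k p i 0) = enc (mk k) (wk k) (inr i) by apply/funext => p; rewrite /u2 mxE.
  exact: measurable_enc.
have [v2 [mv2 _ cv2]] := @limit_selection_closed _ _ R n setT 0 u2 closedT I mu2 (fun _ _ => I).
pose m t x := v1 (t, x); pose w t x := v2 (t, x).
have bmi : borel_plane m by move=> i; have := mv1 i; congr measurable_fun; apply/funext => -[t x].
have bwi : borel_plane w by move=> i; have := mv2 i; congr measurable_fun; apply/funext => -[t x].
have Smi t x : S (m t x) by exact: Sv1.
have cw : {ae lam2, forall p : R * R, forall i, (fun k => u2 k p i 0) @ \oo --> v2 p i 0 /\ forall k, `|u2 k p i 0| <= D p}.
  apply: (ae_impl _ cv) => p hp i; split; last first.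
    by move=> k; have [h _] := hp (inr i); have := h k; rewrite /= /u2 mxE.
  apply: cv2 => j; have [_] := hp (inr j); congr (cvgn _); apply/funext => k; by rewrite /= /u2 mxE.
have cm : {ae lam2, forall p : R * R, 0 <= p.1 <= 1 -> forall i, (fun k => mk k p.1 p.2 i 0) @ \oo --> m p.1 p.2 i 0}.
  apply: (ae_impl _ cv) => -[t x] hp pT; apply: cv1 => j.
  have [_ /cvg_ex[a ha]] := hp (inl j); apply/cvg_ex; exists ((gamma x)^-1 * a).
  have -> : (fun k => u1 k (t, x) j 0) = (fun k => (gamma x)^-1 * enc (mk k) (wk k) (inl j) (t, x)).
    by apply/funext => k; rewrite /enc /= unit1 // mul1r mulKf // gt_eqF // gauss_fun_gt0.
  by apply: cvgMl_tmp; exact: ha.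
(* [D] is only square-integrable: products of [D] and [C] on a bounded strip are
   dominated by [D ^ 2 + C ^ 2] *)
have D2i : lam2.-integrable setT (EFin \o (fun p => D p ^+ 2)).
  by apply: ge0_integrable_real => //; [exact: measurable_funX | move=> p; exact: sqr_ge0].
pose dom C r (p : R * R) := D p ^+ 2 + C ^+ 2 * (unit_time p.1 * \1_(`[- r, r]%classic) p.2).
have domi C r : lam2.-integrable setT (EFin \o dom C r).
  have i1 := integrable_indic_itv (0 : R) 1 true false.
  have i2 := integrable_indic_itv (- r) r true false.
  have i3 := integrableZl (mu := lam2) measurableT (C ^+ 2) (@tensor_integrable _ _ _ _ R lam lam _ _ i1 i2).
  exact: (integrableD (mu := lam2) measurableT D2i i3).
have domP C r p a b : `|a| <= D p -> `|b| <= C -> `|a * (unit_time p.1 * \1_(`[- r, r]%classic) p.2) * b| <= dom C r p.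
  move=> ha hb; have C0 : 0 <= C by apply: le_trans hb.
  have := D0 p; rewrite /dom !indicE; case: (_ \in _) => /=; case: (_ \in _) => /=;
    rewrite ?(mul0r, mul1r, mulr0, mulr1, addr0, normr0) ?sqr_ge0 // => Dp.
  rewrite normrM; apply: (@le_trans _ _ (D p * C)); first exact: ler_pM.
  have := sqr_ge0 (D p - C); rewrite sqrrB; have := mulr_ge0 Dp C0.
  set x := D p * C; set y := D p ^+ 2; set z := C ^+ 2; rewrite -mulr_natl; lra.
have swi : strip_integrable 1 w.
  have bf : borel_family 1 w by move=> i; apply: measurable_funTS; exact: bwi.
  apply/(strip_integrableP bf) => r r0.
  pose F k (p : R * R) := unit_time p.1 * (\1_(`[- r, r]%classic) p.2 * `|u2 k p|).
  have mi : measurable_fun setT (\1_(`[- r, r]%classic) : R -> R) by exact: measurable_indic.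
  have ms : measurable_fun setT (snd : R * R -> R) by exact: measurable_snd.
  have mr := measurable_comp measurableT (@subsetT _ _) mi ms.
  have := @Rdominated _ _ R lam2 setT F (fun p => unit_time p.1 * (\1_(`[- r, r]%classic) p.2 * `|v2 p|))
    (fun p => n%:R * dom 1 r p) measurableT.
  have -> : (fun p => unit_time p.1 * (\1_(`[- r, r]%classic) p.2 * `|v2 p|)) =
     (fun p : R * R => unit_time p.1 * (\1_(`[- r, r]%classic) p.2 * `|w p.1 p.2|)) by apply/funext => -[].
  move=> H; apply: (H _ _ _ _ _).1.
  - move=> k; apply: measurable_funM => //; apply: measurable_funM; first exact: mr.
    by apply: (@measurable_norm_cV R n _ _ (u2 k)) => i; exact: mu2.
  - apply: measurable_funM => //; apply: measurable_funM; first exact: mr.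
    exact: measurable_norm_plane.
  - apply: (ae_impl _ cw) => -[t x] hp _; apply: cvgMl_tmp; apply: cvgMl_tmp; apply: cvg_norm.
    by apply: cvg_cV => i; have [] := hp i.
  - exact: (integrableZl (mu := lam2) measurableT _ (domi 1 r)).
  apply: (ae_impl _ cw) => p hp k _.
  rewrite /F mulrA; have x0 : 0 <= unit_time p.1 * \1_(`[- r, r]%classic) p.2 :> R by rewrite mulr_ge0 // indicE.
  rewrite normrM (ger0_norm x0) normr_id.
  apply: le_trans (ler_wpM2l x0 (cV_norm_le_sum _)) _; rewrite mulr_sumr.
  apply: (@le_trans _ _ (\sum_(i < n) dom 1 r p)); last by rewrite sumr_const card_ord -[leLHS]mulr_natl lexx.
  apply: ler_sum => i _; have [_ /(_ k) hD] := hp i.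
  have := domP 1 r p (`|u2 k p i 0|) 1; rewrite normr_id normr1 mulr1 => /(_ hD (lexx _)).
  by apply: le_trans; rewrite normrM normr_id (ger0_norm x0) mulrC.
have bf : borel_family 1 w by move=> i; apply: measurable_funTS; exact: bwi.
have sub01 t : 0 <= t <= 1 -> `[0, t]%classic `<=` `[0, 1 : R]%classic.
  by move=> /andP[_ t1] s /=; rewrite !in_itv /= => /andP[-> /le_trans]; exact.
pose flux (u : R -> R -> 'cV[R]_n) (i : 'I_n) (rho : R -> R) (t : R) := \int[lam2]_p (\1_(`[0, t]%classic) p.1 * (u p.1 p.2 i 0 * derive1 rho p.2)).
have flux_cvg i rho t : test1 rho -> 0 <= t <= 1 -> (fun k => flux (wk k) i rho t) @ \oo --> flux w i rho t.
  move=> trho t1; have [r [C [r0 C0 vr vr' hC]]] := test1_bounds trho.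
  have [srho' _] := smooth1_derive trho.1; have mr := continuous_measurable_fun (smooth1_continuous srho').
  have ms : measurable_fun setT (snd : R * R -> R) by exact: measurable_snd.
  have mr2 := measurable_comp measurableT (@subsetT _ _) mr ms.
  have mt : measurable_fun setT (fun p : R * R => \1_(`[0, t]%classic) p.1 : R) by apply: measurable_time_indic; exact: measurable_itv.
  have mu (u : R -> R -> 'cV[R]_n) : borel_plane u -> measurable_fun setT (fun p : R * R => \1_(`[0, t]%classic) p.1 * (u p.1 p.2 i 0 * derive1 rho p.2)).
    by move=> bu; apply: measurable_funM => //; apply: measurable_funM; [exact: bu | exact: mr2].
  have cut (p : R * R) a : \1_(`[0, t]%classic) p.1 * (a * derive1 rho p.2) =
     \1_(`[0, t]%classic) p.1 * ((unit_time p.1 * a) * derive1 rho p.2).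
    rewrite indicE; case: (boolP (p.1 \in _)) => [/set_mem /(sub01 t t1) h|]; last by rewrite !mul0r.
    by rewrite unit1 ?mul1r //; move: h; rewrite /= in_itv.
  apply: (@Rdominated _ _ R lam2 setT (fun k p => \1_(`[0, t]%classic) p.1 * (wk k p.1 p.2 i 0 * derive1 rho p.2))
    (fun p => \1_(`[0, t]%classic) p.1 * (w p.1 p.2 i 0 * derive1 rho p.2)) (dom C r) measurableT _ _ _ (domi C r) _).2.
  - by move=> k; exact: mu.
  - exact: mu.
  - apply: (ae_impl _ cw) => -[s x] hp _ /=; have [c _] := hp i.
    have -> : (fun k => \1_(`[0, t]%classic) s * (wk k s x i 0 * derive1 rho x)) =
       (fun k => \1_(`[0, t]%classic) s * (u2 k (s, x) i 0 * derive1 rho x)).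
      by apply/funext => k; rewrite (cut (s, x)) /u2 mxE.
    by apply: cvgMl_tmp; apply: cvgMr_tmp.
  apply: (ae_impl _ cw) => p hp k _; have [_ /(_ k) hD] := hp i; rewrite (cut p).
  have := domP C r p (u2 k p i 0) (derive1 rho p.2) hD (hC p.2).2; apply: le_trans.
  rewrite /u2 mxE; have [rp|rp] := ltP r `|p.2|; first by rewrite vr' // !mulr0 normr0.
  have -> : \1_(`[- r, r]%classic) p.2 = 1 :> R by rewrite indicE mem_set //= in_itv /= -ler_norml.
  rewrite indicE; case: (boolP (p.1 \in _)) => [/set_mem /(sub01 t t1) h|]; last by rewrite mul0r normr0.
  by rewrite unit1 ?mul1r ?mulr1 //; move: h; rewrite /= in_itv.
pose L t i rho := \int[lam]_x (mu0 x i 0 * rho x) + flux w i rho t.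
have Lcvg t i rho : 0 <= t <= 1 -> test1 rho -> (fun k => \int[lam]_x (mk k t x i 0 * rho x)) @ \oo --> L t i rho.
  move=> t1 trho.
  have -> : (fun k => \int[lam]_x (mk k t x i 0 * rho x)) = (fun k => \int[lam]_x (mu0 x i 0 * rho x) + flux (wk k) i rho t).
    by apply/funext => k; have [_ _ _ _ h] := cc k; exact: (h i rho trho).1.
  by apply: cvgD; [exact: cvg_cst | exact: flux_cvg].
have Mk k t : Mfun S (mk k t) by split => [i|x]; [exact: (measurable_section t (bm k i)) | exact: Sm].
have Mm t : Mfun S (m t) by split => [i|x]; [exact: (measurable_section t (bmi i)) | exact: Smi].
have ex t : exists h, 0 <= t <= 1 -> Mfun S h /\ forall i rho, test1 rho -> \int[lam]_x (h x i 0 * rho x) = L t i rho.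
  have [t1|t1] := boolP (0 <= t <= 1); last by exists mu0.
  have [h Sh hL] := weak_limit_representable cS kS (fun k => Mk k t) (fun i rho => Lcvg t i rho t1).
  by exists h.
(* [m t] represents the limits [L t] at almost every [t] only; at the other
   times, and at the end points, it is replaced *)
pose good t := forall i rho, test1 rho -> \int[lam]_x (m t x i 0 * rho x) = L t i rho.
pose H t := if t == 0 then mu0 else if t == 1 then mu1 else if `[< good t >] then m t else projT1 (cid (ex t)).
have t0 : 0 <= (0 : R) <= 1 by rewrite lexx ler01.
have t1 : 0 <= (1 : R) <= 1 by rewrite lexx ler01.
have HP t : 0 <= t <= 1 -> Mfun S (H t) /\ forall i rho, test1 rho -> \int[lam]_x (H t x i 0 * rho x) = L t i rho.
  move=> tI; rewrite /H; have [->|_] := eqVneq t 0.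
    split => // i rho trho; rewrite /L /flux.
    have [_ _ <-] := flux_iterated bf swi i trho (measurable_itv `[0, 0]) (sub01 0 t0).
    by rewrite set_itv1 Rintegral_set1 addr0.
  have [->|_] := eqVneq t 1.
    split => // i rho trho; apply/esym.
    have c := Lcvg 1 i rho t1 trho.
    have e : (fun k => \int[lam]_x (mk k 1 x i 0 * rho x)) = (fun=> \int[lam]_x (mu1 x i 0 * rho x)).
      by apply/funext => k; have [_ _ _ _ h] := cc k; exact: (h i rho trho).2.
    by rewrite e in c; exact: (cvg_unique _ c (cvg_cst _)).
  case: asboolP => [g|_]; first by split.
  by case: cid => h hP /=; exact: hP.
have wf : weak_form 1 H w.
  move=> i rho trho t tI; rewrite (HP t tI).2 // (HP 0 t0).2 // /L -addrA; congr (_ + _).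
  have [_ _ e1] := flux_iterated bf swi i trho (measurable_itv `[0, 0]) (sub01 0 t0).
  have [_ _ e2] := flux_iterated bf swi i trho (measurable_itv _) (sub01 t tI).
  by rewrite /flux -e1 -e2 set_itv1 Rintegral_set1 add0r.
have SH t : 0 <= t <= 1 -> Mfun S (H t) by move=> /HP[].
have cH : curves S 1 (H, w).
  split => //=; first exact: (weak_form_weakstar kS ltr01 SH bf swi wf).
  exact: (weak_form_continuity_eq kS ltr01 SH bf swi wf).
exists (H, w); split.
  split => //=; rewrite /ae_equal /H ?eqxx; first exact: aeW.
  by rewrite oner_eq0 /=; exact: aeW.
have [m' [w' [fl mE wE]]] := curve_flow kS ltr01 cH.
have PE := curve_flow_Phi cS intS mobM cH fl mE wE.
have [bm' bw' Sm' _ _] := fl.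
have mPH := measurable_Phi cS intS mobM bm' bw' Sm'.
have mPm := measurable_Phi cS intS mobM bmi bwi Smi.
have -> : energy S M 1 (H, w) = plane_energy M m w.
  rewrite (plane_energyE cS intS mobM bmi bwi Smi) /energy.
  transitivity (\int[lam]_(t in `[0%R, 1%R]%classic) Phi S M (m' t) (w' t))%E.
    by apply: eq_integral => t; rewrite inE /= in_itv /= => tI; rewrite -PE.
  apply: (@ae_eq_integral _ _ R lam `[0, 1]%classic _ _ (measurable_itv _)).
  - by apply: measurable_funTS; exact: mPH.
  - by apply: measurable_funTS; exact: mPm.
  have ne (c : R) : {ae lam, forall t, t != c}.
    exists [set c]; split => //; first exact: lebesgue_measure_set1.
    by move=> t /= /negP; rewrite negbK => /eqP.
  have as_ := ae_sections cm.
  have ne01 : {ae lam, forall t : R, t != 0 /\ t != 1} by apply: (ae_impl2 _ (ne 0) (ne 1)) => t a b.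
  apply: (ae_impl2 _ as_ ne01) => t ht [n0 n1] tI'.
  have tI : 0 <= t <= 1 by move: tI'; rewrite /= in_itv.
  suff g : good t.
    have hm : H t = m t by rewrite /H (negbTE n0) (negbTE n1) (asboolT g).
    exact: (etrans (esym (PE t tI)) (congr1 (fun z => Phi S M z (w t)) hm)).
  move=> i rho trho.
  have c1 : (fun k => \int[lam]_x (mk k t x i 0 * rho x)) @ \oo --> \int[lam]_x (m t x i 0 * rho x).
    apply: (bounded_pairing_cvg kS) => //.
    by apply: (ae_impl _ ht) => x /(_ tI i).
  exact: (cvg_unique _ c1 (Lcvg t i rho tI trho)).
apply/lee_addgt0Pr => e e0.
have [N hN] : exists N : nat, (N.+1%:R^-1 : R) < e.
  by have [N _ h] := near_infty_natSinv_lt (PosNum e0); exists N; apply: h => /=.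
have := @plane_energy_lsc R n S M mobM (fun k => mk (k + N)%N) (fun k => wk (k + N)%N) m w (W + e)%:E.
rewrite EFinD; apply.
- by move=> k; exact: bm.
- by move=> k; exact: bw.
- by move=> k; exact: Sm.
- exact: bmi.
- exact: bwi.
- exact: Smi.
- apply: (ae_impl2 _ cm cw) => -[t x] h1 h2 tI i; split.
    by have := h1 tI i; rewrite -(cvg_shiftn N).
  have [c _] := h2 i; have := c; rewrite -(cvg_shiftn N) /=.
  have -> : (fun k => u2 (k + N)%N (t, x) i 0) = (fun k => wk (k + N)%N t x i 0).
    by apply/funext => k; rewrite /u2 mxE /= unit1 // mul1r.
  by [].
move=> k; apply: le_trans (hk (k + N)%N).2 _; rewrite -EFinD lee_fin lerD2l.
apply: le_trans (ltW hN); rewrite lef_pV2 ?posrE // ler_nat ltnS leq_addl //.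
Qed.

End Limit.
End Existence.

(** * Energy and length *)

Section Transport.
Context {R : realType} {n : nat}.
Local Notation lam := (@lebesgue_measure R).
Variables (S : set 'cV[R]_n) (M : 'cV[R]_n -> 'M[R]_n).
Hypotheses (cS : convex_set S) (kS : compact S) (intS : S° !=set0) (mobM : mobility S M).
Implicit Types (m w : R -> R -> 'cV[R]_n) (mu nu : R -> 'cV[R]_n).

Lemma ae_equal_refl mu : ae_equal mu mu.
Proof. exact: aeW. Qed.

Lemma ae_equal_trans mu nu xi : ae_equal mu nu -> ae_equal nu xi -> ae_equal mu xi.
Proof. by move=> h1 h2; apply: (ae_impl2 _ h1 h2) => x -> ->. Qed.

Lemma ae_equal_sym mu nu : ae_equal mu nu -> ae_equal nu mu.
Proof. by move=> h; apply: (ae_impl _ h) => x ->. Qed.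

Lemma flow_between T m w mu nu : 0 < T -> flow S m w -> ae_equal (m 0) mu -> ae_equal (m T) nu ->
  curves_between S T mu nu (m, w).
Proof. by move=> T0 fl h0 hT; split; [exact: flow_curve | exact: h0 | exact: hT]. Qed.

Lemma between_flow T mu nu c : 0 < T -> curves_between S T mu nu c -> exists m w,
  [/\ flow S m w, ae_equal (m 0) mu, ae_equal (m T) nu,
      forall t, 0 <= t <= T -> ae_equal (m t) (c.1 t) &
      forall t, 0 <= t <= T -> Phi S M (c.1 t) (c.2 t) = Phi S M (m t) (w t)].
Proof.
move=> T0 [cc h0 hT]; have [m [w [fl mE wE]]] := curve_flow kS T0 cc.
exists m, w; split; [exact: fl | | | exact: mE | exact: (curve_flow_Phi cS intS mobM cc fl mE wE)].
- by apply: ae_equal_trans h0; apply: mE; rewrite lexx ltW.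
- by apply: ae_equal_trans hT; apply: mE; rewrite lexx ltW.
Qed.

Lemma energy_flow T c m w : (forall t, 0 <= t <= T -> Phi S M (c.1 t) (c.2 t) = Phi S M (m t) (w t)) ->
  energy S M T c = (\int[lam]_(t in `[0%R, T]%classic) Phi S M (m t) (w t))%E.
Proof. by move=> h; apply: eq_integral => t; rewrite inE /= in_itv /= => /h. Qed.

Definition curve_length (T : R) (c : curve) : \bar R :=
  (\int[lam]_(t in `[0%R, T]%classic) sqrte (Phi S M (c.1 t) (c.2 t)))%E.

Lemma length_flow T c m w : (forall t, 0 <= t <= T -> Phi S M (c.1 t) (c.2 t) = Phi S M (m t) (w t)) ->
  curve_length T c = (\int[lam]_(t in `[0%R, T]%classic) sqrte (Phi S M (m t) (w t)))%E.
Proof. by move=> h; apply: eq_integral => t; rewrite inE /= in_itv /= => /h ->. Qed.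

Lemma measurable_sqrte {d : measure_display} {X : measurableType d} (D : set X) (f : X -> \bar R) :
  measurable D -> measurable_fun D f -> (forall x, D x -> 0 <= f x)%E -> measurable_fun D (fun x => sqrte (f x)).
Proof.
move=> mD mf f0; apply: (measurability _ (ErealGenOInfty.measurableE R)) => // _ [_ [y ->] <-].
have [y0|y0] := ltP y 0.
  have -> : D `&` (fun x => sqrte (f x)) @^-1` `]y%:E, +oo[%classic = D; last exact: mD.
  apply/seteqP; split => [x [Dx _]|x Dx]; first exact: Dx.
  split; first exact: Dx.
  by rewrite /= in_itv /= andbT; apply: lt_le_trans (sqrte_ge0 _); rewrite lte_fin.
have -> : D `&` (fun x => sqrte (f x)) @^-1` `]y%:E, +oo[%classic = D `&` f @^-1` `](y ^+ 2)%:E, +oo[%classic.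
  have e : y%:E = sqrte ((y ^+ 2)%:E) by rewrite EFin_expe sqrte_sqr gee0_abs // lee_fin.
  apply/seteqP; split => x [Dx] /=; rewrite in_itv /= andbT => h; split => //=; rewrite in_itv /= andbT.
    by move: h; rewrite e !ltNge lee_sqrt // lee_fin sqr_ge0.
  by rewrite e ltNge lee_sqrt ?lee_fin ?sqr_ge0 // -ltNge.
by apply: mf => //; exact: emeasurable_itv.
Qed.

Let P0 m w t : (forall t x, S (m t x)) -> (0 <= Phi S M (m t) (w t))%E.
Proof. by move=> Sm; apply: (Phi_ge0 cS intS mobM). Qed.

(** Reparametrizing by arc length makes the speed constant. The extra speed
    [e / T] keeps the reparametrization invertible where [Phi] vanishes; the
    factor [c0] adjusts the duration to [T']. *)
Lemma arc_length T T' L e mu nu c : 0 < T -> 0 < T' -> 0 < e -> curves_between S T mu nu c ->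
  (curve_length T c <= L%:E)%E ->
  exists2 c', curves_between S T' mu nu c' & (T'%:E * energy S M T' c' <= ((L + e) ^+ 2)%:E)%E.
Proof.
move=> T0 T'0 e0 cb; have [m [w [fl h0 hT _ PE]]] := between_flow T0 cb.
rewrite (length_flow PE) => hL; have [mm mw Sm _ _] := fl.
have mT : measurable `[0, T]%classic by exact: measurable_itv.
pose P t := Phi S M (m t) (w t).
have PP t : (0 <= P t)%E by exact: P0.
have mP : measurable_fun setT P by exact: (measurable_flow_Phi cS intS mobM fl).
pose s t := sqrte (P t).
have ms : measurable_fun setT s by exact: measurable_sqrte.
have s0 t : (0 <= s t)%E by exact: sqrte_ge0.
have si : lam.-integrable `[0, T]%classic s.
  apply/integrableP; split; first exact: measurable_funTS.
  under eq_integral do rewrite gee0_abs //.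
  by apply: le_lt_trans hL _; rewrite ltry.
pose g0 t := fine (s t).
have g00 t : 0 <= g0 t by rewrite fine_ge0.
have mg0 : measurable_fun setT g0 by apply: (measurableT_comp (f := fine)); [exact: fine_measurable | exact: ms].
have sfin := integrable_ae (mu := lam) mT si.
have mg0E : measurable_fun `[0, T]%classic (EFin \o g0) by apply/measurable_EFinP; exact: measurable_funTS.
have eI : (\int[lam]_(t in `[0%R, T]%classic) (g0 t)%:E = \int[lam]_(t in `[0%R, T]%classic) s t)%E.
  apply: (@ae_eq_integral _ _ R lam `[0, T]%classic _ _ mT mg0E); first exact: measurable_funTS.
  by apply: (ae_impl _ sfin) => t h tT; rewrite /comp /g0 fineK //; exact: h.
have g0i : lam.-integrable `[0, T]%classic (EFin \o g0).
  apply/integrableP; split => //.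
  under eq_integral do rewrite gee0_abs ?lee_fin //.
  by rewrite eI; apply: le_lt_trans hL _; rewrite ltry.
pose L' := \int[lam]_(t in `[0, T]%classic) g0 t.
have L'0 : 0 <= L' by apply: Rintegral_ge0 => t _.
have L'E : (\int[lam]_(t in `[0%R, T]%classic) s t = L'%:E)%E.
  by rewrite -eI /L' /Rintegral fineK //; exact: (integrable_fin_num _ g0i).
have L'L : L' <= L by rewrite -lee_fin -L'E.
pose c0 := T' / (e + L').
have eL : 0 < e + L' by rewrite ltr_wpDr.
have c00 : 0 < c0 by rewrite divr_gt0.
pose kappa := c0 * (e / T); pose g t := c0 * g0 t.
have k0 : 0 < kappa by rewrite !mulr_gt0 // invr_gt0.
have mg : measurable_fun setT g by apply: measurable_funM.
have gg0 t : 0 <= g t by rewrite mulr_ge0 // ltW.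
have gi : lam.-integrable `[0, T]%classic (EFin \o g) by exact: (integrableZl (mu := lam) mT c0 g0i).
have := flow_reparametrize cS intS mobM fl T0 k0 mg gg0 gi.
have -> : kappa * T + \int[lam]_(t in `[0, T]%classic) g t = T'.
  rewrite RintegralZl // -/L' /kappa /c0; field.
  by rewrite !gt_eqF.
move=> [m' [w' [fl' m0' mT' E']]].
exists (m', w'); first by apply: flow_between; rewrite ?m0' ?mT'.
have -> : energy S M T' (m', w') = (\int[lam]_(t in `[0%R, T]%classic) (((kappa + g t)^-1)%:E * P t))%E by exact: E'.
have kg t : 0 < kappa + g t by rewrite ltr_wpDr.
have step : (\int[lam]_(t in `[0%R, T]%classic) (((kappa + g t)^-1)%:E * P t) <= (c0^-1)%:E * L'%:E)%E.
  have ci0 : 0 <= c0^-1 by rewrite invr_ge0 ltW.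
  rewrite -L'E -ge0_integralZl_EFin //; last exact: measurable_funTS.
  apply: (@ae_ge0_le_integral _ _ R lam `[0, T]%classic mT).
  - by move=> t _; rewrite mule_ge0 // lee_fin invr_ge0 ltW.
  - apply: measurable_funTS; apply: emeasurable_funM => //; apply/measurable_EFinP.
    by apply: measurable_inv_pos => //; exact: measurable_funD.
  - by move=> t _; rewrite mule_ge0 // lee_fin.
  - by apply: measurable_funeM; exact: measurable_funTS.
  apply: (ae_impl _ sfin) => t h tT.
  have sE : s t = (g0 t)%:E by rewrite /g0 fineK // h.
  have PtE : P t = (g0 t ^+ 2)%:E by rewrite -(sqr_sqrte (PP t)) -/(s t) sE EFin_expe.
  rewrite sE PtE -!EFinM lee_fin mulrC ler_pdivrMr //.
  have -> : c0^-1 * g0 t * (kappa + g t) = g0 t * (e / T) + g0 t ^+ 2.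
    by rewrite /kappa /g; field; rewrite !gt_eqF.
  by rewrite lerDr mulr_ge0 // divr_ge0 // ltW.
have T'E : (0 <= T'%:E)%E by rewrite lee_fin ltW.
apply: le_trans (lee_wpmul2l T'E step) _.
rewrite -!EFinM lee_fin.
have -> : T' * (c0^-1 * L') = (e + L') * L' by rewrite /c0; field; rewrite !gt_eqF.
rewrite expr2; apply: ler_pM => //; [exact: ltW | by rewrite addrC lerD2r | by apply: le_trans L'L _; rewrite lerDl ltW].
Qed.

Lemma length_le_energy T mu nu c : 0 < T -> curves_between S T mu nu c ->
  (curve_length T c <= sqrte (T%:E * energy S M T c))%E.
Proof.
move=> T0 cb; have [m [w [fl _ _ _ PE]]] := between_flow T0 cb.
rewrite (length_flow PE) (energy_flow PE); have [mm mw Sm _ _] := fl.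
have mT : measurable `[0, T]%classic by exact: measurable_itv.
pose P t := Phi S M (m t) (w t).
have PP t : (0 <= P t)%E by exact: P0.
have mP : measurable_fun setT P by exact: (measurable_flow_Phi cS intS mobM fl).
have ms : measurable_fun setT (fun t => sqrte (P t)) by exact: measurable_sqrte.
set E := (\int[lam]_(t in _) _)%E in |- *.
set E' := (X in sqrte (_ * X)%E).
have E'0 : (0 <= E')%E by apply: integral_ge0 => t _; exact: PP.
have [fE|] := boolP (E' \is a fin_num); last first.
  rewrite ge0_fin_numE // -leNgt leye_eq => /eqP ->.
  by rewrite gt0_muley ?lte_fin //= leey.
rewrite -(fineK fE) -EFinM /=; set q := fine E'.
have q0 : 0 <= q by rewrite fine_ge0.
apply/lee_addgt0Pr => e e0.
(* Cauchy-Schwarz, from AM-GM with the free parameter [a], whose best value is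
   [b / T] up to [e] *)
have amgm (a : R) : 0 < a -> ((2 * a)%:E * E <= (a ^+ 2 * T + q)%:E)%E.
  move=> a0; have a2 : 0 <= 2 * a by rewrite mulr_ge0 // ltW.
  have -> : ((a ^+ 2 * T + q)%:E = \int[lam]_(t in `[0%R, T]%classic) ((a ^+ 2)%:E + P t))%E.
    rewrite ge0_integralD //; [|by move=> t _; rewrite lee_fin sqr_ge0|exact: measurable_funTS].
    rewrite integral_cst // [X in (_ * X + _)%E](lebesgue_itv_cc (ltW T0)) subr0 -/E' -(fineK fE).
    by rewrite -EFinM -EFinD.
  rewrite -ge0_integralZl_EFin //; [|by move=> t _; exact: sqrte_ge0|exact: measurable_funTS].
  apply: ge0_le_integral => //.
  - by move=> t _; rewrite mule_ge0 ?sqrte_ge0 // lee_fin.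
  - by apply: measurable_funeM; exact: measurable_funTS.
  - by apply: emeasurable_funD; [exact: measurable_cst | exact: measurable_funTS].
  move=> t _; rewrite -/(P t) -{2}(sqr_sqrte (PP t)) expe2; have := sqrte_ge0 (P t).
  case: (sqrte (P t)) => [x| |] // x0; last by rewrite mulyy addey // leey.
  rewrite -!EFinM -EFinD lee_fin -[x * x]expr2.
  have := sqr_ge0 (a - x); rewrite sqrrB -mulr_natl; lra.
have Tq : 0 <= T * q by rewrite mulr_ge0 // ltW.
pose b := Num.sqrt (T * q) + e.
have b0 : 0 < b by rewrite ltr_wpDl // sqrtr_ge0.
have bq : T * q <= b ^+ 2.
  have := sqr_sqrtr Tq; have := sqrtr_ge0 (T * q); rewrite /b; set r := Num.sqrt _ => r0 rE.
  by rewrite -rE sqrrD; have := mulr_ge0 r0 (ltW e0); have := sqr_ge0 e; rewrite -mulr_natl; lra.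
have a0 : 0 < b / T by rewrite divr_gt0.
have := amgm _ a0.
have E0 : (0 <= E)%E by apply: integral_ge0 => t _; exact: sqrte_ge0.
have h2 : (b / T) ^+ 2 * T + q <= (2 * (b / T)) * b.
  have -> : (b / T) ^+ 2 * T = b ^+ 2 / T by field; rewrite gt_eqF.
  have -> : 2 * (b / T) * b = b ^+ 2 / T + b ^+ 2 / T by ring.
  by rewrite lerD2l ler_pdivlMr // mulrC.
move=> /le_trans/(_ (_ : (_ <= ((2 * (b / T)) * b)%:E)%E)); rewrite lee_fin => /(_ h2).
have p0 : 0 < 2 * (b / T) by rewrite mulr_gt0.
move: (2 * (b / T)) p0 => p p0; rewrite EFinM lee_pmul2l ?lte_fin //.
Qed.

Let sqinf (T : R) mu nu : \bar R := ereal_inf [set (T%:E * energy S M T c)%E | c in curves_between S T mu nu].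
Let infl (T : R) mu nu : \bar R := ereal_inf [set curve_length T c | c in curves_between S T mu nu].

Lemma energy_ge0 T c : curves S T c -> (0 <= energy S M T c)%E.
Proof.
move=> [Smu _ _ _ _]; apply: integral_ge0 => t; rewrite /= in_itv /= => tT.
have [_ Sm] := Smu t tT; rewrite (Phi_action cS intS mobM) //.
by apply: integral_ge0 => x _; exact: action_density_ge0.
Qed.

Let sqinf_ge0 T mu nu : 0 < T -> (0 <= sqinf T mu nu)%E.
Proof.
move=> T0; apply: le_ereal_inf_tmp => _ [c [cc _ _] <-].
by rewrite mule_ge0 ?energy_ge0 // lee_fin ltW.
Qed.

Let length_ge0 T c : (0 <= curve_length T c)%E.
Proof. by apply: integral_ge0 => t _; exact: sqrte_ge0. Qed.

Let infl_le T mu nu : 0 < T -> (infl T mu nu <= sqrte (sqinf T mu nu))%E.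
Proof.
move=> T0.
have l0 : (0 <= infl T mu nu)%E by apply: le_ereal_inf_tmp => _ [c _ <-]; exact: length_ge0.
rewrite -(gee0_abs l0) -sqrte_sqr lee_sqrt; last exact: sqinf_ge0.
apply: le_ereal_inf_tmp => _ [c cb <-].
have cc : curves S T c by have [] := cb.
have TE : (0 <= T%:E * energy S M T c)%E by rewrite mule_ge0 ?energy_ge0 // lee_fin ltW.
rewrite -lee_sqrt // sqrte_sqr gee0_abs //.
apply: le_trans (length_le_energy T0 cb); apply: ereal_inf_lbound; by exists c.
Qed.

Let le_infl T T' mu nu : 0 < T -> 0 < T' -> (sqrte (sqinf T' mu nu) <= infl T mu nu)%E.
Proof.
move=> T0 T'0; apply: le_ereal_inf_tmp => _ [c cb <-].
have := length_ge0 T c; case el : (curve_length T c) => [L| |] // L0; last exact: leey.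
have {}L0 : 0 <= L by rewrite -lee_fin.
apply/lee_addgt0Pr => e e0; rewrite -EFinD.
have hL : (curve_length T c <= L%:E)%E by rewrite el.
have [c' cb' hE] := arc_length T0 T'0 e0 cb hL.
have Le : 0 <= L + e by rewrite addr_ge0 // ltW.
have -> : (L + e)%:E = sqrte (((L + e) ^+ 2)%:E) by rewrite EFin_expe sqrte_sqr gee0_abs // lee_fin.
rewrite lee_sqrt ?lee_fin ?sqr_ge0 //; apply: le_trans hE.
by apply: ereal_inf_lbound; exists c'.
Qed.

Let WM_sqinf mu nu : WM S M mu nu = sqrte (sqinf 1 mu nu).
Proof.
rewrite /WM /min_energy /sqinf; congr sqrte; congr ereal_inf.
by apply/seteqP; split => _ [c cb <-]; exists c => //; rewrite mul1e.
Qed.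

(** [infl <= sqrte sqinf] by Cauchy-Schwarz for equal durations, and
    [sqrte sqinf <= infl] by arc length for arbitrary ones. *)
Lemma WM_length T mu nu : 0 < T ->
  WM S M mu nu = sqrte (sqinf T mu nu) /\ WM S M mu nu = infl T mu nu.
Proof.
move=> T0; have l1 := infl_le mu nu T0; have l2 := le_infl mu nu T0 T0.
have l3 := le_infl mu nu T0 (@ltr01 R); have l4 := infl_le mu nu (@ltr01 R).
have l5 := le_infl mu nu (@ltr01 R) T0.
have e1 : infl T mu nu = sqrte (sqinf T mu nu) by apply/eqP; rewrite eq_le l1 l2.
have e2 : WM S M mu nu = sqrte (sqinf T mu nu).
  rewrite WM_sqinf; apply/eqP; rewrite eq_le (le_trans l3 l1) /=; exact: le_trans l5 l4.
by split; rewrite ?e1.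
Qed.

End Transport.

(** * Minimizers as geodesics *)

Section Geodesics.
Context {R : realType} {n : nat}.
Local Notation lam := (@lebesgue_measure R).
Variables (S : set 'cV[R]_n) (M : 'cV[R]_n -> 'M[R]_n).
Hypotheses (cS : convex_set S) (kS : compact S) (intS : S° !=set0) (mobM : mobility S M).
Implicit Types (m w : R -> R -> 'cV[R]_n) (mu nu : R -> 'cV[R]_n).

Let mcc (a b : R) : measurable `[a, b]%classic. Proof. exact: measurable_itv. Qed.

Lemma min_energy_ae mu nu mu' nu' : ae_equal mu mu' -> ae_equal nu nu' -> min_energy S M mu nu = min_energy S M mu' nu'.
Proof.
move=> h k; congr ereal_inf; apply/seteqP; split => _ [c [cc h0 h1] <-]; exists c => //; split.
- exact: cc.
- exact: ae_equal_trans h.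
- exact: ae_equal_trans k.
- exact: cc.
- by apply: ae_equal_trans h0 _; exact: ae_equal_sym.
- by apply: ae_equal_trans h1 _; exact: ae_equal_sym.
Qed.

Lemma energy_of_flow T m w : energy S M T (m, w) = (\int[lam]_(t in `[0%R, T]%classic) Phi S M (m t) (w t))%E.
Proof. by []. Qed.

Let min_energy_le_rev mu nu : (min_energy S M nu mu <= min_energy S M mu nu)%E.
Proof.
apply: le_ereal_inf_tmp => _ [c cb <-].
have [m [w [fl h0 h1 _ PE]]] := between_flow cS kS intS mobM (@ltr01 R) cb.
have [rf rE] := flow_reverse cS intS mobM fl.
have [sf sE] := flow_shift cS intS mobM (- 1) rf.
have e0 : - ((0 : R) + - 1) = 1 by ring.
have e1 : - ((1 : R) + - 1) = 0 by ring.
have b1 : ae_equal (m (- (0 + - 1))) nu by rewrite e0.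
have b0 : ae_equal (m (- (1 + - 1))) mu by rewrite e1.
have := flow_between kS (@ltr01 R) sf b1 b0 => cb'.
apply: ereal_inf_lbound; exists (fun u : R => m (- (u + - 1)), fun (u : R) x => - w (- (u + - 1)) x); first exact: cb'.
rewrite energy_of_flow (energy_flow PE).
have h : (0 : R) + - 1 <= 1 + - 1 by rewrite lerD2r.
have rh := rE _ _ h; rewrite e0 e1 in rh.
exact: (etrans (sE 0 1 (@ler01 R)) rh).
Qed.

Lemma min_energy_sym mu nu : min_energy S M nu mu = min_energy S M mu nu.
Proof. by apply/eqP; rewrite eq_le !min_energy_le_rev. Qed.

Lemma min_energy_refl mu : Mfun S mu -> min_energy S M mu mu = 0%E.
Proof.
move=> Smu; have [fl P0] := flow_constant cS intS mobM Smu.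
apply/eqP; rewrite eq_le; apply/andP; split; last first.
  by apply: le_ereal_inf_tmp => _ [c [cc _ _] <-]; exact: (energy_ge0 cS intS mobM cc).
apply: ereal_inf_lbound; exists (fun=> mu, fun _ _ => 0).
  exact: (flow_between kS (@ltr01 R) fl (ae_equal_refl mu) (ae_equal_refl mu)).
by rewrite energy_of_flow; apply: integral0_eq => t _; exact: P0.
Qed.

(** Curves of almost minimal energy give the competitors that
    [minimizer_of_almost] asks for. *)
Lemma minimizer_exists mu nu : Mfun S mu -> Mfun S nu -> min_energy S M mu nu \is a fin_num ->
  exists2 c, curves_between S 1 mu nu c & energy S M 1 c = min_energy S M mu nu.
Proof.
move=> Smu Snu fE; have WE := fineK fE; set W := fine _ in WE.
have almost e : 0 < e -> exists m w, [/\ competitor S mu nu m w & (plane_energy M m w <= (W + e)%:E)%E].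
  move=> e0; have [_ [c cb <-] hlt] := lb_ereal_inf_adherent e0 fE.
  have [m [w [fl h0 h1 _ PE]]] := between_flow cS kS intS mobM (@ltr01 R) cb.
  have [bm bw Sm _ _] := fl.
  exists m, w; split; first exact: (flow_competitor kS fl Smu Snu h0 h1).
  rewrite (plane_energyE cS intS mobM bm bw Sm) -(energy_flow PE) EFinD WE; exact: ltW.
have [c [cb hc]] := minimizer_of_almost cS kS intS mobM Smu Snu almost.
exists c; first exact: cb.
apply/eqP; rewrite eq_le -{1}WE hc /=.
by apply: ereal_inf_lbound; exists c.
Qed.

(** Equality in Cauchy-Schwarz: the length is at least [sqrt W] and the energy
    is [W], so the variance of the speed vanishes. *)
Lemma minimizer_speed mu nu m w (W : R) : flow S m w -> ae_equal (m 0) mu -> ae_equal (m 1) nu ->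
  min_energy S M mu nu = W%:E -> energy S M 1 (m, w) = W%:E ->
  {ae lam, forall t, 0 <= t <= 1 -> Phi S M (m t) (w t) = W%:E}.
Proof.
move=> fl h0 h1 mE EW; have cb := flow_between kS (@ltr01 R) fl h0 h1.
have W0 : 0 <= W by rewrite -lee_fin -EW; case: cb => cc _ _; exact: (energy_ge0 cS intS mobM cc).
have [_ _ Sm _ _] := fl.
pose P t := Phi S M (m t) (w t).
have PP t : (0 <= P t)%E by apply: (Phi_ge0 cS intS mobM).
have mP : measurable_fun setT P by exact: (measurable_flow_Phi cS intS mobM fl).
have EP : (\int[lam]_(t in `[0%R, 1%R]%classic) P t = W%:E)%E by exact: EW.
pose s t := sqrte (P t).
have ms : measurable_fun setT s by exact: measurable_sqrte.
have s0 t : (0 <= s t)%E by exact: sqrte_ge0.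
pose r := Num.sqrt W; have r0 : 0 <= r by exact: sqrtr_ge0.
have rW : r ^+ 2 = W by exact: sqr_sqrtr.
have ls : (r%:E <= \int[lam]_(t in `[0%R, 1%R]%classic) s t)%E.
  have [_ eL] := WM_length cS kS intS mobM mu nu (@ltr01 R).
  have -> : r%:E = WM S M mu nu by rewrite /WM mE.
  by rewrite eL; apply: ereal_inf_lbound; exists (m, w).
have Pi : lam.-integrable `[0, 1]%classic P.
  apply/integrableP; split; first exact: measurable_funTS.
  under eq_integral do rewrite gee0_abs //.
  by rewrite EP ltry.
have Pfin := integrable_ae (mu := lam) (mcc 0 1) Pi.
pose h t : \bar R := ((fine (s t) - r) ^+ 2)%:E.
have h0' t : (0 <= h t)%E by rewrite lee_fin sqr_ge0.
have mh : measurable_fun setT h.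
  apply/measurable_EFinP; apply: measurable_funX; apply: measurable_funB => //.
  by apply: (measurableT_comp (f := fine)); [exact: fine_measurable | exact: ms].
have hs t : P t \is a fin_num -> (h t + (2 * r)%:E * s t = P t + W%:E)%E.
  move=> Pt; have sf : s t \is a fin_num by rewrite /s sqrte_fin_num.
  have gE := fineK sf; have : (P t = s t ^+ 2)%E by rewrite /s sqr_sqrte.
  rewrite /h -gE; move: (fine (s t)) => g ->.
  rewrite -EFin_expe /= -EFinM -!EFinD; congr EFin; rewrite -rW; ring.
have rr0 : 0 <= 2 * r by rewrite mulr_ge0.
have c0 : (0 <= (2 * r)%:E)%E by rewrite lee_fin.
have cs0 t : (0 <= (2 * r)%:E * s t)%E by rewrite mule_ge0.
have mcs : measurable_fun setT (fun t => (2 * r)%:E * s t)%E by exact: measurable_funeM.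
have I : (\int[lam]_(t in `[0%R, 1%R]%classic) h t + (2 * r)%:E * \int[lam]_(t in `[0%R, 1%R]%classic) s t = (W + W)%:E)%E.
  have eZ := @ge0_integralZl_EFin _ _ R lam _ (mcc 0 1) s (fun u _ => s0 u) (measurable_funTS ms) (2 * r) rr0.
  have eD := @ge0_integralD _ _ R lam _ (mcc 0 1) h (fun u => (2 * r)%:E * s u)%E
    (fun u _ => h0' u) (measurable_funTS mh) (fun u _ => cs0 u) (measurable_funTS mcs).
  rewrite -eZ -eD.
  rewrite EFinD -{1}EP.
  have eW : W%:E = (\int[lam]_(t in `[0%R, 1%R]%classic) W%:E)%E.
    by rewrite integral_cst // [X in (_ * X)%E](lebesgue_itv_cc (@ler01 R)) subr0 mule1.
  have W0' : (0 <= W%:E)%E by rewrite lee_fin.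
  have eD' := @ge0_integralD _ _ R lam _ (mcc 0 1) P (cst W%:E)
    (fun u _ => PP u) (measurable_funTS mP) (fun u _ => W0') (measurable_cst _).
  rewrite [X in (_ + X)%E]eW -eD'.
  apply: (@ae_eq_integral _ _ R lam `[0, 1]%classic _ _ (mcc 0 1)).
  - by apply: measurable_funTS; exact: emeasurable_funD.
  - by apply: measurable_funTS; apply: emeasurable_funD; [exact: mP | exact: measurable_cst].
  by apply: (ae_impl _ Pfin) => t ht tI; apply: hs; exact: ht.
have hz : (\int[lam]_(t in `[0%R, 1%R]%classic) `|h t| = 0)%E.
  under eq_integral do rewrite gee0_abs //.
  apply/eqP; rewrite eq_le; apply/andP; split; last by apply: integral_ge0.
  have ih0 : (0 <= \int[lam]_(t in `[0%R, 1%R]%classic) h t)%E by apply: integral_ge0.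
  have rr : 2 * r * r = W + W by rewrite -rW; ring.
  move: I ih0 ls; case: (\int[lam]_(t in _) h t)%E => [a| |]; case: (\int[lam]_(t in _) s t)%E => [b| |].
  - rewrite -!EFinM -EFinD => -[e]; rewrite !lee_fin => _ /(ler_wpM2l rr0); lra.
  - have [r00|rn] := eqVneq r 0; first by rewrite r00 mulr0 mul0e adde0 => -[->]; rewrite lee_fin -rr r00 mulr0.
    by rewrite gt0_muley // lte_fin mulr_gt0 // lt_def rn.
  - by [].
  - by rewrite -!EFinM.
  - have [r00|rn] := eqVneq r 0; first by rewrite r00 mulr0 mul0e adde0.
    by rewrite gt0_muley // lte_fin mulr_gt0 // lt_def rn.
  - by [].
  - by [].
  - by [].
  - by [].
have mhD : measurable_fun (`[0, 1]%classic : set R) h by exact: measurable_funTS.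
have [hae _] := @ae_eq_integral_abs _ _ R lam _ (mcc 0 1) h mhD.
apply: (ae_impl2 _ Pfin (hae hz)) => t Pt ht tI.
have tI' : `[0, 1]%classic t by rewrite /= in_itv.
have sf : s t \is a fin_num by rewrite /s sqrte_fin_num //; exact: Pt.
have := ht tI'; rewrite /h => -[] /eqP; rewrite sqrf_eq0 subr_eq0 => /eqP g.
change (P t = W%:E); rewrite -(sqr_sqrte (PP t)) -/(s t) -(fineK sf) g.
by rewrite -EFin_expe rW.
Qed.

Let integral_tile (f : R -> \bar R) s t : measurable_fun setT f -> (forall u, 0 <= f u)%E -> 0 <= s -> s <= t -> t <= 1 ->
  (\int[lam]_(u in `[0%R, 1%R]%classic) f u = \int[lam]_(u in `[0%R, s[%classic) f u +
   (\int[lam]_(u in `[s, t[%classic) f u + \int[lam]_(u in `[t, 1%R]%classic) f u))%E.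
Proof.
move=> mf f0 s0 st t1.
have e2 : `[s, 1]%classic = `[s, t[%classic `|` `[t, 1]%classic.
  by rewrite -itv_bndbnd_setU // bnd_simp.
have e1 : `[0, 1]%classic = `[0, s[%classic `|` `[s, 1]%classic.
  by rewrite -itv_bndbnd_setU // bnd_simp // (le_trans st).
have d1 : [disjoint `[0, s[%classic & `[s, 1]%classic].
  by apply/disj_set2P/seteqP; split => x //= []; rewrite !in_itv /= => /andP[_ a] /andP[b _]; move: a; rewrite ltNge b.
have d2 : [disjoint `[s, t[%classic & `[t, 1]%classic].
  by apply/disj_set2P/seteqP; split => x //= []; rewrite !in_itv /= => /andP[_ a] /andP[b _]; move: a; rewrite ltNge b.
rewrite e1 (@ge0_integral_setU _ _ R lam _ _ (measurable_itv _) (measurable_itv _) f (measurable_funTS mf) (fun u _ => f0 u) d1).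
congr (_ + _)%E; rewrite e2.
exact: (@ge0_integral_setU _ _ R lam _ _ (measurable_itv _) (measurable_itv _) f (measurable_funTS mf) (fun u _ => f0 u) d2).
Qed.

(** The restriction of the minimizer has constant speed, which gives [<=]. A
    cheaper curve between the two times could be inserted there, and would beat
    the minimizer. *)
Lemma minimizer_subcurve mu nu m w (W : R) s t : flow S m w -> ae_equal (m 0) mu -> ae_equal (m 1) nu ->
  min_energy S M mu nu = W%:E -> 0 <= W -> {ae lam, forall t, 0 <= t <= 1 -> Phi S M (m t) (w t) = W%:E} ->
  0 <= s -> s < t -> t <= 1 -> WM S M (m s) (m t) = ((t - s)%:E * sqrte W%:E)%E.
Proof.
move=> fl h0 h1 mE W0 PW s0 st t1.
have d0 : 0 < t - s by rewrite subr_gt0.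
have d0E : (0 <= (t - s)%:E)%E by rewrite lee_fin ltW.
have [_ _ Sm _ _] := fl.
pose P t := Phi S M (m t) (w t).
have PP u : (0 <= P u)%E by apply: (Phi_ge0 cS intS mobM).
have mP : measurable_fun setT P by exact: (measurable_flow_Phi cS intS mobM fl).
have intP (D : set R) : measurable D -> D `<=` `[0, 1]%classic -> (\int[lam]_(u in D) P u = W%:E * lam D)%E.
  move=> mD D1; rewrite -(integral_cst lam) //.
  apply: (@ae_eq_integral _ _ R lam D _ _ mD); [exact: measurable_funTS | exact: measurable_cst | ].
  by apply: (ae_impl _ PW) => u hu uD; apply: hu; have := D1 _ uD; rewrite /= in_itv.
have [e _] := WM_length cS kS intS mobM (m s) (m t) d0.
have -> : ((t - s)%:E * sqrte W%:E)%E = sqrte ((t - s)%:E * ((t - s)%:E * W%:E)).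
  by rewrite muleA sqrteM ?mule_ge0 // -expe2 sqrte_sqr gee0_abs.
rewrite e; congr sqrte; apply/eqP; rewrite eq_le; apply/andP; split.
  have [sf sE] := flow_shift cS intS mobM s fl.
  have b0 : ae_equal (m (0 + s)) (m s) by rewrite add0r; exact: ae_equal_refl.
  have b1 : ae_equal (m (t - s + s)) (m t) by rewrite subrK; exact: ae_equal_refl.
  apply: ereal_inf_lbound; exists (fun u => m (u + s), fun u => w (u + s)); first exact: (flow_between kS d0 sf b0 b1).
  congr (_ * _)%E; rewrite energy_of_flow; have := sE 0 (t - s) (ltW d0) => ->.
  rewrite add0r subrK; have := intP `[s, t]%classic => ->; [|exact: measurable_itv|].
    by rewrite lebesgue_itv_cc ?(ltW st) // muleC.
  by move=> u /=; rewrite !in_itv /= => /andP[a b]; rewrite (le_trans s0 a) (le_trans b t1).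
apply: le_ereal_inf_tmp => _ [c cb <-]; apply: lee_wpmul2l => //.
have [m2 [w2 [fl2 k0 k1 _ PE]]] := between_flow cS kS intS mobM d0 cb.
rewrite (energy_flow PE).
have [sf sE] := flow_shift cS intS mobM (- s) fl2.
pose m' u := m2 (u + - s); pose w' u := w2 (u + - s).
have j1 : ae_equal (m s) (m' s).
  by rewrite /m' subrr; exact: ae_equal_sym.
have gl1 := flow_splice fl sf j1.
have j2 : ae_equal (splice s m m' t) (m t) by rewrite splice_ge ?(ltW st) //; exact: k1.
have gl2 := flow_splice gl1 fl j2.
pose F := splice t (splice s m m') m; pose G := splice t (splice s w w') w.
have flF : flow S F G by exact: gl2.
have f0 : ae_equal (F 0) mu.
  have t0 : 0 < t by exact: le_lt_trans st.
  rewrite /F splice_lt //; have [sp|sn] := ltP 0 s; first by rewrite splice_lt.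
  have sz : s = 0 by apply/eqP; rewrite eq_le sn s0.
  have m's : m' 0 = m' s by rewrite sz.
  rewrite splice_ge // m's; apply: ae_equal_trans (ae_equal_sym j1) _; rewrite sz; exact: h0.
have f1 : ae_equal (F 1) nu by rewrite /F splice_ge.
have : (W%:E <= energy S M 1 (F, G))%E.
  by rewrite -mE; apply: ereal_inf_lbound; exists (F, G) => //; exact: (flow_between kS (@ltr01 R) flF f0 f1).
rewrite energy_of_flow.
pose Q u := Phi S M (F u) (G u).
have [_ _ SF _ _] := flF; have [_ _ S2 _ _] := fl2.
have QQ u : (0 <= Q u)%E by apply: (Phi_ge0 cS intS mobM).
have mQ : measurable_fun setT Q by exact: (measurable_flow_Phi cS intS mobM flF).
rewrite (integral_tile mQ QQ s0 (ltW st) t1).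
have Q1 u : u < s -> Q u = P u.
  move=> us; have ut := lt_trans us st.
  have a : F u = m u by rewrite /F (splice_lt _ _ ut) (splice_lt _ _ us).
  have b : G u = w u by rewrite /G (splice_lt _ _ ut) (splice_lt _ _ us).
  exact: (congr2 (Phi S M) a b).
have Q2 u : s <= u -> u < t -> Q u = Phi S M (m' u) (w' u).
  move=> su ut.
  have a : F u = m' u by rewrite /F (splice_lt _ _ ut) (splice_ge _ _ su).
  have b : G u = w' u by rewrite /G (splice_lt _ _ ut) (splice_ge _ _ su).
  exact: (congr2 (Phi S M) a b).
have Q3 u : t <= u -> Q u = P u.
  move=> tu.
  have a : F u = m u by rewrite /F (splice_ge _ _ tu).
  have b : G u = w u by rewrite /G (splice_ge _ _ tu).
  exact: (congr2 (Phi S M) a b).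
have -> : (\int[lam]_(u in `[0%R, s[%classic) Q u = W%:E * s%:E)%E.
  transitivity (\int[lam]_(u in `[0%R, s[%classic) P u)%E.
    by apply: eq_integral => u; rewrite inE /= in_itv /= => /andP[_ us]; exact: Q1.
  rewrite intP; [|exact: measurable_itv|].
    rewrite lebesgue_measure_itv /= lte_fin sube0.
    by case: ltP => // sn; congr (_ * _%:E)%E; apply/eqP; rewrite eq_le sn s0.
  by move=> u /=; rewrite !in_itv /= => /andP[-> b] /=; rewrite (le_trans (ltW b)) // (le_trans (ltW st)).
have -> : (\int[lam]_(u in `[t, 1%R]%classic) Q u = W%:E * (1 - t)%:E)%E.
  transitivity (\int[lam]_(u in `[t, 1%R]%classic) P u)%E.
    by apply: eq_integral => u; rewrite inE /= in_itv /= => /andP[tu _]; exact: Q3.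
  rewrite intP; [|exact: measurable_itv|]; first by rewrite lebesgue_itv_cc.
  by move=> u /=; rewrite !in_itv /= => /andP[b ->]; rewrite (le_trans _ b) // (le_trans s0 (ltW st)).
set B := (\int[lam]_(u in `[s, t[%classic) Q u)%E.
set E2 := (\int[lam]_(u in _) _)%E.
have BE : (B <= E2)%E.
  have mP2 : measurable_fun setT (fun u => Phi S M (m' u) (w' u)) by exact: (measurable_flow_Phi cS intS mobM sf).
  have P20 u : (0 <= Phi S M (m' u) (w' u))%E by apply: (Phi_ge0 cS intS mobM) => x; exact: S2.
  have -> : B = (\int[lam]_(u in `[s, t[%classic) Phi S M (m' u) (w' u))%E.
    by apply: eq_integral => u; rewrite inE /= in_itv /= => /andP[su ut]; exact: Q2.
  have -> : E2 = (\int[lam]_(u in `[s, t]%classic) Phi S M (m' u) (w' u))%E.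
    have sE' := sE s t (ltW st); rewrite subrr in sE'.
    exact: (esym sE').
  apply: ge0_subset_integral; [exact: measurable_itv | exact: measurable_itv | exact: measurable_funTS mP2 | by move=> u _; exact: P20 | ].
  by move=> u /=; rewrite !in_itv /= => /andP[-> /ltW ->].
have E20 : (0 <= E2)%E by apply: integral_ge0 => u _; apply: (Phi_ge0 cS intS mobM).
have B0 : (0 <= B)%E by apply: integral_ge0 => u _; exact: QQ.
move: BE; case: E2 E20 => [q| |] // _; last by move=> _ _; rewrite leey.
move: B B0 => [b| |] // _; rewrite -!EFinM -!EFinD !lee_fin => bq hW; lra.
Qed.

End Geodesics.

Theorem proposition4p10 (R : realType) (n : nat)
    (S : set 'cV[R]_n) (M : 'cV[R]_n -> 'M[R]_n)
    (convexS : convex_set S) (compactS : compact S) (intS : S° !=set0)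
    (mobM : mobility S M)
    (mu0 mu1 : R -> 'cV[R]_n) (Smu0 : Mfun S mu0) (Smu1 : Mfun S mu1) :
  (min_energy S M mu0 mu1 \is a fin_num ->
   exists c : curve,
     [/\ curves_between S 1 mu0 mu1 c,
         energy S M 1 c = min_energy S M mu0 mu1,
         {ae (@lebesgue_measure R), forall t, 0 < t < 1 ->
            Phi S M (c.1 t) (c.2 t) = min_energy S M mu0 mu1} &
         forall s t : R, 0 <= s <= 1 -> 0 <= t <= 1 ->
           WM S M (c.1 s) (c.1 t) = (`|t - s|%:E * WM S M mu0 mu1)%E]) /\
  (forall T : R, 0 < T ->
     WM S M mu0 mu1 =
       sqrte (ereal_inf [set (T%:E * energy S M T c)%E
                        | c in curves_between S T mu0 mu1]) /\
     WM S M mu0 mu1 =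
       ereal_inf [set (\int[lebesgue_measure]_(t in `[0%R, T]%classic)
                         sqrte (Phi S M (c.1 t) (c.2 t)))%E
                 | c in curves_between S T mu0 mu1]).
Proof.
split; last by move=> T T0; exact: (WM_length convexS compactS intS mobM mu0 mu1 T0).
move=> fE; have [c cb cE] := minimizer_exists convexS compactS intS mobM Smu0 Smu1 fE.
have [m [w [fl h0 h1 mc PE]]] := between_flow convexS compactS intS mobM (@ltr01 R) cb.
have WE := esym (fineK fE); set W := fine _ in WE.
have EW : energy S M 1 (m, w) = W%:E.
  by rewrite -WE -cE (energy_flow PE).
have W0 : 0 <= W.
  by rewrite -lee_fin -EW; have [cc _ _] := flow_between compactS (@ltr01 R) fl h0 h1; exact: (energy_ge0 convexS intS mobM cc).
have PW := minimizer_speed convexS compactS intS mobM fl h0 h1 WE EW.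
have geo s t : 0 <= s -> s < t -> t <= 1 -> WM S M (m s) (m t) = ((t - s)%:E * sqrte W%:E)%E.
  exact: (minimizer_subcurve convexS compactS intS mobM fl h0 h1 WE W0 PW).
exists c; split; [exact: cb | exact: cE | | ].
  apply: (ae_impl _ PW) => t ht /andP[t0 t1].
  have tI : 0 <= t <= 1 by rewrite !ltW.
  by rewrite (PE t tI) WE; exact: ht.
move=> s t sI tI.
have -> : WM S M (c.1 s) (c.1 t) = WM S M (m s) (m t).
  by rewrite /WM (min_energy_ae S M (mc s sI) (mc t tI)).
rewrite [WM S M mu0 mu1]/WM WE; move: sI tI => /andP[s0 s1] /andP[t0 t1].
case: (ltgtP s t) => st.
- by rewrite geo // gtr0_norm // subr_gt0.
- by rewrite /WM min_energy_sym // -/(WM S M (m t) (m s)) geo // ltr0_norm ?subr_lt0 // opprB.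
rewrite st subrr normr0 mul0e /WM min_energy_refl //; first by rewrite /= sqrtr0.
have [mm _ Sm _ _] := fl; split => [i|x]; [exact: (measurable_section t (mm i)) | exact: Sm].
Qed.
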